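(* Suppose that $\Lambda\prec\Psi$ for some admissible control parameter $\Psi$, that $\Delta$ is an admissible graph, and that $w$ is a weight adapted to $\Delta$. Then for all $F\subset V_s(\Delta)$ and all $\boldsymbol\mu\in\{1,\dots,N\}^{V_e(\Delta)}$ we have $$X_F^{w,\boldsymbol\mu}(\Delta)\;\prec\;\Psi^{\deg(\Delta)+|F|}.$$
   Context: **Random matrix.** For each $N\in\mathbb N$ let $(h_{ij} : 1\le i\le j\le N)$ be independent complex random variables (depending on $N$) with $\mathbb E h_{ij}=0$ and $h_{ii}\in\mathbb R$; set $h_{ij}=\overline{h_{ji}}$ for $i>j$, so $H=(h_{ij})$ is an $N\times N$ Hermitian matrix. Let $s_{ij}=\mathbb E|h_{ij}|^2$, $M=M_N=1/\max_{i,j}s_{ij}$. Assume $\sum_j s_{ij}=1$ for all $i$, and $N^\delta\le M\le N$ for some fixed $\delta>0$. Let $\zeta_{ij}=s_{ij}^{-1/2}h_{ij}$ (a normalized Gaussian if $s_{ij}=0$); assume that for every $p\in\mathbb N$ there is a constant $\kappa_p$ with $\mathbb E|\zeta_{ij}|^p\le\kappa_p$ for all $N,i,j$. **Resolvent.** For $z=E+\mathrm i\eta$, $\eta>0$: $m=m(z)=\frac1{2\pi}\int_{-2}^2\frac{\sqrt{4-\xi^2}}{\xi-z}\,d\xi$, $G=G(z)=(H-z)^{-1}$, $G^*=(G(z))^*$, $\mathcal G_{ij}=G_{ij}-\delta_{ij}m$, $\mathcal G^*_{ij}=G^*_{ij}-\delta_{ij}\bar m$. Fix $\gamma>0$ small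 and domains $\mathbf S=\mathbf S^{(N)}\subset\{z: -10\le E\le 10,\ M^{-1+\gamma}\le\eta\le10\}$; all $z$-dependent quantities are considered for $z\in\mathbf S$. Let $\Lambda(z)=\max_{x,y}|G_{xy}(z)-\delta_{xy}m(z)|$. **Partial expectation.** $H^{(i)}$ is the matrix obtained from $H$ by setting all entries in row and column $i$ to zero. $P_iX=\mathbb E(X\mid H^{(i)})$, $Q_iX=X-P_iX$. **Stochastic domination.** For random $X=X^{(N)}(u)$ and deterministic $\Psi=\Psi^{(N)}(u)\ge0$, $u\in U^{(N)}$, write $X\prec\Psi$ if for all $\varepsilon>0$, $D>0$ there is $N_0$ such that $\sup_{u}\mathbb P[|X^{(N)}(u)|>N^\varepsilon\Psi^{(N)}(u)]\le N^{-D}$ for $N\ge N_0$. It is always understood to be uniform in all parameters ($z\in\mathbf S$, matrix indices, external indices, weights); $N_0$ depends on $\varepsilon$, $D$ and on the fixed data ($\delta$, $(\kappa_p)$, the graph, etc.). **Control parameters.** A control parameter is a positive deterministic $N$-dependent function $\Psi$ on $\mathbf S$; it is admissible if there is a constant $c>0$ with $M^{-1/2}\le\Psi(z)\le M^{-c}$ for all $N$, $z\in\mathbf S$. **Graphs and monomials.** An admissible graph $\Delta$ is a finite directed multigraph (loops and multiple edges allowed) with vertex set $V(\Delta)=V_s(\Delta)\sqcup V_e(\Delta)$ (summation and external vertices), edge set $E(\Delta)$ with source and target maps $\alpha,\beta:E(\Delta)\to V(\Delta)$, and a colouring $\xi:E(\Delta)\to\{1,*\}$. Its degree is $\deg(\Delta)=|E(\Delta)|$.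 For summation indices $\mathbf a=(a_i)_{i\in V_s(\Delta)}$ and external indices $\boldsymbol\mu=(\mu_i)_{i\in V_e(\Delta)}$, all in $\{1,\dots,N\}$, let $u_i=a_i$ for $i\in V_s(\Delta)$, $u_i=\mu_i$ for $i\in V_e(\Delta)$, and $\mathcal Z^{\boldsymbol\mu}_{\mathbf a}(\Delta)=\prod_{e\in E(\Delta)}\mathcal G^{\xi_e}_{u_{\alpha(e)}u_{\beta(e)}}$ (with $\mathcal G^{1}=\mathcal G$). **Weights.** For a tuple $\mathbf a_J=(a_i)_{i\in J}$ let $\mathcal P(\mathbf a_J)$ be the partition of $J$ given by $k\sim l$ iff $a_k=a_l$. A map $w:\{1,\dots,N\}^{V_s(\Delta)}\to[0,1]$ is a weight adapted to $\Delta$ if for every (possibly trivial) splitting $V_s(\Delta)=I\sqcup J$, with $\mathbf a=(\mathbf a_I,\mathbf a_J)$, and every partition $P$ of $J$, $$\max_{\mathbf a_I}\sum_{\mathbf a_J}\mathbf 1(\mathcal P(\mathbf a_J)=P)\,w(\mathbf a_I,\mathbf a_J)\le M^{|P|-|V_s(\Delta)|},$$ where $|P|$ is the number of blocks of $P$. **Averages.** $X_F^{w,\boldsymbol\mu}(\Delta)=\sum_{\mathbf a}w(\mathbf a)\big[\prod_{i\in F}Q_{a_i}\big]\mathcal Z_{\mathbf a}^{\boldsymbol\mu}(\Delta)$, the sum being over all $\mathbf a\in\{1,\dots,N\}^{V_s(\Delta)}$ whose entries are pairwise distinct and all different from every $\mu_j$, $j\in V_e(\Delta)$. *)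

(* Defs.v *)
From HB Require Import structures.
From mathcomp Require Import all_boot all_order all_algebra.
From mathcomp Require Import all_classical all_reals all_analysis.
From mathcomp Require Import measurable_realfun.
From mathcomp Require Import complex.

Set Implicit Arguments.
Unset Strict Implicit.
Unset Printing Implicit Defensive.

Import Order.TTheory GRing.Theory Num.Theory.
Import numFieldNormedType.Exports.

Local Open Scope classical_set_scope.
Local Open Scope ring_scope.
Local Open Scope complex_scope.

(* The norm of [R[i]] is [R[i]]-valued; [cabs] is the same modulus in [R]. *)
Definition cabs (R : realType) (z : R[i]) : R := complex.Re `|z|.

(* The library has no measurable structure on [R[i]]; Borel sets of the complex
   plane are those of [R * R] through this identification. *)
Definition plane (R : realType) (z : R[i]) : R * R :=
  (complex.Re z, complex.Im z).

Definition cintegral d (T : measurableType d) (R : realType)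
    (mu : {measure set T -> \bar R}) (D : set T) (f : T -> R[i]) : R[i] :=
  Rintegral mu D (fun x => complex.Re (f x)) +i*
  Rintegral mu D (fun x => complex.Im (f x)).

Section probability.
Context d (T : measurableType d) (R : realType) (P : probability T R).

Definition mutually_independent (I : finType) (X : I -> T -> R[i]) : Prop :=
  forall (J : {set I}) (B : I -> set (R * R)),
    (forall k, measurable (B k)) ->
    (P (\bigcap_(k in [set` J]) (@plane R \o X k) @^-1` B k) =
     \prod_(k in J) P ((@plane R \o X k) @^-1` B k))%E.

Definition is_condexp (F : set (set T)) (X Y : T -> R) : Prop :=
  [/\ forall B : set R, measurable B -> F (Y @^-1` B),
      P.-integrable setT (EFin \o Y) &
      forall A, F A ->
        (\int[P]_(w in A) (Y w)%:E = \int[P]_(w in A) (X w)%:E)%E].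

Lemma condexp_exists (F : set (set T)) (X : T -> R) :
    sigma_algebra setT F -> F `<=` measurable ->
    P.-integrable setT (EFin \o X) -> exists Y, is_condexp F X Y.
Proof.
move=> sF subF intX.
pose id' : T -> g_sigma_algebraType F := id.
have FE : @measurable _ (g_sigma_algebraType F) = F by exact: sigma_algebra_id.
have mid : measurable_fun setT id'.
  by move=> _ A; rewrite FE setTI => /subF.
pose mu' : probability (g_sigma_algebraType F) R :=
  distribution P (mfun_Sub (mem_set mid : id' \in mfun)).
pose nu' : {charge set (g_sigma_algebraType F) -> \bar R} :=
  measure_function_pushforward__canonical__charge_Charge (induced_charge intX) mid.
have dom : nu' `<< mu'.
  apply/null_content_dominatesP => A mA muA0.
  have FA : F A by rewrite -FE.
  have mA' : @measurable _ T A by exact: subF.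
  have mX := measurable_funS measurableT (@subsetT _ (A : set T))
    (measurable_int _ intX).
  exact: (null_set_integral mA' mX muA0).
pose f : g_sigma_algebraType F -> \bar R := Radon_Nikodym nu' mu'.
have fin x : f x \is a fin_num by exact: Radon_Nikodym_fin_num.
have intf : mu'.-integrable setT f by exact: Radon_Nikodym_integrable.
have mf : measurable_fun setT f by exact: measurable_int intf.
have mfP : measurable_fun setT (f : T -> \bar R).
  exact: (measurableT_comp mf mid).
have fE : EFin \o (fine \o f) = f by apply/funext => x /=; rewrite fineK.
have intfP : P.-integrable setT (f : T -> \bar R).
  apply/integrableP; split => //.
  move/integrableP : intf => [_]; apply: le_lt_trans.
  rewrite (_ : mu' = pushforward P id' :> (_ -> _))//.
  rewrite ge0_integral_pushforward//; exact: measurableT_comp.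
exists (fine \o f); split; last 2 first.
- by rewrite fE.
- move=> A FA.
  have mA : @measurable _ (g_sigma_algebraType F) A by rewrite FE.
  have := Radon_Nikodym_integral dom mA.
  rewrite -/f -[LHS]/(\int[P]_(w in A) (X w)%:E)%E => ->.
  rewrite [RHS](@integral_pushforward _ _ _ _ _ _ mid P A f)//; last first.
    by apply: integrableS intfP => //; exact: subF.
  by apply: eq_integral => x _; rewrite /= fineK.
- move=> B mB; rewrite -FE -[X in measurable X]setTI.
  exact: (measurableT_comp (@fine_measurable R _ measurableT) mf).
Qed.

(* A version of the conditional expectation, chosen arbitrarily; it is unique
   up to a null set. *)
Definition condexp (F : set (set T)) (X : T -> R) : T -> R :=
  xget (cst 0) [set Y | is_condexp F X Y].

Definition ccondexp (F : set (set T)) (X : T -> R[i]) : T -> R[i] := fun w =>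
  condexp F (fun v => complex.Re (X v)) w +i*
  condexp F (fun v => complex.Im (X v)) w.

End probability.

Section random_matrix.
Context d (T : measurableType d) (R : realType) (P : probability T R).
Variable N : nat.
Variable H : T -> 'M[R[i]]_N.

Definition variance_profile (i j : 'I_N) : R :=
  fine 'E_P[(fun w => cabs (H w i j) ^+ 2)].

Definition bandwidth : R :=
  (\big[Num.max/0]_(i < N) \big[Num.max/0]_(j < N) variance_profile i j)^-1.

(* E|zeta_ij|^p for zeta_ij = s_ij^(-1/2) h_ij; by convention zeta_ij is a
   standard Gaussian when s_ij = 0. *)
Definition normalized_moment (p : nat) (i j : 'I_N) : \bar R :=
  if variance_profile i j == 0 then
    (\int[normal_prob 0 1]_x (`|x| ^+ p)%:E)%E
  else
    (\int[P]_w
       ((cabs (H w i j) / Num.sqrt (variance_profile i j)) ^+ p)%:E)%E.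

(* [rm_hermitian] contains both that the diagonal is real and that the entries
   below the diagonal are defined from those above. *)
Record random_band_matrix (delta : R) (kappa : nat -> R) : Prop :=
  RandomBandMatrix {
  rm_measurable : forall i j,
    measurable_fun setT (fun w => complex.Re (H w i j)) /\
    measurable_fun setT (fun w => complex.Im (H w i j));
  rm_hermitian : forall w i j, H w i j = (H w j i)^*;
  rm_independent : mutually_independent P
    (fun (ij : {ij : 'I_N * 'I_N | (ij.1 <= ij.2)%N}) w =>
       H w (val ij).1 (val ij).2);
  rm_finite_variance : forall i j,
    P.-integrable setT (fun w => (cabs (H w i j) ^+ 2)%:E);
  rm_centered : forall i j,
    ('E_P[(fun w => complex.Re (H w i j))] = 0 /\
     'E_P[(fun w => complex.Im (H w i j))] = 0)%E;
  rm_stochastic : forall i, \sum_(j < N) variance_profile i j = 1;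
  rm_bandwidth : N%:R `^ delta <= bandwidth <= N%:R;
  rm_moments : forall (p : nat) i j,
    (normalized_moment p i j <= (kappa p)%:E)%E }.

Definition minor_mx (i : 'I_N) (w : T) : 'M[R[i]]_N :=
  \matrix_(k, l) if (k == i) || (l == i) then 0 else H w k l.

Definition minor_sigma_algebra (i : 'I_N) : set (set T) :=
  <<s [set A | exists k l (B : set (R * R)), measurable B /\
         A = (fun w => plane (minor_mx i w k l)) @^-1` B] >>.

Definition partial_expectation (i : 'I_N) (X : T -> R[i]) : T -> R[i] :=
  ccondexp P (minor_sigma_algebra i) X.

Definition partial_fluctuation (i : 'I_N) (X : T -> R[i]) : T -> R[i] :=
  fun w => X w - partial_expectation i X w.

End random_matrix.

Section resolvent.
Context (R : realType).

Definition stieltjes_semicircle (z : R[i]) : R[i] :=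
  (2 * pi)^-1%:C *
  cintegral lebesgue_measure `[(-2 : R), 2]
    (fun x => (Num.sqrt (4 - x ^+ 2))%:C / (x%:C - z)).

Definition resolvent N (A : 'M[R[i]]_N) (z : R[i]) : 'M[R[i]]_N :=
  invmx (A - z%:M).

Definition centered_resolvent N (A : 'M[R[i]]_N) (z : R[i]) (star : bool) :
    'M[R[i]]_N :=
  if star then
    (\matrix_(i, j) (resolvent A z j i)^*) - ((stieltjes_semicircle z)^*)%:M
  else resolvent A z - (stieltjes_semicircle z)%:M.

Definition Lambda N (A : 'M[R[i]]_N) (z : R[i]) : R :=
  \big[Num.max/0]_(x < N) \big[Num.max/0]_(y < N)
    cabs (centered_resolvent A z false x y).

Definition spectral_domain (M gamma : R) : set R[i] :=
  [set z | -10 <= complex.Re z <= 10 /\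
           M `^ (-1 + gamma) <= complex.Im z <= 10].

Definition admissible_control_parameter (M : nat -> R)
    (dom : nat -> set R[i]) (Psi : nat -> R[i] -> R) : Prop :=
  (forall N z, (0 < N)%N -> dom N z -> 0 < Psi N z) /\
  exists2 c : R, 0 < c & forall N z, (0 < N)%N -> dom N z ->
    M N `^ (- 2^-1) <= Psi N z <= M N `^ (- c).

End resolvent.

Definition stoch_dominated (R : realType) (d : nat -> measure_display)
    (Omega : forall N, measurableType (d N))
    (P : forall N, probability (Omega N) R)
    (U : nat -> Type) (D : forall N, set (U N))
    (X : forall N, U N -> Omega N -> R[i]) (Psi : forall N, U N -> R) : Prop :=
  forall eps D0 : R, 0 < eps -> 0 < D0 ->
  exists N0 : nat, forall N, (N0 <= N)%N ->
    (ereal_sup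
       [set P N [set w | (N%:R `^ eps * Psi N u < cabs (X N u w))%R] | u in D N]
     <= (N%:R `^ (- D0))%:E)%E.

(* The colour of an edge e is * if [starred e] and 1 otherwise. *)
Record admissible_graph := AdmissibleGraph {
  summation_vertex : finType;
  external_vertex : finType;
  edge : finType;
  source : edge -> summation_vertex + external_vertex;
  target : edge -> summation_vertex + external_vertex;
  starred : edge -> bool }.

Section graph.
Context (R : realType) (Delta : admissible_graph) (N : nat).
Local Notation Vs := (summation_vertex Delta).
Local Notation Ve := (external_vertex Delta).

Definition degree : nat := #|edge Delta|.

Definition vertex_index (a : {ffun Vs -> 'I_N}) (mu : {ffun Ve -> 'I_N})
    (v : Vs + Ve) : 'I_N :=
  match v with inl i => a i | inr i => mu i end.

Definition monomial (A : 'M[R[i]]_N) (z : R[i])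
    (a : {ffun Vs -> 'I_N}) (mu : {ffun Ve -> 'I_N}) : R[i] :=
  \prod_(e : edge Delta)
    centered_resolvent A z (starred e)
      (vertex_index a mu (source e)) (vertex_index a mu (target e)).

(* Here I is the complement of J and a0 fixes the indices in I; the sum runs
   over the tuples that agree with a0 on I, and [preim_partition a J] is the
   partition of J into level sets of a. *)
Definition adapted_weight (M : R) (w : {ffun Vs -> 'I_N} -> R) : Prop :=
  (forall a, 0 <= w a <= 1) /\
  forall (J : {set Vs}) (p : {set {set Vs}}), finset.partition p J ->
  forall a0 : {ffun Vs -> 'I_N},
    \sum_(a : {ffun Vs -> 'I_N} |
            [forall i in ~: J, a i == a0 i] && (preim_partition a J == p)) w a
    <= M ^ (#|p|%:Z - #|Vs|%:Z).

Context d (T : measurableType d) (P : probability T R).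

(* The product of the Q_(a_i) is the composition taken in the enumeration order
   of F; these operators commute almost surely. *)
Definition fluctuations (H : T -> 'M[R[i]]_N) (F : {set Vs})
    (a : {ffun Vs -> 'I_N}) (X : T -> R[i]) : T -> R[i] :=
  foldr (fun i Y => partial_fluctuation P H (a i) Y) X (enum F).

Definition average (H : T -> 'M[R[i]]_N) (F : {set Vs})
    (w : {ffun Vs -> 'I_N} -> R) (mu : {ffun Ve -> 'I_N}) (z : R[i]) :
    T -> R[i] := fun omega =>
  \sum_(a : {ffun Vs -> 'I_N} |
          injectiveb a && [forall i, forall j, a i != mu j])
    (w a)%:C *
    fluctuations H F a (fun v => monomial (H v) z a mu) omega.

End graph.

Record average_parameter (R : realType) (Delta : admissible_graph) (N : nat) :=
  AverageParameter {
  ap_weight : {ffun summation_vertex Delta -> 'I_N} -> R;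
  ap_external : {ffun external_vertex Delta -> 'I_N};
  ap_spectral : R[i] }.

(* Main.v *)
Require Import Defs.
From HB Require Import structures.
From mathcomp Require Import all_boot all_order all_algebra.
From mathcomp Require Import all_classical all_reals all_analysis.
From mathcomp Require Import measurable_realfun.
From mathcomp Require Import complex.
From mathcomp Require Import ring lra zify.

(** The proof bounds a high even moment of the average.  Real and imaginary
    parts are treated separately, so that all random variables are real, and
    the [n]-th moment of [sum_a w(a) Q_F Z_a] is expanded into a sum over lists
    of [n] index tuples.

    Conditional expectations become concrete through resampling.  The entries
    on and above the diagonal form a point of a product space whose law does
    not change when any set of coordinates is replaced by an independent copy
    ([resample_law]).  Averaging over the copy of the coordinates in [S]
    therefore satisfies [avg S (avg S' f) = avg (S :|: S') f] pointwise
    ([avg_avg]), which makes all the operators P_k and Q_k commute, and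
    [is_condexp_avg] identifies P_k with such an average.

    Each fluctuation operator gains a factor Psi.  In the expectation of a
    product over [n] tuples, call a label lone if it occurs in one tuple only.
    If k is lone in the tuple r, then Q_k acts on the factor r, and the
    expectation vanishes once all the other factors are replaced by their
    averages P_k; telescoping this replacement puts one Q_k on another factor
    ([mean_prod_transfer]).  That factor is a monomial Z_a with k not in a.  As
    Q_k kills what does not depend on row and column k, Q_k Z_a is Q_k of
    Z_a - Z_a^(k), where ^(k) denotes removal of row and column k
    ([ops_freeze_diffs]).  By G_xy - G_xy^(k) = G_xk G_ky / G_kk
    ([resolvent_minorB]) this difference contains one more off-diagonal
    entry, and so on for several labels ([small_resolvent]).  Division by
    G_kk is harmless because the semicircle transform is bounded below
    ([stieltjes_semicircle_lower]).  The deterministic bound 1/eta on the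
    resolvent takes care of the improbable event where Lambda is large
    ([mean_freeze_diffs_part]).

    Labels that are not lone gain nothing, but the weights make coincidences
    rare: every repeated occurrence of a label costs 1/M in the sum of the
    weights ([iter_sum_weight_of]), and it spoils at most two of the gains
    Psi >= M^(-1/2) ([size_lone]).  In total the [n]-th moment is at most a
    constant times [N^o(1) Psi^(n (deg + #|F|))], and Markov's inequality
    concludes. *)

Set Implicit Arguments.
Unset Strict Implicit.
Unset Printing Implicit Defensive.

Import Order.TTheory GRing.Theory Num.Theory.
Import numFieldNormedType.Exports.

Local Open Scope ring_scope.
Local Open Scope complex_scope.

(** * Difference calculus for functions of a set *)

Section difference_calculus.
Context (K : numFieldType) (I : finType).
Implicit Types (f g : {set I} -> K) (X T : {set I}) (k : I).

Definition set_shift k f : {set I} -> K := fun T => f (k |: T).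

Definition difference k f : {set I} -> K := fun T => f T - f (k |: T).

Definition differences (s : seq I) f := foldl (fun f k => difference k f) f s.

Variables (B : {set I}) (lam : K).
Hypothesis lam01 : 0 <= lam <= 1.

(** In the application [f T] is a quantity computed from the minor of the
    matrix without the rows and columns in [T], and [X] contains the row and
    column indices that [f] itself uses and that cannot be removed.  The
    predicate follows [d] successive removals of indices in [B], and demands
    one more power of [lam] for each of them. *)
Fixpoint small d X n C f : Prop :=
  (forall T, T \subset B :\: X -> `|f T| <= C * lam ^+ n) /\
  (if d is d'.+1 then
     forall k, k \in B :\: X -> small d' (k |: X) n.+1 C (difference k f)
   else True).

Let lam0 : 0 <= lam. Proof. by case/andP: lam01. Qed.
Let lam1 : lam <= 1. Proof. by case/andP: lam01. Qed.

Lemma subset_setU1D k X T : T \subset B :\: (k |: X) ->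
  T \subset B :\: X.
Proof.
by move/fintype.subset_trans; apply; apply: finset.setDS; apply: finset.subsetUr.
Qed.

Lemma setU1_subsetD k X T : k \in B :\: X -> T \subset B :\: (k |: X) ->
  k |: T \subset B :\: X.
Proof.
by move=> kBX TB; rewrite finset.subUset finset.sub1set kBX (subset_setU1D TB).
Qed.

Lemma small_ext d X n C f g :
  (forall T, T \subset B :\: X -> f T = g T) -> small d X n C f ->
  small d X n C g.
Proof.
elim: d X n f g => [|d IH] X n f g fg /= [fb fd]; split => //.
- by move=> T TX; rewrite -fg// fb.
- by move=> T TX; rewrite -fg// fb.
- move=> k kX; apply: IH (fd k kX) => T TX.
  by rewrite /difference !fg// ?setU1_subsetD// (subset_setU1D TX).
Qed.

Lemma small_le d X n n' C C' f : (n' <= n)%N -> 0 <= C -> C <= C' ->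
  small d X n C f -> small d X n' C' f.
Proof.
move=> nn C0 CC; elim: d X n n' f nn => [|d IH] X n n' f nn /= [fb fd];
    split => //.
- move=> T TX; apply: le_trans (fb T TX) _.
  by apply: ler_pM; rewrite ?exprn_ge0//; apply: ler_wiXn2l.
- move=> T TX; apply: le_trans (fb T TX) _.
  by apply: ler_pM; rewrite ?exprn_ge0//; apply: ler_wiXn2l.
- by move=> k kX; apply: IH (fd k kX).
Qed.

Lemma small_down d X n C f : small d.+1 X n C f -> small d X n C f.
Proof.
elim: d X n f => [|d IH] X n f /= [fb fd]; split => // k kX.
by apply: IH; apply: fd.
Qed.

Lemma small_setU1 d X n C f k : small d X n C f -> small d (k |: X) n C f.
Proof.
elim: d X n f => [|d IH] X n f /= [fb fd]; split => //.
- by move=> T TX; apply: fb; apply: subset_setU1D TX.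
- by move=> T TX; apply: fb; apply: subset_setU1D TX.
- move=> l lX; rewrite finset.setUCA; apply: IH; apply: fd.
  by move: lX; rewrite !inE negb_or -andbA => /and3P[_ -> ->].
Qed.

Lemma small_shift d X n C f k : k \in B :\: X -> small d X n C f ->
  small d (k |: X) n C (set_shift k f).
Proof.
elim: d X n f => [|d IH] X n f kX /= [fb fd]; split => //.
- by move=> T TX; apply: fb; apply: setU1_subsetD.
- by move=> T TX; apply: fb; apply: setU1_subsetD.
- move=> l lX; rewrite finset.setUCA.
  have lX' : l \in B :\: X.
    by move: lX; rewrite !inE negb_or -andbA => /and3P[_ -> ->].
  have kX' : k \in B :\: (l |: X).
    move: lX kX; rewrite !inE !negb_or => /andP[/andP[lk _] _] /andP[-> ->].
    by rewrite eq_sym lk.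
  apply: small_ext (IH _ _ _ kX' (fd l lX')) => T _.
  by rewrite /set_shift /difference finset.setUCA.
Qed.

Lemma smallD d X n C C' f g : small d X n C f -> small d X n C' g ->
  small d X n (C + C') (fun T => f T + g T).
Proof.
elim: d X n f g => [|d IH] X n f g /= [fb fd] [gb gd]; split => //.
- move=> T TX; apply: le_trans (ler_normD _ _) _.
  by rewrite mulrDl lerD ?fb ?gb.
- move=> T TX; apply: le_trans (ler_normD _ _) _.
  by rewrite mulrDl lerD ?fb ?gb.
- move=> k kX; apply: small_ext (IH _ _ _ _ (fd k kX) (gd k kX)) => T TX.
  by rewrite /difference; ring.
Qed.

Lemma smallN d X n C f : small d X n C f -> small d X n C (fun T => - f T).
Proof.
elim: d X n f => [|d IH] X n f /= [fb fd]; split => //.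
- by move=> T TX; rewrite normrN fb.
- by move=> T TX; rewrite normrN fb.
- move=> k kX; apply: small_ext (IH _ _ _ (fd k kX)) => T TX.
  by rewrite /difference; ring.
Qed.

Lemma small_isometry d X n C f (h : K -> K) :
  {morph h : x y / x - y} -> (forall x, `|h x| = `|x|) ->
  small d X n C f -> small d X n C (fun T => h (f T)).
Proof.
move=> hB hN; elim: d X n f => [|d IH] X n f /= [fb fd]; split => //.
- by move=> T TX; rewrite hN fb.
- by move=> T TX; rewrite hN fb.
- move=> k kX; apply: small_ext (IH _ _ _ (fd k kX)) => T TX.
  by rewrite /difference hB.
Qed.

(** Leibniz rule: [difference k (f g)] is
    [difference k f * g + set_shift k f * difference k g], so that each
    difference doubles the number of products. *)
Lemma smallM d X n n' C C' f g : small d X n C f -> small d X n' C' g ->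
  small d X (n + n') (C * C' * 2 ^+ d) (fun T => f T * g T).
Proof.
have bnd X' T p p' a b : T \subset B :\: X' -> `|a| <= C * lam ^+ p ->
    `|b| <= C' * lam ^+ p' -> `|a * b| <= C * C' * lam ^+ (p + p').
  move=> _ aC bC; rewrite normrM exprD mulrACA.
  by apply: ler_pM.
elim: d X n n' f g => [|d IH] X n n' f g.
  move=> /= [fb _] [gb _]; rewrite expr0 mulr1.
  by split => // T TX; apply: (bnd X T) => //; [apply: fb|apply: gb].
move=> sf sg; have [fb fd] := sf; have [gb gd] := sg.
have C0 T : T \subset B :\: X -> 0 <= C * C' * lam ^+ (n + n').
  by move=> TX; apply: le_trans (bnd X T _ _ _ _ TX (fb T TX) (gb T TX)).
split.
  move=> T TX; apply: le_trans (bnd X T _ _ _ _ TX (fb T TX) (gb T TX)) _.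
  rewrite [leRHS]mulrAC; apply: ler_peMr; first exact: C0 TX.
  by rewrite exprn_ege1// ler1n.
move=> k kX.
have h1 := IH _ _ _ _ _ (fd k kX) (small_setU1 k (small_down sg)).
have h2 := IH _ _ _ _ _ (small_shift kX (small_down sf)) (gd k kX).
rewrite addnS in h2; rewrite addSn in h1.
have := smallD h1 h2; rewrite -mulrDr -mulr2n -[X in C * C' * X]mulr_natl -exprS.
by apply: small_ext => T TX; rewrite /set_shift /difference; ring.
Qed.

Lemma differences_bound d X n C f s : small d X n C f -> uniq s ->
  {subset s <= B :\: X} -> (size s <= d)%N ->
  `|differences s f finset.set0| <= C * lam ^+ (n + size s).
Proof.
elim: s d X n f => [|k s IH] [|d] X n f //= sf.
- by move=> _ _ _; rewrite addn0; apply: sf.1; apply: finset.sub0set.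
- by move=> _ _ _; rewrite addn0; apply: sf.1; apply: finset.sub0set.
move=> /andP[ks us] sX sd; rewrite addnS -addSn; apply: (IH d (k |: X)) => //.
  by apply: sf.2; apply: sX; rewrite mem_head.
move=> l ls; have := sX l; rewrite in_cons ls orbT => /(_ isT).
rewrite !inE negb_or => /andP[-> ->]; rewrite !andbT.
by apply: contraNneq ks => <-.
Qed.

End difference_calculus.

Lemma differences_le (K : numFieldType) (I : finType) (s : seq I) (f : {set I} -> K) C :
  (forall T, `|f T| <= C) -> forall T, `|differences s f T| <= 2 ^+ size s * C.
Proof.
elim: s f C => [|k s IH] f C fC T /=; first by rewrite mul1r.
rewrite exprSr -mulrA; apply: IH => {}T.
by apply: le_trans (ler_normB _ _) _; rewrite mulr_natl mulr2n lerD.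
Qed.

Lemma small_prod (K : numFieldType) (I : finType) (B : {set I}) (lam : K) d X
  (E : finType) (C : K) (f : E -> {set I} -> K) : 0 <= lam <= 1 -> 1 <= C ->
  (forall e, small B lam d X 1 C (f e)) ->
  small B lam d X #|E| ((C * 2 ^+ d) ^+ #|E|) (fun T => \prod_e f e T).
Proof.
move=> lam01 C1 fs.
have C0 : 0 <= C by apply: le_trans C1.
have small1 : small B lam d X 0 1 (fun=> 1).
  case: d {fs} => [|d] /=; split => //.
  - by move=> T _; rewrite normr1 mulr1.
  - by move=> T _; rewrite normr1 mulr1.
  move=> k _; have : forall p X', small B lam d X' p 1 (difference k (fun=> 1)).
    have lp p : 0 <= lam ^+ p by rewrite exprn_ge0//; case/andP: lam01.
    elim: d => [|d IH] p X' /=; split => //.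
    - by move=> T _; rewrite /difference subrr normr0 mul1r.
    - by move=> T _; rewrite /difference subrr normr0 mul1r.
    - move=> l _; apply: small_ext (IH p.+1 (l |: X')) => T _.
      by rewrite /difference !subrr.
  exact.
have : forall s : seq E, small B lam d X (size s) ((C * 2 ^+ d) ^+ size s)
    (fun T => \prod_(e <- s) f e T).
  elim=> [|e s IH] /=.
    by apply: small_ext small1 => T _; rewrite big_nil.
  have := smallM (fs e) IH; rewrite add1n mulrAC -exprS.
  by apply: small_ext => T _; rewrite big_cons.
move=> /(_ (enum E)); rewrite -cardE; apply: small_ext => T _.
by rewrite big_enum.
Qed.

(** The hypotheses on [g] are those satisfied by the resolvents of the
    minors of a matrix.  A difference of [g x y] is a product of two off-diagonal
    entries and an inverse diagonal entry, and a difference of an inverse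
    diagonal entry is a product of factors of the same kind; the induction on
    [d] goes through because the new index [k] joins the set [X] of indices in
    use.  The constant depends on neither the index type nor [lam]. *)
Lemma small_resolvent (K : numFieldType) (d : nat) (b : K) : 1 <= b ->
  exists2 C : K, 1 <= C &
  forall (I : finType) (B : {set I}) (lam m : K)
    (g : I -> I -> {set I} -> K) ,
  0 <= lam <= 1 ->
  (forall (T : {set I}) x y, T \subset B -> x \notin T -> y \notin T ->
     `|g x y T - m *+ (x == y)| <= lam) ->
  (forall (T : {set I}) x, T \subset B -> x \notin T ->
     g x x T != 0 /\ `|(g x x T)^-1| <= b) ->
  (forall (T : {set I}) x y k, x \notin k |: T -> y \notin k |: T -> k \notin T ->
     g x y T - g x y (k |: T) = g x k T * g k y T / g k k T) ->
  forall (X : {set I}) x y, x \in X -> y \in X ->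
    small B lam d X 1 C (fun T => g x y T - m *+ (x == y)) /\
    small B lam d X 0 C (fun T => (g x x T)^-1).
Proof.
move=> b1.
have b0 : 0 <= b by apply: le_trans b1.
elim: d => [|d [C C1 IH]].
  exists b => // I B lam m g lam01 g1 g2 g3 X x y xX yX /=.
  have lam0 : 0 <= lam by case/andP: lam01.
  split; split => // T TX.
    have TB : T \subset B by apply: fintype.subset_trans TX (finset.subsetDl _ _).
    have nX z : z \in X -> z \notin T.
      by move=> zX; apply: contraL zX => /(fintype.subsetP TX); rewrite inE => /andP[].
    rewrite expr1; apply: le_trans (g1 T x y TB (nX _ xX) (nX _ yX)) _.
    by rewrite ler_peMl.
  have TB : T \subset B by apply: fintype.subset_trans TX (finset.subsetDl _ _).
  rewrite expr0 mulr1; apply: (g2 T x TB _).2.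
  by apply: contraL xX => /(fintype.subsetP TX); rewrite inE => /andP[].
have C0 : 0 <= C by apply: le_trans C1.
pose e : K := 2 ^+ d.
have e1 : 1 <= e by rewrite exprn_ege1// ler1n.
have e0 : 0 <= e by apply: le_trans e1.
pose D := C * C * e * C * e + b.
have D0 : 0 <= C * C * e * C * e by rewrite !mulr_ge0.
exists (D + D * C * e * C * e).
  rewrite -[leLHS]addr0 lerD ?mulr_ge0 ?addr_ge0//.
  by rewrite -[leLHS]add0r lerD.
have D1 : D <= D + D * C * e * C * e by rewrite lerDl !mulr_ge0 ?addr_ge0.
have D2 : D * C * e * C * e <= D + D * C * e * C * e.
  by rewrite lerDr ?addr_ge0.
move=> I B lam m g lam01 g1 g2 g3 X x y xX yX.
have {}IH := IH I B lam m g lam01 g1 g2 g3.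
have lam0 : 0 <= lam by case/andP: lam01.
have sub (T : {set I}) k z : T \subset B :\: (k |: X) -> z \in X -> k \in B :\: X ->
    z \notin k |: T.
  move=> TX zX kX; rewrite !inE negb_or; apply/andP; split.
    by apply: contraTneq zX => ->; move: kX; rewrite inE => /andP[].
  apply: contraL zX => /(fintype.subsetP TX); rewrite !inE negb_or.
  by move=> /andP[/andP[]].
have subk (T : {set I}) k : T \subset B :\: (k |: X) -> k \notin T.
  by move=> TX; apply/negP => /(fintype.subsetP TX); rewrite !inE eqxx.
have key p q k : p \in X -> q \in X -> k \in B :\: X ->
    small B lam d (k |: X) 2 D (difference k (fun T => g p q T - m *+ (p == q))).
  move=> pX qX kX.
  have pX' : p \in k |: X by rewrite inE pX orbT.
  have qX' : q \in k |: X by rewrite inE qX orbT.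
  have kX' : k \in k |: X by rewrite !inE eqxx.
  have [h1 _] := IH _ _ _ pX' kX'; have [h2 h3] := IH _ _ _ kX' qX'.
  have pk : p == k = false.
    by apply/eqP => epk; move: kX; rewrite -epk inE pX.
  have qk : k == q = false.
    by apply/eqP => eqk; move: kX; rewrite eqk inE qX.
  have := smallM (smallM h1 h2) h3.
  rewrite -/e addn0 => /(small_le (n' := 2) lam01 (leqnn _) D0 (C' := D)) h.
  apply: small_ext (h _); last by rewrite lerDl.
  move=> T TX; rewrite /difference pk qk !subr0 -g3 ?sub//; last exact: subk TX.
  by ring.
have [IH1 IH2] : (forall T : {set I}, T \subset B :\: X ->
      `|g x y T - m *+ (x == y)| <= D * lam ^+ 1) /\
    (forall T : {set I}, T \subset B :\: X -> `|(g x x T)^-1| <= D * lam ^+ 0).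
  have bD : b <= D by rewrite lerDr.
  have bD1 : 1 <= D by apply: le_trans bD.
  split => T TX.
    rewrite expr1; apply: le_trans (_ : lam <= _); last by rewrite ler_peMl.
    have TB : T \subset B by apply: fintype.subset_trans TX (finset.subsetDl _ _).
    have nX z : z \in X -> z \notin T.
      by move=> zX; apply: contraL zX => /(fintype.subsetP TX); rewrite inE => /andP[].
    by apply: g1; rewrite ?nX.
  rewrite mulr1; apply: le_trans bD.
  have TB : T \subset B by apply: fintype.subset_trans TX (finset.subsetDl _ _).
  apply: (g2 T x TB _).2.
  by apply: contraL xX => /(fintype.subsetP TX); rewrite inE => /andP[].
split; split.
- move=> T TX; apply: le_trans (IH1 T TX) _.
  by rewrite ler_wpM2r// exprn_ge0.
- move=> k kX; apply: small_le (key x y k xX yX kX) => //.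
  by rewrite addr_ge0.
- move=> T TX; apply: le_trans (IH2 T TX) _.
  by rewrite ler_wpM2r// exprn_ge0.
- move=> k kX.
  have xX' : x \in k |: X by rewrite inE xX orbT.
  have [_ h2] := IH _ _ _ xX' xX'.
  have [_ h3'] := IH _ _ _ xX xX.
  have h3 := small_shift kX h3'.
  have := smallN (smallM (smallM (key x x k xX xX kX) h2) h3).
  rewrite -/e addn0 => /(small_le (n' := 1) lam01 _ _ D2) h.
  apply: small_ext (h _ _); rewrite ?mulr_ge0 ?addr_ge0//.
  move=> T TX; rewrite /difference /set_shift.
  have TB : T \subset B.
    by apply: fintype.subset_trans TX (finset.subsetDl _ _).
  have kTB : k |: T \subset B.
    rewrite finset.subUset finset.sub1set TB andbT.
    by move: kX; rewrite inE => /andP[].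
  have xkT := sub T k x TX xX kX.
  have xT : x \notin T by apply: contra xkT; rewrite inE => ->; rewrite orbT.
  have [n1 _] := g2 T x TB xT; have [n2 _] := g2 _ x kTB xkT.
  by field; rewrite n1 n2.
Qed.

(** * Resolvents of Hermitian matrices and of their minors *)

Section modulus.
Local Open Scope classical_set_scope.
Context (R : realType).
Implicit Types z : R[i].

Lemma cabsE z : (cabs z)%:C = `|z|.
Proof. by rewrite /cabs normc_def. Qed.

Lemma cabs_ge0 z : 0 <= cabs z.
Proof. by rewrite /cabs normc_def /= sqrtr_ge0. Qed.

Lemma cabs_le z (c : R) : (cabs z <= c) = (`|z| <= c%:C).
Proof. by rewrite -cabsE lecR. Qed.

Lemma cabs_real (x : R) : cabs x%:C = `|x|.
Proof. by rewrite /cabs normc_def /= expr0n addr0 sqrtr_sqr. Qed.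

Lemma cabs_leD z : cabs z <= `|complex.Re z| + `|complex.Im z|.
Proof.
rewrite cabs_le [in leLHS](complexE z); apply: le_trans (ler_normD _ _) _.
rewrite rmorphD lerD//; first by rewrite -cabs_le cabs_real.
rewrite normrM -[leRHS]mul1r ler_pM//.
  by rewrite normc_def /= expr0n expr1n add0r sqrtr1.
by rewrite -cabs_le cabs_real.
Qed.

Lemma Re_le_cabs z : `|complex.Re z| <= cabs z.
Proof. by rewrite -lecR cabsE normc_ge_Re. Qed.

Lemma Im_le_cabs z : `|complex.Im z| <= cabs z.
Proof.
rewrite -[leLHS]normrN -ReiNIm; apply: le_trans (Re_le_cabs _) _.
rewrite cabs_le normrM cabsE.
by rewrite [X in _ * X]normc_def /= expr0n expr1n add0r sqrtr1 mulr1.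
Qed.

Lemma mulcJ z : z * z^* = (cabs z ^+ 2)%:C.
Proof. by rewrite -sqr_normc -cabsE rmorphXn. Qed.

End modulus.

Section hermitian_resolvent.
Local Open Scope classical_set_scope.
Context (R : realType) (N : nat).
Implicit Types (A : 'M[R[i]]_N) (z : R[i]).

Definition selfadjoint A := forall i j, A i j = (A j i)^*.

Variables (A : 'M[R[i]]_N) (z : R[i]).
Hypothesis hA : selfadjoint A.
Hypothesis z0 : 0 < complex.Im z.

(** If [v A = z v] then the real number [v A v^*] equals
    [z |v|^2], which is not real unless [v = 0]. *)
Lemma hermitian_unitmx : A - z%:M \in unitmx.
Proof.
rewrite -row_free_unit; apply: inj_row_free => v /eqP.
rewrite mulmxBr subr_eq0 mul_mx_scalar => /eqP vA.
pose s : R := \sum_i cabs (v 0 i) ^+ 2.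
pose q : R[i] := \sum_i \sum_j v 0 i * A i j * (v 0 j)^*.
have qE : q = z * s%:C.
  rewrite /q exchange_big /= rmorph_sum /= mulr_sumr; apply: eq_bigr => j _.
  rewrite -mulcJ -mulr_suml mulrA; congr (_ * _).
  by have := congr1 (fun M : 'rV_N => M 0 j) vA; rewrite !mxE.
have qJ : q^* = q.
  rewrite {1}/q rmorph_sum /q exchange_big /=; apply: eq_bigr => i _.
  rewrite rmorph_sum; apply: eq_bigr => j _.
  by rewrite !rmorphM /= conjcK [A i j]hA conjcK; ring.
have q0 : complex.Im q = 0.
  by move: qJ; case: (q) => a b [] /= /eqP; rewrite -subr_eq0; lra.
have s0 : s = 0.
  move: q0; rewrite qE; case: z z0 => a b /= b0 /eqP.
  by rewrite mulr0 add0r mulf_eq0 (gt_eqF b0) => /eqP.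
apply/rowP => i; rewrite mxE; apply/eqP.
have : cabs (v 0 i) ^+ 2 <= s.
  rewrite /s (bigD1 i)//= lerDl; apply: sumr_ge0 => j _.
  by rewrite exprn_ge0// cabs_ge0.
rewrite s0 => h; have : cabs (v 0 i) ^+ 2 == 0.
  by rewrite eq_le h exprn_ge0// cabs_ge0.
rewrite expf_eq0 /= => /eqP h'.
by rewrite -normr_eq0 -cabsE h'.
Qed.

Local Notation G := (resolvent A z).

Lemma resolventV : (A - z%:M) *m G = 1%:M.
Proof. by rewrite mulmxV// hermitian_unitmx. Qed.

Lemma resolventK : G *m (A - z%:M) = 1%:M.
Proof. by rewrite mulVmx// hermitian_unitmx. Qed.

(** Ward identity: [G - G^* = 2 i Im z G G^*], where [G^*] is the adjoint. *)
Lemma ward x : complex.Im (G x x) = complex.Im z * \sum_y cabs (G x y) ^+ 2.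
Proof.
pose J (M : 'M[R[i]]_N) : 'M[R[i]]_N := \matrix_(i, j) (M j i)^*.
have JM M M' : J (M *m M') = J M' *m J M.
  apply/matrixP => i j; rewrite !mxE rmorph_sum; apply: eq_bigr => k _.
  by rewrite !mxE rmorphM mulrC.
have J1 : J 1%:M = 1%:M.
  by apply/matrixP => i j; rewrite !mxE eq_sym rmorph_nat.
have JA : J (A - z%:M) = A - z^*%:M.
  apply/matrixP => i j; rewrite !mxE rmorphB /= -hA eq_sym.
  by case: eqP; rewrite ?mulr1n ?mulr0n ?conjc0.
have GJ : (A - z^*%:M) *m J G = 1%:M.
  by rewrite -JA -JM resolventK J1.
have : G - J G = (z - z^*) *: (G *m J G).
  transitivity (G *m ((A - z^*%:M) - (A - z%:M)) *m J G).
    by rewrite mulmxBr mulmxBl -mulmxA GJ resolventK mulmx1 mul1mx.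
  have -> : (A - z^*%:M) - (A - z%:M) = (z - z^*)%:M.
    by apply/matrixP => i j; rewrite !mxE; ring.
  by rewrite mul_mx_scalar -scalemxAl.
move=> /(congr1 (fun M : 'M[R[i]]_N => M x x)); rewrite !mxE.
under eq_bigr do rewrite mxE mulcJ.
rewrite -rmorph_sum /= subcJ subcJ => /(congr1 (@complex.Im R)) /=.
case: z => a b /=; case: (G x x) => c d /=.
lra.
Qed.

(** Combine the Ward identity with [|G x x|^2 <= sum_y |G x y|^2]. *)
Lemma resolvent_row_le x : \sum_y cabs (G x y) ^+ 2 <= (complex.Im z)^-2.
Proof.
set s := \sum_y _; set e := complex.Im z.
have s0 : 0 <= s by apply: sumr_ge0 => y _; rewrite exprn_ge0// cabs_ge0.
have h1 : e * s <= cabs (G x x).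
  by rewrite -ward; apply: le_trans (Im_le_cabs _); exact: ler_norm.
have h2 : cabs (G x x) ^+ 2 <= s.
  rewrite /s (bigD1 x)//= lerDl; apply: sumr_ge0 => j _.
  by rewrite exprn_ge0// cabs_ge0.
have h3 : (e * s) ^+ 2 <= s.
  apply: le_trans h2; rewrite ler_sqr// nnegrE ?cabs_ge0//.
  by rewrite mulr_ge0// ltW.
have [->|sN0] := eqVneq s 0; first by rewrite invr_ge0 sqr_ge0.
rewrite -[leRHS]mul1r ler_pdivlMr ?exprn_gt0// mulrC.
have sp : 0 < s by rewrite lt_neqAle eq_sym sN0.
by rewrite -(ler_pM2r sp) mul1r; apply: le_trans h3; rewrite exprMn (expr2 s) mulrA.
Qed.

Lemma resolvent_le x y : cabs (G x y) <= (complex.Im z)^-1.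
Proof.
rewrite -ler_sqr ?nnegrE ?cabs_ge0 ?invr_ge0 ?(ltW z0)//.
rewrite exprVn; apply: le_trans (resolvent_row_le x).
rewrite (bigD1 y)//= lerDl; apply: sumr_ge0 => j _.
by rewrite exprn_ge0// cabs_ge0.
Qed.

(** By the Ward identity a vanishing diagonal entry would force the
    whole row to vanish. *)
Lemma resolvent_diag_neq0 x : G x x != 0.
Proof.
apply/eqP => Gxx; have := ward x; rewrite Gxx /= => /esym/eqP.
rewrite mulf_eq0 (gt_eqF z0) /= psumr_eq0; last first.
  by move=> y _; rewrite exprn_ge0// cabs_ge0.
move=> /allP G0.
have G0' y : G x y = 0.
  have := G0 y; rewrite mem_index_enum => /(_ isT) /=.
  by rewrite expf_eq0 /= => /eqP h; apply/eqP; rewrite -normr_eq0 -cabsE h.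
have := congr1 (fun M : 'M[R[i]]_N => M x x) resolventK; rewrite !mxE eqxx /=.
rewrite big1 => [|j _]; last by rewrite G0' mul0r.
by move/eqP; rewrite eq_sym oner_eq0.
Qed.

End hermitian_resolvent.

Section minors.
Local Open Scope classical_set_scope.
Context (R : realType) (N : nat).
Implicit Types (A : 'M[R[i]]_N) (z : R[i]) (T : {set 'I_N}).

(** Rows and columns are set to zero and not removed, so that all minors have
    the same size; away from [T] the resolvent is the same. *)
Definition minor T A : 'M[R[i]]_N :=
  \matrix_(k, l) if (k \in T) || (l \in T) then 0 else A k l.

Lemma hermitian_minor T A : selfadjoint A -> selfadjoint (minor T A).
Proof.
by move=> hA i j; rewrite !mxE orbC; case: ifP => // _; rewrite conjc0.
Qed.

Lemma minor0 A : minor finset.set0 A = A.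
Proof. by apply/matrixP => i j; rewrite mxE !inE. Qed.

Lemma minorU T T' A : minor T (minor T' A) = minor (T :|: T') A.
Proof.
apply/matrixP => i j; rewrite !mxE !inE.
by case: (i \in T); case: (j \in T); case: (i \in T'); case: (j \in T').
Qed.

(** By the resolvent identity the difference is [G' (A' - A) G].
    The matrix [A' - A] lives on row and column [k], and [G' x k = 0], so the
    difference is [a * G k y] with a factor [a] that does not depend on [y];
    the case [y = k] determines [a]. *)
Lemma resolvent_minorB A z k x y : selfadjoint A -> 0 < complex.Im z ->
  x != k -> 
  resolvent A z x y - resolvent (minor [set k] A) z x y =
    resolvent A z x k * resolvent A z k y / resolvent A z k k.
Proof.
move=> hA z0 xk.
set A' := minor [set k] A; set G := resolvent A z; set G' := resolvent A' z.
have hA' : selfadjoint A' by apply: hermitian_minor.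
have zn0 : z != 0 by apply/eqP => z00; move: z0; rewrite z00 /= ltxx.
have G'k : G' x k = 0.
  have := congr1 (fun M : 'M[R[i]]_N => M x k) (resolventK hA' z0).
  rewrite !mxE (negPf xk) mulr0n (bigD1 k)//= big1 => [|j jk].
    rewrite !mxE !inE eqxx /= sub0r mulr1n addr0 mulrN => /eqP.
    by rewrite oppr_eq0 mulf_eq0 (negPf zn0) orbF => /eqP.
  by rewrite !mxE !inE eqxx orbT (negPf jk) mulr0n subr0 mulr0.
pose a := - \sum_(i | i != k) G' x i * A i k.
have key y' : G x y' - G' x y' = a * G k y'.
  have -> : G x y' - G' x y' = (G' *m (A' - A) *m G) x y'.
    have -> : A' - A = (A' - z%:M) - (A - z%:M).
      by rewrite opprB addrA subrK.
    rewrite mulmxBr mulmxBl -!mulmxA resolventV// mulmxA resolventK//.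
    by rewrite mulmx1 mul1mx !mxE.
  rewrite mxE (bigD1 k)//= big1 ?addr0 => [|j jk].
    congr (_ * _); rewrite mxE (bigD1 k)//= G'k mul0r add0r.
    rewrite /a -sumrN; apply: eq_bigr => i _.
    by rewrite !mxE !inE eqxx orbT sub0r mulrN.
  rewrite mxE (bigD1 k)//= G'k mul0r add0r big1 ?mul0r// => i ik.
  by rewrite !mxE !inE (negPf ik) (negPf jk) /= subrr mulr0.
have Gk : a = G x k / G k k.
  have := key k; rewrite G'k subr0 => ->.
  by rewrite mulfK// resolvent_diag_neq0.
by rewrite key Gk mulrAC.
Qed.

End minors.

(** * The Stieltjes transform of the semicircle law *)

Section semicircle.
Local Open Scope classical_set_scope.
Context (R : realType).
Notation mu := (@lebesgue_measure R).
Local Notation J := (`[(-2 : R), 2]%classic : set R).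
Implicit Types (E e x : R) (z : R[i]).

Definition sqdist E e x := (x - E) ^+ 2 + e ^+ 2.
Definition semicircle x := Num.sqrt (4 - x ^+ 2) : R.
(** [cauchy_re] and [cauchy_im] are the real and imaginary parts of the
    integrand [sqrt (4 - x^2) / (x - z)] at [z = E + i e]. *)
Definition cauchy_re E e x := semicircle x * ((x - E) / sqdist E e x).
Definition cauchy_im E e x := semicircle x * (e / sqdist E e x).

Lemma sqdist_gt0 E e x : 0 < e -> 0 < sqdist E e x.
Proof. by move=> e0; rewrite ltr_wpDl ?sqr_ge0// exprn_gt0. Qed.

Lemma stieltjes_semicircleE z : 0 < complex.Im z ->
  stieltjes_semicircle z = (2 * pi)^-1%:C *
   (Rintegral mu J (cauchy_re (complex.Re z) (complex.Im z)) +i*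
    Rintegral mu J (cauchy_im (complex.Re z) (complex.Im z))).
Proof.
case: z => E e /= e0; rewrite /stieltjes_semicircle /cintegral.
congr (_ * (_ +i* _)); apply: eq_Rintegral => x _ /=.
  by rewrite !mul0r subr0 sub0r sqrrN.
by rewrite !mul0r addr0 sub0r mulNr opprK sqrrN.
Qed.

Lemma continuous_sqdist E e : continuous (sqdist E e : R -> R).
Proof.
move=> x; apply: cvgD; last exact: cvg_cst.
apply: (@continuous_comp _ _ _ (fun x => x - E) (fun y => y ^+ 2)).
  by apply: cvgB; [exact: cvg_id|exact: cvg_cst].
exact: exprn_continuous.
Qed.

Lemma continuous_semicircle : continuous (semicircle : R -> R).
Proof.
move=> x; apply: (@continuous_comp _ _ _ (fun x => 4 - x ^+ 2) Num.sqrt).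
  by apply: cvgB; [exact: cvg_cst|exact: exprn_continuous].
exact: sqrt_continuous.
Qed.

Lemma continuous_quot E e : 0 < e ->
  continuous ((fun x => (x - E) / sqdist E e x) : R -> R).
Proof.
move=> e0 x; apply: cvgM.
  by apply: cvgB; [exact: cvg_id|exact: cvg_cst].
by apply: cvgV; [rewrite gt_eqF// sqdist_gt0|exact: continuous_sqdist].
Qed.

Lemma continuous_cauchy_re E e : 0 < e -> continuous (cauchy_re E e : R -> R).
Proof.
by move=> e0 x; apply: cvgM; [exact: continuous_semicircle|exact: continuous_quot].
Qed.

Lemma continuous_cauchy_im E e : 0 < e -> continuous (cauchy_im E e : R -> R).
Proof.
move=> e0 x; apply: cvgM; first exact: continuous_semicircle.
apply: cvgM; first exact: cvg_cst.
by apply: cvgV; [rewrite gt_eqF// sqdist_gt0|exact: continuous_sqdist].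
Qed.

Lemma integrable_continuous (f : R -> R) a b :
  continuous f -> mu.-integrable `[a, b] (EFin \o f).
Proof.
move=> cf; apply: continuous_compact_integrable; first exact: segment_compact.
exact: continuous_subspaceT.
Qed.

Lemma integrable_patch (f : R -> R) a b : continuous f ->
  mu.-integrable J (EFin \o (f \_ `[a, b])).
Proof.
move=> cf; rewrite -restrict_comp//; apply/integrable_restrict => //.
by apply: integrableS (integrable_continuous (-2) 2 cf) => //; exact: measurableI.
Qed.

Lemma Rintegral_patch (f : R -> R) a b : -2 <= a -> b <= 2 ->
  Rintegral mu J (f \_ `[a, b]) = Rintegral mu `[a, b] f.
Proof.
move=> a2 b2; rewrite -Rintegral_mkcondr; congr (Rintegral _ _ _).
apply/seteqP; split => x /=; rewrite !in_itv /=; first by case.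
by lra.
Qed.

(** The integrand is odd around [E]; its primitive is
    [ln ((x - E)^2 + e^2) / 2]. *)
Lemma Rintegral_quot E e r : 0 < e -> 0 <= r ->
  Rintegral mu `[E - r, E + r] (fun x => (x - E) / sqdist E e x) = 0.
Proof.
move=> e0; rewrite le_eqVlt => /predU1P[<-|r0].
  by rewrite subr0 addr0 set_itv1 Rintegral_set1.
pose F := fun x : R => 2^-1 * ln (sqdist E e x).
have dF x : is_derive x (1 : R) F ((x - E) / sqdist E e x).
  have k0 := sqdist_gt0 E x e0.
  have dk : is_derive x (1 : R) (sqdist E e) (2 * (x - E)).
    rewrite /sqdist; apply: is_derive_eq.
    by rewrite /GRing.scale /=; ring.
  have := is_derive1_comp (is_derive1_ln k0) dk.
  move=> h; rewrite /F; apply: is_derive_eq.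
  by rewrite /GRing.scale /= mulrCA mulKf// mulrC.
rewrite /Rintegral (@continuous_FTC2 _ _ F).
- rewrite -EFinB /= /F /sqdist.
  have -> : E + r - E = r by ring. 
  have -> : E - r - E = - r by ring.
  by rewrite sqrrN subrr.
- by rewrite ltrD2l gtrN.
- by apply: continuous_subspaceT; exact: continuous_quot.
- have cF : continuous F.
    move=> x; apply: differentiable_continuous; apply/derivable1_diffP.
    by case: (dF x).
  split.
  - by move=> x _; case: (dF x).
  - exact: cvg_at_right_filter (cF _).
  - exact: cvg_at_left_filter (cF _).
- by move=> x _; rewrite derive1E; case: (dF x).
Qed.

Lemma Rintegral_lower (f h : R -> R) a b a' b' c :
  continuous f -> continuous h -> -2 <= a -> a <= b -> b <= 2 ->
  (forall x, -2 <= x <= 2 ->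
     c * \1_(`[a, b]%classic) x + (h \_ `[a', b']) x <= f x) ->
  c * (b - a) + Rintegral mu J (h \_ `[a', b']) <= Rintegral mu J f.
Proof.
move=> cf ch a2 ab b2 hf.
have i1 := @integrable_patch h a' b' ch.
have c1 : continuous (cst c : R -> R) by move=> x; exact: cvg_cst.
have i2 := @integrable_patch (cst c) a b c1.
have i3 := integrable_continuous (-2) 2 cf.
have -> : c * (b - a) + Rintegral mu J (h \_ `[a', b']) =
    \int[mu]_(x in J) ((cst c \_ `[a, b]) x + (h \_ `[a', b']) x).
  rewrite RintegralD//; congr (_ + _).
  rewrite Rintegral_patch// Rintegral_cst//= lebesgue_measure_itv/= lte_fin.
  move: ab; rewrite le_eqVlt => /predU1P[->|->]; last by [].
  by rewrite ltxx subrr.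
apply: le_Rintegral => //.
  exact: (integrableD _ i2 i1).
move=> x /=; rewrite in_itv/= => hx; apply: le_trans (hf x hx).
by rewrite lerD2r patchE indicE; case: ifPn => _; rewrite ?mulr1 ?mulr0.
Qed.

Lemma Rintegral_cst0 (D : set R) : Rintegral mu D (fun=> 0) = 0.
Proof. by rewrite /Rintegral integral0. Qed.

Lemma semicircle_ge0 x : 0 <= semicircle x. Proof. exact: sqrtr_ge0. Qed.

Lemma ler_semicircle x y : y ^+ 2 <= x ^+ 2 -> semicircle x <= semicircle y.
Proof. by move=> xy; rewrite ler_wsqrtr// lerB. Qed.

(** In the bulk, near [E] the density is bounded below and the
    kernel is a Poisson kernel. *)
Lemma cauchy_im_lower E e : -1 <= E <= 1 -> 0 < e <= 10 ->
  20^-1 <= Rintegral mu J (cauchy_im E e).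
Proof.
move=> /andP[E1 E2] /andP[e0 e10].
(* The density is at least 1 up to distance 1/2 from [E]. *)
pose h := Num.min e 2^-1.
have h0 : 0 < h by rewrite lt_min e0 invr_gt0 ltr0n.
have he : h <= e by rewrite ge_min lexx.
have h2 : h <= 2^-1 by rewrite ge_min lexx orbT.
have := @Rintegral_lower (cauchy_im E e) (cst 0) (E - h) (E + h) 0 0 (2 * e)^-1.
have -> : ((cst 0 : R -> R) \_ `[(0 : R), 0]) = cst 0.
  by apply/funext => x; rewrite patchE if_same.
rewrite Rintegral_cst0 addr0 => /(_ (continuous_cauchy_im e0)).
have c0 : continuous (cst 0 : R -> R) by move=> x; exact: cvg_cst.
have -> : E + h - (E - h) = 2 * h by ring.
move=> /(_ c0) H; apply: le_trans (H _ _ _ _); try lra.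
  rewrite mulrC ler_pdivlMr ?mulr_gt0//.
  by rewrite /h; have [eh|eh] := leP e 2^-1; [lra|lra].
move=> x x2; rewrite /= addr0 indicE.
rewrite mem_setE in_itv/=.
case: (boolP (E - h <= x <= E + h)) => [/andP[x1 x3]|_] /=; last first.
  by rewrite mulr0 mulr_ge0 ?semicircle_ge0// divr_ge0// ltW// sqdist_gt0.
rewrite mulr1 /cauchy_im -[leLHS]mul1r ler_pM//.
  by rewrite invr_ge0 mulr_ge0// ltW.
  rewrite -[leLHS]sqrtr1 ler_wsqrtr//; nra.
have k0 := sqdist_gt0 E x e0.
rewrite ler_pdivlMr// mulrC ler_pdivrMr ?mulr_gt0//.
rewrite /sqdist; nra.
Qed.

(** The sign [s] is that of [E].  Subtract from the density its
    value at [E] on the interval [E - r, E + r], where [r] is the distance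
    from [E] to the nearer edge of the support; this does not change the
    integral, by oddness.  What remains has the sign of [- s] everywhere,
    because the density decreases away from the origin, and it is bounded
    below where [s x] lies in [[-1, -1/2]]. *)
Lemma cauchy_re_lower (s E e : R) : (s == 1) || (s == -1) -> 1 <= s * E -> s * E <= 10 ->
  0 < e <= 10 -> (2 * (16 * 16))^-1 <= - s * Rintegral mu J (cauchy_re E e).
Proof.
move=> s1 E1 E10 /andP[e0 e10].
have i3 := integrable_continuous (-2) 2 (continuous_cauchy_re (E := E) e0).
rewrite -RintegralZl//.
(* When [E] is outside the support, the density vanishes at [E] and the
   interval degenerates to a point. *)
pose r : R := Num.max 0 (2 - s * E).
have r0 : 0 <= r by rewrite le_max lexx.
have r1 : r <= 1 by rewrite ge_max ler01; lra.
pose h := fun x => - s * semicircle E * ((x - E) / sqdist E e x).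
pose a : R := if s == 1 then -1 else 2^-1.
have aE : a = if s == 1 then -1 else 2^-1 by [].
have cf : continuous ((fun x => - s * cauchy_re E e x) : R -> R).
  by move=> x; apply: cvgM; [exact: cvg_cst|exact: continuous_cauchy_re].
have ch : continuous (h : R -> R).
  by move=> x; apply: cvgM; [exact: cvg_cst|exact: continuous_quot].
have := @Rintegral_lower (fun x => - s * cauchy_re E e x) h a (a + 2^-1)
  (E - r) (E + r) ((16 * 16)^-1) cf ch.
have s2 : s * s = 1 by case/orP: s1 => /eqP ->; ring.
have -> : Rintegral mu J (h \_ `[E - r, E + r]) = 0.
  have [E2|E2] := leP (s * E) 2.
    have rE : r = 2 - s * E by rewrite /r max_r// subr_ge0.
    rewrite Rintegral_patch.
    - rewrite /h RintegralZl// ?Rintegral_quot ?mulr0//.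
      by apply: integrable_continuous; exact: continuous_quot.
    - by rewrite rE; case/orP: s1 E1 E2 => /eqP ->; lra.
    - by rewrite rE; case/orP: s1 E1 E2 => /eqP ->; lra.
  have E0 : semicircle E = 0.
    rewrite /semicircle ler0_sqrtr//; case/orP: s1 E1 E2 => /eqP ->; nra.
  rewrite -[RHS](Rintegral_cst0 J); apply: eq_Rintegral => x _.
  by case: ifP => // _; rewrite /h E0 mulr0 mul0r.
rewrite addr0 [a + _ - a]addrC addKr -invfM => H.
rewrite mulrC; apply: H; rewrite ?lerDl ?invr_ge0//.
- by rewrite aE; case: ifP => _; lra.
- by rewrite aE; case: ifP => _; lra.
move=> x x2; have k0 := sqdist_gt0 E x e0.
rewrite patchE indicE /h /cauchy_re !mem_setE !in_itv/=.
have rE : (r = 0 /\ 2 < s * E) \/ (r = 2 - s * E /\ s * E <= 2).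
  rewrite /r; have [E2|E2] := leP (s * E) 2; [right|left].
    by rewrite max_r// subr_ge0.
  by rewrite max_l// subr_le0 ltW.
have notin : (a <= x <= a + 2^-1) = (2^-1 <= - s * x <= 1).
  by rewrite aE; case/orP: s1 => /eqP ->; rewrite ?eqxx ?eqNr ?oner_eq0; lra.
rewrite notin.
case: ifP => [/andP[xE1 xE2]|xE].
  have -> : (2^-1 <= - s * x <= 1) = false.
    by apply/negbTE/negP => /andP[y1 y2]; case/orP: s1 E1 rE y1 y2 => /eqP ->; lra.
  rewrite mulr0 add0r !mulrA ler_wpM2r ?invr_ge0 ?(ltW k0)//.
  rewrite -subr_ge0.
  have -> : - s * semicircle x * (x - E) - - s * semicircle E * (x - E) =
    (semicircle E - semicircle x) * (s * (x - E)) by ring.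
  have [h1|h1] := leP 0 (s * (x - E)).
    rewrite mulr_ge0// subr_ge0 ler_semicircle//.
    by case/orP: s1 E1 h1 => /eqP ->; nra.
  rewrite nmulr_lge0// subr_le0 ler_semicircle//.
  by case/orP: s1 E1 h1 rE xE1 xE2 => /eqP ->; nra.
rewrite addr0.
have un : 0 <= - s * (x - E).
  rewrite leNgt; apply/negP => h1; move/negP: xE; apply.
  by case/orP: s1 E1 h1 rE => /eqP ->; lra.
have -> : - s * (semicircle x * ((x - E) / sqdist E e x)) =
   semicircle x * (- s * (x - E)) / sqdist E e x by ring.
case: (boolP (2^-1 <= - s * x <= 1)) => [/andP[y1 y2]|_] /=; rewrite ?mulr0.
  rewrite mulr1 -[leLHS]mul1r ler_pM//.
    rewrite -[leLHS]mulr1 ler_pM//.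
    rewrite -[leLHS]sqrtr1 ler_wsqrtr//.
    by case/orP: s1 y1 y2 => /eqP ->; nra.
    by case/orP: s1 E1 y1 y2 => /eqP ->; lra.
  have u12 : - s * (x - E) <= 12 by case/orP: s1 E10 y1 y2 => /eqP ->; lra.
  rewrite lef_pV2 ?posrE// /sqdist.
  have -> : (x - E) ^+ 2 = (- s * (x - E)) ^+ 2.
    by rewrite exprMn sqrrN (expr2 s) s2 mul1r.
  by move: un u12; set u := - s * (x - E); nra.
by rewrite divr_ge0 ?(ltW k0)// mulr_ge0// semicircle_ge0.
Qed.

(** The imaginary part alone degenerates near the edges
    of the spectrum, and the real part alone degenerates near the origin. *)
Lemma stieltjes_semicircle_lower : exists2 c : R, 0 < c & forall z,
  -10 <= complex.Re z <= 10 -> 0 < complex.Im z <= 10 ->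
  c <= cabs (stieltjes_semicircle z).
Proof.
have pi0 : 0 < (2 * pi : R)^-1 by rewrite invr_gt0 mulr_gt0// pi_gt0.
exists ((2 * pi)^-1 * (2 * (16 * 16))^-1) => [|[E e] /= E10 e0].
  by rewrite mulr_gt0// invr_gt0.
have e00 : 0 < e by case/andP: e0.
rewrite stieltjes_semicircleE//=.
set I1 := Rintegral _ _ _; set I2 := Rintegral _ _ _.
have -> : cabs ((2 * pi)^-1%:C * (I1 +i* I2)) = (2 * pi)^-1 * cabs (I1 +i* I2).
  apply: complexI; rewrite cabsE normrM -cabsE rmorphM -cabsE cabs_real.
  by rewrite ger0_norm// ltW.
rewrite ler_pM2l//.
have h1 := Re_le_cabs (I1 +i* I2); have h2 := Im_le_cabs (I1 +i* I2).
rewrite /= in h1 h2.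
have [E1|E1] := boolP (-1 <= E <= 1).
  apply: le_trans h2; apply: le_trans (ler_norm _).
  by apply: le_trans (cauchy_im_lower E1 e0); rewrite lef_pV2// ?posrE; lra.
apply: le_trans h1.
have [E0|E0] := leP 0 E.
  apply: le_trans (@cauchy_re_lower 1 E e _ _ _ e0) _; rewrite ?eqxx//; try lra.
  by rewrite mulN1r -normrN ler_norm.
apply: le_trans (@cauchy_re_lower (-1) E e _ _ _ e0) _; rewrite ?eqxx ?orbT//; try lra.
by rewrite opprK mul1r ler_norm.
Qed.

Lemma stieltjes_semicircle_upper z : 0 < complex.Im z ->
  cabs (stieltjes_semicircle z) <= 16 * (complex.Im z)^-1.
Proof.
case: z => E e /= e0.
rewrite stieltjes_semicircleE//=.
set I1 := Rintegral _ _ _; set I2 := Rintegral _ _ _.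
have pi0 : 0 < (2 * pi : R)^-1 by rewrite invr_gt0 mulr_gt0// pi_gt0.
have -> : cabs ((2 * pi)^-1%:C * (I1 +i* I2)) = (2 * pi)^-1 * cabs (I1 +i* I2).
  apply: complexI; rewrite cabsE normrM -cabsE rmorphM -cabsE cabs_real.
  by rewrite ger0_norm// ltW.
have rho2 x : `|semicircle x| <= 2.
  rewrite ger0_norm ?semicircle_ge0//.
  have -> : (2 : R) = Num.sqrt (2 ^+ 2) by rewrite sqrtr_sqr ger0_norm.
  by rewrite ler_wsqrtr//; have := sqr_ge0 x; lra.
have bnd (f : R -> R) : continuous f -> (forall x, `|f x| <= 2 * e^-1) ->
    `|Rintegral mu J f| <= 8 * e^-1.
  move=> cf fb; apply: le_trans (le_normr_Rintegral _ _) _ => //.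
    exact: integrable_continuous.
  apply: le_trans (_ : Rintegral mu J (cst (2 * e^-1)) <= _).
    apply: le_Rintegral => //.
      apply: integrable_continuous => x.
      by apply: cvg_norm; exact: cf.
    by apply: integrable_continuous => x; exact: cvg_cst.
  rewrite Rintegral_cst//= lebesgue_measure_itv/= lte_fin.
  by rewrite ifT; [rewrite /=; lra|lra].
have b1 : `|I1| <= 8 * e^-1.
  apply: bnd => [|x]; first exact: continuous_cauchy_re.
  rewrite /cauchy_re normrM ler_pM//.
  have k0 := sqdist_gt0 E x e0.
  rewrite normrM [`|_^-1|]gtr0_norm ?invr_gt0// ler_pdivrMr// mulrC.
  rewrite ler_pdivlMr// /sqdist -[in leRHS]real_normK ?num_real//.
  by have := sqr_ge0 (`|x - E| - e); nra.
have b2 : `|I2| <= 8 * e^-1.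
  apply: bnd => [|x]; first exact: continuous_cauchy_im.
  rewrite /cauchy_im normrM ler_pM//.
  have k0 := sqdist_gt0 E x e0.
  rewrite gtr0_norm ?divr_gt0// ler_pdivrMr// mulrC.
  rewrite ler_pdivlMr// /sqdist.
  by have := sqr_ge0 (x - E); nra.
have pi1 : (2 * pi : R)^-1 <= 1.
  by rewrite invf_le1 ?mulr_gt0// ?pi_gt0//; have := @pi_ge2 R; lra.
rewrite -[leRHS]mul1r ler_pM// ?cabs_ge0//; first exact: ltW.
apply: le_trans (cabs_leD _) _; rewrite /= -/I1 -/I2.
have -> : 16 * e^-1 = 8 * e^-1 + 8 * e^-1 by ring.
exact: lerD.
Qed.

End semicircle.

(** * Means of bounded measurable functions *)

Section bounded_measurable.
Local Open Scope classical_set_scope.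
Context d (T : measurableType d) (R : realType).
Implicit Types (f g : T -> R).

Definition bmeasurable f := measurable_fun setT f /\ exists C, forall x, `|f x| <= C.

Lemma bmeasurable_cst c : bmeasurable (fun=> c).
Proof. by split => //; exists `|c|. Qed.

Lemma bmeasurableD f g : bmeasurable f -> bmeasurable g -> bmeasurable (fun x => f x + g x).
Proof.
move=> [mf [C fC]] [mg [D gD]]; split; first exact: measurable_funD.
exists (C + D) => x; apply: le_trans (ler_normD _ _) _; exact: lerD.
Qed.

Lemma bmeasurableN f : bmeasurable f -> bmeasurable (fun x => - f x).
Proof.
move=> [mf [C fC]]; split; first exact: measurableT_comp.
by exists C => x; rewrite normrN.
Qed.

Lemma bmeasurableB f g : bmeasurable f -> bmeasurable g -> bmeasurable (fun x => f x - g x).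
Proof. by move=> bf bg; apply: bmeasurableD => //; exact: bmeasurableN. Qed.

Lemma bmeasurableM f g : bmeasurable f -> bmeasurable g -> bmeasurable (fun x => f x * g x).
Proof.
move=> [mf [C fC]] [mg [D gD]]; split; first exact: measurable_funM.
by exists (C * D) => x; rewrite normrM ler_pM.
Qed.

Lemma bmeasurable_norm f : bmeasurable f -> bmeasurable (fun x => `|f x|).
Proof.
move=> [mf [C fC]]; split; first exact: measurableT_comp.
by exists C => x; rewrite normr_id.
Qed.

Lemma bmeasurable_sum (J : Type) (s : seq J) (p : pred J) (f : J -> T -> R) :
  (forall i, bmeasurable (f i)) -> bmeasurable (fun x => \sum_(i <- s | p i) f i x).
Proof.
move=> bf; elim: s => [|i s IH].
  by under eq_fun do rewrite big_nil; exact: bmeasurable_cst.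
under eq_fun do rewrite big_cons; case: (p i) => //; exact: bmeasurableD.
Qed.

Lemma bmeasurable_prod (J : Type) (s : seq J) (p : pred J) (f : J -> T -> R) :
  (forall i, bmeasurable (f i)) -> bmeasurable (fun x => \prod_(i <- s | p i) f i x).
Proof.
move=> bf; elim: s => [|i s IH].
  by under eq_fun do rewrite big_nil; exact: bmeasurable_cst.
under eq_fun do rewrite big_cons; case: (p i) => //; exact: bmeasurableM.
Qed.

Lemma bmeasurableX f n : bmeasurable f -> bmeasurable (fun x => f x ^+ n).
Proof.
move=> bf; elim: n => [|n IH]; first exact: bmeasurable_cst.
by under eq_fun do rewrite exprS; exact: bmeasurableM.
Qed.

Variable mu : probability T R.

Lemma probability_lty A : measurable A -> (mu A < +oo)%E.
Proof. by move=> mA; apply: le_lt_trans (probability_le1 mu mA) (ltry _). Qed.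

Lemma bmeasurable_integrable f A : measurable A -> bmeasurable f -> mu.-integrable A (EFin \o f).
Proof.
move=> mA [mf [C fC]]; apply: measurable_bounded_integrable => //.
- exact: probability_lty.
- exact: measurable_funS mf.
- exists C; split; first exact: num_real.
  by move=> M CM x _; apply: le_trans (fC x) (ltW CM).
Qed.

Definition mean f := Rintegral mu setT f.

Lemma mean_EFin f : bmeasurable f -> (mean f)%:E = (\int[mu]_x (f x)%:E)%E.
Proof.
by move=> bf; rewrite /mean /Rintegral fineK//; apply: integrable_fin_num => //;
  exact: bmeasurable_integrable.
Qed.

Lemma meanD f g : bmeasurable f -> bmeasurable g ->
  mean (fun x => f x + g x) = mean f + mean g.
Proof. by move=> bf bg; apply: RintegralD => //; exact: bmeasurable_integrable. Qed.

Lemma meanB f g : bmeasurable f -> bmeasurable g ->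
  mean (fun x => f x - g x) = mean f - mean g.
Proof. by move=> bf bg; apply: RintegralB => //; exact: bmeasurable_integrable. Qed.

Lemma meanZ c f : bmeasurable f -> mean (fun x => c * f x) = c * mean f.
Proof. by move=> bf; apply: RintegralZl => //; exact: bmeasurable_integrable. Qed.

Lemma mean_cst c : mean (fun=> c) = c.
Proof.
have mu1 : fine (mu setT) = 1 by rewrite probability_setT.
by rewrite /mean Rintegral_cst// [fine _]mu1 mulr1.
Qed.

Lemma le_mean f g : bmeasurable f -> bmeasurable g -> (forall x, f x <= g x) ->
  mean f <= mean g.
Proof. by move=> bf bg fg; apply: le_Rintegral => //; exact: bmeasurable_integrable. Qed.

Lemma le_norm_mean f : bmeasurable f -> `|mean f| <= mean (fun x => `|f x|).
Proof. by move=> bf; apply: le_normr_Rintegral => //; exact: bmeasurable_integrable. Qed.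

Lemma mean_sum (J : Type) (s : seq J) (p : pred J) (f : J -> T -> R) :
  (forall i, bmeasurable (f i)) ->
  mean (fun x => \sum_(i <- s | p i) f i x) = \sum_(i <- s | p i) mean (f i).
Proof.
move=> bf; elim: s => [|i s IH].
  by under [X in mean X]eq_fun do rewrite big_nil; rewrite mean_cst big_nil.
under [X in mean X]eq_fun do rewrite big_cons; rewrite big_cons.
by case: (p i) => //; rewrite meanD ?IH//; exact: bmeasurable_sum.
Qed.

(** Jensen's inequality for powers: integrate the tangent line of
    [t ^+ n] at the mean. *)
Lemma mean_expr_le f n : bmeasurable f -> (forall x, 0 <= f x) ->
  mean f ^+ n <= mean (fun x => f x ^+ n).
Proof.
move=> bf f0; set c := mean f.
have c0 : 0 <= c by apply: Rintegral_ge0.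
have tangent t : 0 <= t -> c ^+ n + n%:R * c ^+ n.-1 * (t - c) <= t ^+ n.
  move=> t0; case: n => [|n]; first by rewrite !expr0 mul0r mul0r addr0.
  rewrite /= -subr_ge0; elim: n => [|n IH].
    by rewrite expr0 mul1r expr1; lra.
  set u := c ^+ n in IH *.
  have -> : t ^+ n.+2 - (c ^+ n.+2 + n.+2%:R * c ^+ n.+1 * (t - c)) =
     t * (t ^+ n.+1 - (c ^+ n.+1 + n.+1%:R * c ^+ n * (t - c))) +
     n.+1%:R * c ^+ n * (t - c) ^+ 2.
    by rewrite !exprS -/u -[n.+2%:R]natr1; ring.
  by rewrite addr_ge0// mulr_ge0// ?sqr_ge0// mulr_ge0// exprn_ge0.
have bfc : bmeasurable (fun x => f x - c) by apply: bmeasurableB => //; exact: bmeasurable_cst.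
have bl : bmeasurable (fun x => n%:R * c ^+ n.-1 * (f x - c)).
  by apply: bmeasurableM => //; exact: bmeasurable_cst.
have <- : mean (fun x => c ^+ n + n%:R * c ^+ n.-1 * (f x - c)) = c ^+ n.
  rewrite meanD//; last exact: bmeasurable_cst.
  rewrite meanZ// meanB//; last exact: bmeasurable_cst.
  by rewrite !mean_cst subrr mulr0 addr0.
apply: le_mean => [||x]; last exact: tangent.
  by apply: bmeasurableD => //; exact: bmeasurable_cst.
exact: bmeasurableX.
Qed.

Lemma mean_norm_expr_le f n : bmeasurable f ->
  `|mean f| ^+ n <= mean (fun x => `|f x| ^+ n).
Proof.
move=> bf; apply: le_trans (mean_expr_le n (bmeasurable_norm bf) _) => //.
case: n => [|n]; first by rewrite !expr0.
rewrite ler_pXn2r ?nnegrE//; first exact: le_norm_mean.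
exact: Rintegral_ge0.
Qed.

End bounded_measurable.

(** * Resampling the coordinates of a product measure *)

Section configurations.
Local Open Scope classical_set_scope.
Context (R : realType) (I : finType).

Definition box (B : I -> set (R * R)) : set (I -> R * R) :=
  [set x | forall i, B i (x i)].

Definition boxes : set (set (I -> R * R)) :=
  [set A | exists2 B, (forall i, measurable (B i)) & A = box B].

Definition config := g_sigma_algebraType boxes.

Definition resample (S : {set I}) (x y : config) : config :=
  fun i => if i \in S then y i else x i.

Lemma measurable_box B : (forall i, measurable (B i)) ->
  measurable (box B : set config).
Proof. by move=> mB; apply: sub_sigma_algebra; exists B. Qed.

Lemma boxT : box (fun=> setT) = setT.
Proof. by apply/seteqP; split. Qed.

Lemma boxes_setI : setI_closed boxes.
Proof.
move=> _ _ [A mA ->] [B mB ->]; exists (fun i => A i `&` B i).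
  by move=> i; exact: measurableI.
apply/seteqP; split => x /=; first by move=> [xA xB] i; split.
by move=> h; split => i; have [] := h i.
Qed.

Lemma measurable_coord (i : I) :
  measurable_fun setT (fun x : config => x i).
Proof.
move=> _ B mB; rewrite setTI.
have -> : (fun x : config => x i) @^-1` B =
    box (fun j => if j == i then B else setT).
  apply/seteqP; split => x /=; last by move=> /(_ i); rewrite eqxx.
  by move=> xB j; case: eqP => // ->.
by apply: measurable_box => j; case: ifP.
Qed.

Lemma measurable_config d (T : measurableType d) (f : T -> config) :
  (forall i, measurable_fun setT (fun w => f w i)) -> measurable_fun setT f.
Proof.
move=> mf; apply: (@measurability _ _ T config setT f boxes) => // _ [_ [B mB ->] <-].
rewrite setTI.
have -> : f @^-1` box B = \bigcap_(i in [set: I]) (fun w => f w i) @^-1` B i.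
  by apply/seteqP; split => w /= h i; [move=> _|]; apply: h.
apply: fin_bigcap_measurable => [|i _]; first exact: finite_finset.
by rewrite -[X in measurable X]setTI; exact: mf.
Qed.

Lemma measurable_resample (S : {set I}) :
  measurable_fun setT (fun z : config * config => resample S z.1 z.2).
Proof.
apply: measurable_config => i; rewrite /resample.
case: (i \in S); apply: (measurableT_comp (measurable_coord i)).
  exact: measurable_snd.
exact: measurable_fst.
Qed.

Lemma measurable_resample1 (S : {set I}) (x : config) :
  measurable_fun setT (fun y => resample S x y).
Proof.
apply: measurable_config => i; rewrite /resample.
by case: (i \in S); [exact: measurable_coord|exact: measurable_cst].
Qed.

Lemma measurable_resample2 (S : {set I}) (y : config) :
  measurable_fun setT (fun x => resample S x y).
Proof.
apply: measurable_config => i; rewrite /resample.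
by case: (i \in S); [exact: measurable_cst|exact: measurable_coord].
Qed.

End configurations.

Section resampling.
Local Open Scope classical_set_scope.
Context (R : realType) (I : finType).
Local Notation config := (config R I).
Variable mu : probability config R.

(** The coordinates are independent under [mu]. *)
Hypothesis mu_box : forall B : I -> set (R * R), (forall i, measurable (B i)) ->
  mu (box B) = (\prod_i mu (box (fun j => if j == i then B i else setT)))%E.

Let mu2 : probability (config * config)%type R := (mu \x mu)%E.

(** The one probabilistic input: replacing a set of coordinates by an
    independent copy does not change the law.  Both laws agree on boxes, which
    are stable under intersection and generate the sigma-algebra. *)
Lemma resample_law S A : measurable A ->
  mu2 ((fun z => resample S z.1 z.2) @^-1` A) = mu A.
Proof.
move=> mA.
have mr := @measurable_resample R I S.
pose X : {mfun (config * config)%type >-> config} :=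
  mfun_Sub (mem_set mr : (fun z => resample S z.1 z.2) \in mfun).
pose nu := distribution mu2 X.
rewrite -[LHS]/(nu A).
apply: (@measure_unique _ R config (@boxes R I) (fun=> setT) _ _ _ _ nu mu) => //.
- exact: boxes_setI.
- by move=> _; exists (fun=> setT) => //; rewrite boxT.
- by apply/seteqP; split => // x _; exists 0%N.
- move=> _ [B mB ->].
  rewrite /nu /distribution /pushforward /=.
  pose B1 i := if i \in S then setT else B i.
  pose B2 i := if i \in S then B i else setT.
  have mB1 i : measurable (B1 i) by rewrite /B1; case: ifP.
  have mB2 i : measurable (B2 i) by rewrite /B2; case: ifP.
  have -> : (fun z : config * config => resample S z.1 z.2) @^-1` box B =
      box B1 `*` box B2.
    apply/seteqP; split => -[x y] /=.
      move=> h; split => i; have := h i; rewrite /resample /B1 /B2;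
      by case: ifP.
    move=> [h1 h2] i; have := h1 i; have := h2 i; rewrite /resample /B1 /B2;
      by case: ifP.
  rewrite [LHS]product_measure1E; [|exact: measurable_box..].
  rewrite [X in (X * _)%E]mu_box// [X in (_ * X)%E]mu_box// [RHS]mu_box//.
  rewrite -big_split/=; apply: eq_bigr => i _.
  have mu1 : mu setT = 1%E by exact: probability_setT.
  have bT : box (fun j : I => if j == i then setT else setT) = setT :> set config.
    by rewrite -[RHS](@boxT R I); congr box; apply/funext => j; case: ifP.
  rewrite /B1 /B2; case: ifP => _.
    by rewrite bT [X in (X * _)%E]mu1 mul1e.
  by rewrite bT [X in (_ * X)%E]mu1 mule1.
- by move=> _; apply: probability_lty.
Qed.

Notation mean := (mean mu).
Implicit Types (f g : config -> R) (S : {set I}).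

Lemma bmeasurable_resample f S : bmeasurable f ->
  bmeasurable (fun z : config * config => f (resample S z.1 z.2)).
Proof.
move=> [mf [C fC]]; split; last by exists C.
exact: (measurableT_comp mf (@measurable_resample R I S)).
Qed.

Lemma bmeasurable_resample1 f S x : bmeasurable f -> bmeasurable (fun y => f (resample S x y)).
Proof.
move=> [mf [C fC]]; split; last by exists C.
exact: (measurableT_comp mf (@measurable_resample1 R I S x)).
Qed.

Lemma bmeasurable_resample2 f S y : bmeasurable f -> bmeasurable (fun x => f (resample S x y)).
Proof.
move=> [mf [C fC]]; split; last by exists C.
exact: (measurableT_comp mf (@measurable_resample2 R I S y)).
Qed.

(** Averages over an independent copy of the coordinates in [S]: the
    conditional expectation given the other coordinates. *)
Definition avg S f : config -> R := fun x => mean (fun y => f (resample S x y)).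

Lemma bmeasurable_avg f S : bmeasurable f -> bmeasurable (avg S f).
Proof.
move=> bf; split; last first.
  have [_ [C fC]] := bf; exists C => x.
  apply: le_trans (le_norm_mean _ (bmeasurable_resample1 S x bf)) _.
  rewrite -[leRHS](mean_cst mu); apply: le_mean => //.
  - exact: bmeasurable_norm (bmeasurable_resample1 S x bf).
  - exact: bmeasurable_cst.
have h := measurable_fubini_F (bmeasurable_integrable mu2 measurableT (bmeasurable_resample S bf)).
exact: (measurableT_comp (@fine_measurable R _ measurableT) h).
Qed.

Lemma mean_avg S f : bmeasurable f -> mean (avg S f) = mean f.
Proof.
move=> bf; apply: EFin_inj; rewrite !mean_EFin//; last exact: bmeasurable_avg.
transitivity (\int[mu]_x \int[mu]_y (f (resample S x y))%:E)%E.
  by apply: eq_integral => x _; rewrite mean_EFin//; exact: bmeasurable_resample1.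
have bi := bmeasurable_integrable mu2 measurableT (bmeasurable_resample S bf).
have := integral12_prod_meas1 bi; rewrite /fubini_F /= => ->.
have mr := @measurable_resample R I S.
have mf : measurable_fun setT (EFin \o f) by apply/measurable_EFinP; case: bf.
have := integral_pushforward mr mf bi measurableT.
rewrite preimage_setT => <-.
apply: eq_measure_integral => A mA _; exact: resample_law.
Qed.

(** Resampling [S'] and then [S] amounts to one resampling of the union
    by a configuration that is itself resampled, and that has the same law. *)
Lemma avg_avg S S' f : bmeasurable f -> avg S (avg S' f) = avg (S :|: S') f.
Proof.
move=> bf; apply/funext => x.
rewrite {1}/avg.
have -> : (fun y => avg S' f (resample S x y)) =
    avg S' (fun u => f (resample (S :|: S') x u)).
  apply/funext => y; rewrite /avg; congr (mean _); apply/funext => z.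
  congr (f _); apply/funext => i; rewrite /resample !inE.
  by case: (i \in S); case: (i \in S').
by rewrite mean_avg//; exact: bmeasurable_resample1.
Qed.

Lemma avgC S S' f : bmeasurable f -> avg S (avg S' f) = avg S' (avg S f).
Proof. by move=> bf; rewrite !avg_avg// finset.setUC. Qed.

Lemma avgB S f g : bmeasurable f -> bmeasurable g ->
  avg S (fun x => f x - g x) = (fun x => avg S f x - avg S g x).
Proof.
by move=> bf bg; apply/funext => x; apply: meanB; exact: bmeasurable_resample1.
Qed.

Definition resample_invariant S f := forall x y, f (resample S x y) = f x.

Lemma invariant_avg S f : bmeasurable f -> resample_invariant S (avg S f).
Proof.
move=> bf x y; rewrite /avg; congr (mean _); apply/funext => z.
by congr (f _); apply/funext => i; rewrite /resample; case: (i \in S).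
Qed.

Lemma avg_invariant S f : resample_invariant S f -> avg S f = f.
Proof.
move=> fS; apply/funext => x; rewrite /avg.
by under [X in mean X]eq_fun do rewrite fS; rewrite mean_cst.
Qed.

Lemma avgMl S f g : bmeasurable f -> resample_invariant S g ->
  avg S (fun x => g x * f x) = (fun x => g x * avg S f x).
Proof.
move=> bf gS; apply/funext => x; rewrite /avg.
under [X in mean X]eq_fun do rewrite gS.
by rewrite meanZ//; exact: bmeasurable_resample1.
Qed.

Lemma mean_norm_avg_le S f n : bmeasurable f ->
  mean (fun x => `|avg S f x| ^+ n) <= mean (fun x => `|f x| ^+ n).
Proof.
move=> bf.
have bn := bmeasurableX n (bmeasurable_norm bf).
rewrite -[leRHS](mean_avg S)//; apply: le_mean.
- exact/bmeasurableX/bmeasurable_norm/bmeasurable_avg.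
- exact: bmeasurable_avg.
- by move=> x; apply: mean_norm_expr_le; exact: bmeasurable_resample1.
Qed.

(** The fluctuation with respect to the coordinates in [S]. *)
Definition flu S f : config -> R := fun x => f x - avg S f x.

Lemma bmeasurable_flu S f : bmeasurable f -> bmeasurable (flu S f).
Proof. by move=> bf; apply: bmeasurableB => //; exact: bmeasurable_avg. Qed.

Lemma fluC_avg S S' f : bmeasurable f -> flu S (avg S' f) = avg S' (flu S f).
Proof.
move=> bf; apply/funext => x.
have -> : avg S' (flu S f) x = avg S' f x - avg S' (avg S f) x.
  by have := avgB S' bf (bmeasurable_avg S bf) => /(congr1 (fun h => h x)).
by rewrite -(avgC S S' bf).
Qed.

Lemma fluC S S' f : bmeasurable f -> flu S (flu S' f) = flu S' (flu S f).
Proof.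
move=> bf; apply/funext => x.
have E S1 S2 : flu S1 (flu S2 f) x =
    f x - avg S2 f x - (avg S1 f x - avg S1 (avg S2 f) x).
  have := avgB S1 bf (bmeasurable_avg S2 bf) => /(congr1 (fun h => h x)) <-.
  by [].
by rewrite !E (avgC S S' bf); ring.
Qed.

Lemma avg_flu S f : bmeasurable f -> avg S (flu S f) = fun=> 0.
Proof.
move=> bf; have ba := bmeasurable_avg S bf; rewrite /flu avgB//.
by rewrite avg_avg// finset.setUid; apply/funext => x; rewrite subrr.
Qed.

(** A fluctuation is orthogonal to the functions of the other
    coordinates. *)
Lemma mean_flu_mul S f g : bmeasurable f -> bmeasurable g -> resample_invariant S g ->
  mean (fun x => flu S f x * g x) = 0.
Proof.
move=> bf bg gS.
have bq := bmeasurable_flu S bf.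
rewrite -(mean_avg S); last exact: bmeasurableM.
under [X in avg S X]eq_fun do rewrite mulrC.
by rewrite avgMl// avg_flu//; under [X in mean X]eq_fun do rewrite mulr0;
  rewrite mean_cst.
Qed.

Lemma normD_expr_le (a b : R) n :
  `|a - b| ^+ n <= 2 ^+ n * (`|a| ^+ n + `|b| ^+ n).
Proof.
have h : `|a - b| <= 2 * Num.max `|a| `|b|.
  apply: le_trans (ler_normB _ _) _; rewrite mulr_natl mulr2n.
  by rewrite lerD// le_max lexx ?orbT.
have m0 : 0 <= Num.max `|a| `|b| by rewrite le_max normr_ge0.
apply: le_trans (_ : (2 * Num.max `|a| `|b|) ^+ n <= _).
  by apply: lerXn2r; rewrite ?nnegrE// mulr_ge0.
rewrite exprMn ler_pM2l ?exprn_gt0//.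
by have [_|_] := leP `|a| `|b|; rewrite ?lerDl ?lerDr exprn_ge0.
Qed.

Lemma mean_norm_flu_le S f n : bmeasurable f ->
  mean (fun x => `|flu S f x| ^+ n) <= 4 ^+ n * mean (fun x => `|f x| ^+ n).
Proof.
move=> bf; have ba := bmeasurable_avg S bf.
have bn := bmeasurableX n (bmeasurable_norm bf); have bn' := bmeasurableX n (bmeasurable_norm ba).
case: n bn bn' => [|n] bn bn'.
  rewrite -[leLHS]/(mean (fun=> 1)) -[X in _ <= _ * X]/(mean (fun=> 1)).
  by rewrite mean_cst expr0 mul1r.
apply: le_trans (_ : mean (fun x => 2 ^+ n.+1 * (`|f x| ^+ n.+1 + `|avg S f x| ^+ n.+1)) <= _).
  apply: le_mean => [||x]; last exact: normD_expr_le.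
    exact/bmeasurableX/bmeasurable_norm/bmeasurable_flu.
  by apply: bmeasurableM; [exact: bmeasurable_cst|exact: bmeasurableD].
have -> : (4 : R) = 2 * 2 by ring.
rewrite meanZ; last exact: bmeasurableD.
rewrite (meanD _ bn bn') exprMn -mulrA ler_pM2l ?exprn_gt0//.
have le1 := mean_norm_avg_le S n.+1 bf.
set u := mean _ in le1 *; set v := mean (fun x => `|f x| ^+ _) in le1 *.
have v0 : 0 <= v by apply: Rintegral_ge0.
apply: le_trans (_ : 2 * v <= _).
  by rewrite mulr_natl mulr2n lerD2l.
by rewrite ler_wpM2r// exprS ler_peMr// exprn_ege1// ler1n.
Qed.

End resampling.

(** * Transferring fluctuation operators between the factors of a product *)

Lemma telescope_prod (R : comPzRingType) n (x y : 'I_n -> R) :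
  \prod_(t < n) x t - \prod_(t < n) y t =
  \sum_(q < n) \prod_(t < n) (if (t < q)%N then y t
                        else if t == q then x t - y t else x t).
Proof.
pose A (q : nat) := \prod_(t < n) (if (t < q)%N then y t else x t).
transitivity (A 0 - A n).
  by congr (_ - _); apply: eq_bigr => t _; rewrite ?ltn_ord.
have -> : A 0 - A n = \sum_(q < n) (A q - A q.+1).
  rewrite -(big_mkord xpredT (fun q => A q - A q.+1)).
  have -> : \sum_(0 <= q < n) (A q - A q.+1) =
      - \sum_(0 <= q < n) (A q.+1 - A q).
    by rewrite -sumrN; apply: eq_bigr => q _; rewrite opprB.
  by rewrite telescope_sumr// opprB.
apply: eq_bigr => q _; rewrite /A (bigD1 q)//= ltnn [X in _ - X](bigD1 q)//=.
rewrite ltnSn [RHS](bigD1 q)//= ltnn eqxx mulrBl; congr (_ * _ - _ * _).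
  by apply: eq_bigr => t /negPf ->.
apply: eq_bigr => t /negPf tq; rewrite tq ltnS leq_eqVlt.
by have -> : (t == q :> nat) = false by [].
Qed.

Lemma prod_le_sum_expr (R : realDomainType) n (y : 'I_n -> R) :
  (0 < n)%N -> (forall r, 0 <= y r) -> \prod_r y r <= \sum_r y r ^+ n.
Proof.
case: n y => // n y _ y0.
have [m _ hm] := @Order.TotalTheory.arg_maxP _ _ _ ord0 xpredT y isT.
apply: le_trans (_ : y m ^+ n.+1 <= _).
  have -> : y m ^+ n.+1 = \prod_(r < n.+1) y m.
    by rewrite prodr_const card_ord.
  by apply: ler_prod => r _; rewrite y0 /=; exact: hm.
by rewrite (bigD1 m)//= lerDl sumr_ge0// => r _; rewrite exprn_ge0.
Qed.

Section operator_words.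
Context (R : realType) (I L : finType).
Local Notation config := (config R I).
Variable mu : probability config R.
Hypothesis mu_box : forall B : I -> set (R * R), (forall i, measurable (B i)) ->
  mu (box B) = (\prod_i mu (box (fun j => if j == i then B i else setT)))%E.
Variables (star : L -> {set I}) (x0 : config).
Implicit Types (f g : config -> R) (s t : seq (bool * L)).
Local Notation mean := (mean mu).

(** An operator is coded by a boolean, true for a fluctuation Q_k and false for
    an average P_k, and by its label k. *)
Definition op1 (o : bool * L) f :=
  if o.1 then flu mu (star o.2) f else avg mu (star o.2) f.

Definition ops s f := foldr op1 f s.

Lemma bmeasurable_op1 o f : bmeasurable f -> bmeasurable (op1 o f).
Proof. by move=> bf; rewrite /op1; case: ifP => _; [exact: bmeasurable_flu|exact: bmeasurable_avg]. Qed.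

Lemma bmeasurable_ops s f : bmeasurable f -> bmeasurable (ops s f).
Proof. by move=> bf; elim: s => //= o s IH; exact: bmeasurable_op1. Qed.

Lemma op1C o o' f : bmeasurable f -> op1 o (op1 o' f) = op1 o' (op1 o f).
Proof.
move=> bf; rewrite /op1; case: o.1; case: o'.1.
- exact: fluC.
- exact: fluC_avg.
- by rewrite fluC_avg.
- exact: avgC.
Qed.

Lemma ops_op1 s o f : bmeasurable f -> ops s (op1 o f) = op1 o (ops s f).
Proof.
move=> bf; elim: s => //= o' s ->; apply: op1C; exact: bmeasurable_ops.
Qed.

Lemma ops_rem s o f : bmeasurable f -> o \in s -> ops s f = op1 o (ops (rem o s) f).
Proof.
move=> bf; elim: s => //= o' s IH; rewrite in_cons eq_sym.
case: eqP => [->//|_ /= os]; rewrite (IH os) /=; apply: op1C; exact: bmeasurable_ops.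
Qed.

Lemma op1B o f g : bmeasurable f -> bmeasurable g ->
  op1 o (fun x => f x - g x) = (fun x => op1 o f x - op1 o g x).
Proof.
move=> bf bg; rewrite /op1; case: o.1; last exact: avgB.
apply/funext => x; have /(congr1 (fun h => h x)) h := avgB mu (star o.2) bf bg.
by rewrite /flu h; ring.
Qed.

Lemma opsB s f g : bmeasurable f -> bmeasurable g ->
  ops s (fun x => f x - g x) = (fun x => ops s f x - ops s g x).
Proof.
by move=> bf bg; elim: s => //= o s ->; rewrite op1B//; exact: bmeasurable_ops.
Qed.

Lemma op1_0 o : op1 o (fun=> 0) = fun=> 0.
Proof.
have a0 S : avg mu S (fun=> 0) = fun=> 0 by apply: avg_invariant.
by rewrite /op1 /flu a0; case: o.1 => //; apply/funext => x; rewrite subrr.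
Qed.

Lemma ops_0 s : ops s (fun=> 0) = fun=> 0.
Proof. by elim: s => //= o s ->; rewrite op1_0. Qed.

(** Sets the coordinates of [star k] to reference values.  For matrices the
    reference value is zero and this removes row and column [k]. *)
Definition freeze k f : config -> R := fun x => f (resample (star k) x x0).

Lemma bmeasurable_freeze k f : bmeasurable f -> bmeasurable (freeze k f).
Proof. exact: bmeasurable_resample2. Qed.

Lemma ops_freeze s k f : bmeasurable f -> (true, k) \in s ->
  ops s (freeze k f) = fun=> 0.
Proof.
move=> bf ks; have bk := bmeasurable_freeze k bf.
rewrite (ops_rem bk ks) -ops_op1// /op1 /= /flu.
rewrite avg_invariant => [|x y].
  by rewrite -[RHS](ops_0 (rem (true, k) s)); congr ops; apply/funext => x;
    rewrite subrr.
rewrite /freeze; congr f; apply/funext => i; rewrite /resample.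
by case: (i \in star k).
Qed.

Definition freeze_diff f k : config -> R := fun x => f x - freeze k f x.

Definition freeze_diffs (B : seq L) f := foldl freeze_diff f B.

Lemma bmeasurable_freeze_diffs B f : bmeasurable f -> bmeasurable (freeze_diffs B f).
Proof.
elim: B f => //= k B IH f bf; apply: IH; apply: bmeasurableB => //; exact: bmeasurable_freeze.
Qed.

(** A fluctuation operator kills functions that ignore its
    coordinates, such as [freeze k f]. *)
Lemma ops_freeze_diffs s B f : bmeasurable f ->
  (forall k, k \in B -> (true, k) \in s) -> ops s (freeze_diffs B f) = ops s f.
Proof.
elim: B f => //= k B IH f bf Bs; rewrite IH.
- have bk := bmeasurable_freeze k bf.
  rewrite /freeze_diff opsB// ops_freeze ?Bs ?mem_head//.
  by apply/funext => x; rewrite subr0.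
- by apply: bmeasurableB => //; exact: bmeasurable_freeze.
- by move=> l lB; apply: Bs; rewrite in_cons lB orbT.
Qed.

Lemma mean_norm_ops_le s f n : bmeasurable f ->
  mean (fun x => `|ops s f x| ^+ n) <=
  (4 ^+ n) ^+ size s * mean (fun x => `|f x| ^+ n).
Proof.
move=> bf; elim: s => [|o s IH] /=; first by rewrite expr0 mul1r.
have bs := bmeasurable_ops s bf.
have n4 : 1 <= 4 ^+ n :> R by rewrite exprn_ege1// ler1n.
apply: le_trans (_ : 4 ^+ n * mean (fun x => `|ops s f x| ^+ n) <= _).
  rewrite {1}/op1; case: o.1; first exact: mean_norm_flu_le.
  apply: le_trans (mean_norm_avg_le _ _ _ bs) _ => //.
  by rewrite ler_peMl//; apply: Rintegral_ge0 => x _; rewrite exprn_ge0.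
by rewrite exprS -mulrA ler_pM2l// (lt_le_trans _ n4).
Qed.

Definition gains t := [seq o.2 | o <- t & o.1].

(** [t r] lists the operators added in front of the factor [r].  Every
    label of [L0] becomes a fluctuation operator of exactly one factor other
    than its owner. *)
Record transfer n (own : L -> 'I_n) (L0 : seq L) (t : 'I_n -> seq (bool * L)) :
    Prop := Transfer {
  transfer_label : forall r k, k \in gains (t r) -> k \in L0 /\ own k != r;
  transfer_uniq : forall r, uniq (gains (t r));
  transfer_size : forall r, (size (t r) <= size L0)%N;
  transfer_total : (\sum_r size (gains (t r)) = size L0)%N }.

(** Let [k] be the first label.  If all the factors but the
    owner's were averaged over [star k], the mean would vanish, because the
    owner's factor is a fluctuation.  The difference between the product and the
    averaged one telescopes over the factors [q] into products where factor
    [q] carries a fluctuation operator of label [k], and the factors before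
    it an average. *)
Lemma mean_prod_transfer n (f : 'I_n -> config -> R) (own : L -> 'I_n) L0 :
  (forall r, bmeasurable (f r)) -> uniq L0 ->
  forall (s : 'I_n -> seq (bool * L)) (C : R), 0 <= C ->
  (forall k, k \in L0 -> (true, k) \in s (own k)) ->
  (forall t : 'I_n -> seq (bool * L), transfer own L0 t ->
     `|mean (fun x => \prod_r ops (t r ++ s r) (f r) x)| <= C) ->
  `|mean (fun x => \prod_r ops (s r) (f r) x)| <= n%:R ^+ size L0 * C.
Proof.
move=> bf; elim: L0 => [|k L0 IH] /= + s C C0 => [_ _ h|/andP[kL0 uL0] sk h].
  rewrite expr0 mul1r; apply: (h (fun=> [::])); split => //.
  by rewrite big1.
pose r0 := own k.
pose upd (q : 'I_n) (t : 'I_n) : seq (bool * L) :=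
  if t == r0 then [::] else if (t < q)%N then [:: (false, k)]
  else if t == q then [:: (true, k)] else [::].
pose x r := ops (s r) (f r).
have bx r : bmeasurable (x r) by exact: bmeasurable_ops.
pose y r := if r == r0 then x r else avg mu (star k) (x r).
have by_ r : bmeasurable (y r) by rewrite /y; case: ifP => // _; exact: bmeasurable_avg.
pose z (q : 'I_n) := fun v => \prod_t ops (upd q t ++ s t) (f t) v.
have bz q : bmeasurable (z q) by apply: bmeasurable_prod => t; exact: bmeasurable_ops.
(* The term [q = r0] of the telescoping sum vanishes because [y] and [x] agree
   at [r0]. *)
have split_ v : \prod_r x r v = \prod_r y r v + \sum_(q | q != r0) z q v.
  apply/eqP; rewrite addrC -subr_eq telescope_prod; apply/eqP.
  rewrite (bigD1 r0)//= (bigD1 r0)//= ltnn eqxx /y eqxx subrr mul0r add0r.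
  apply: eq_bigr => q qr; apply: eq_bigr => t _; rewrite /upd.
  case: eqP => [->|_]; first by rewrite subrr eq_sym (negPf qr) if_same.
  by case: ifP => // _; case: ifP.
have y0 : mean (fun v => \prod_r y r v) = 0.
  pose g v := \prod_(r | r != r0) y r v.
  have kr0 : (true, k) \in s r0 by apply: sk; rewrite mem_head.
  have bs : bmeasurable (ops (rem (true, k) (s r0)) (f r0)) by exact: bmeasurable_ops.
  have bg : bmeasurable g by exact: bmeasurable_prod.
  rewrite -[RHS](@mean_flu_mul R I mu mu_box (star k) _ g bs bg).
    congr (mean _); apply/funext => v; rewrite (bigD1 r0)//=; congr (_ * _).
    by rewrite /y eqxx /x (ops_rem (bf r0) kr0).
  move=> v w; apply: eq_bigr => r /negPf rr0; rewrite /y rr0.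
  exact: invariant_avg.
have -> : mean (fun v => \prod_r ops (s r) (f r) v) = \sum_(q | q != r0) mean (z q).
  have -> : (fun v => \prod_r ops (s r) (f r) v) =
      (fun v => \prod_r y r v + \sum_(q | q != r0) z q v).
    by apply/funext => v; exact: split_.
  have bY : bmeasurable (fun v => \prod_r y r v) by exact: bmeasurable_prod.
  have bZ : bmeasurable (fun v => \sum_(q | q != r0) z q v) by exact: bmeasurable_sum.
  by rewrite (meanD mu bY bZ) y0 add0r mean_sum.
have step q : q != r0 -> `|mean (z q)| <= n%:R ^+ size L0 * C.
  move=> qr; apply: IH => // [l lL0|t [t1 t2 t3 t4]].
    by rewrite mem_cat sk ?orbT// in_cons lL0 orbT.
  have -> : (fun x => \prod_r ops (t r ++ (upd q r ++ s r)) (f r) x) =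
      (fun x => \prod_r ops ((t r ++ upd q r) ++ s r) (f r) x).
    by apply/funext => v; apply: eq_bigr => r _; rewrite catA.
  apply: h.
  have gE r : gains (t r ++ upd q r) =
      gains (t r) ++ (if r == q then [:: k] else [::]).
    rewrite /gains filter_cat map_cat; congr (_ ++ _); rewrite /upd.
    have [->|rq] := eqVneq r q; first by rewrite (negPf qr) ltnn.
    by case: ifP => // _; case: ifP.
  split.
  - move=> r l; rewrite gE mem_cat => /orP[/t1[lL0 ol]|].
      by rewrite in_cons lL0 orbT.
    case: eqP => // ->; rewrite inE => /eqP ->.
    by rewrite mem_head eq_sym.
  - move=> r; rewrite gE cat_uniq t2; case: eqP => //= _.
    rewrite orbF andbT; apply: contra kL0 => /t1[]//.
  - move=> r; rewrite size_cat /upd.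
    have := t3 r; case: ifP => _ /=; first by rewrite addn0 => /leqW.
    by case: ifP => _; [|case: ifP => _]; rewrite /= ?addn0 ?addn1 ?ltnS// => /leqW.
  - under eq_bigr do rewrite gE size_cat.
    rewrite big_split /= t4; rewrite (bigD1 q)//= eqxx big1 ?addn0 ?addn1//.
    by move=> r /negPf ->.
apply: le_trans (ler_norm_sum _ _ _) _.
apply: le_trans (_ : \sum_(q < n) n%:R ^+ size L0 * C <= _).
  rewrite [leRHS](bigID (fun q => q != r0))/= ler_wpDr ?ler_sum//.
  by rewrite sumr_ge0// => q _; rewrite mulr_ge0// exprn_ge0.
by rewrite sumr_const card_ord exprS -mulrA mulr_natl.
Qed.

(** A crude form of Hoelder's inequality: after normalisation, a product
    of [n] numbers is at most the sum of their [n]-th powers. *)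
Lemma mean_prod_le n (Y : 'I_n -> config -> R) (K : R) (lam : 'I_n -> R) :
  (0 < n)%N -> (forall r, bmeasurable (Y r)) -> (forall r, 0 < lam r) ->
  (forall r, mean (fun x => `|Y r x| ^+ n) <= K * lam r ^+ n) ->
  `|mean (fun x => \prod_r Y r x)| <= n%:R * K * \prod_r lam r.
Proof.
move=> n0 bY lam0 hY.
have bP : bmeasurable (fun x => \prod_r Y r x) by exact: bmeasurable_prod.
have bZ r : bmeasurable (fun x => `|Y r x| ^+ n) by exact/bmeasurableX/bmeasurable_norm.
have bZ' r : bmeasurable (fun x => (lam r ^+ n)^-1 * `|Y r x| ^+ n).
  by apply: bmeasurableM => //; exact: bmeasurable_cst.
have bS : bmeasurable (fun x => \sum_r (lam r ^+ n)^-1 * `|Y r x| ^+ n) by exact: bmeasurable_sum.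
have p0 : 0 < \prod_r lam r by rewrite prodr_gt0.
apply: le_trans (le_norm_mean mu bP) _.
apply: le_trans (_ : mean (fun x =>
    \prod_r lam r * \sum_r (lam r ^+ n)^-1 * `|Y r x| ^+ n) <= _).
  apply: le_mean => [||x]; first exact: bmeasurable_norm.
    by apply: bmeasurableM => //; exact: bmeasurable_cst.
  rewrite mulrC -ler_pdivrMr// normr_prod -prodf_div.
  apply: le_trans (prod_le_sum_expr n0 _) _ => [r|].
    by rewrite divr_ge0// ltW.
  by apply: ler_sum => r _; rewrite exprMn exprVn mulrC.
rewrite (meanZ mu _ bS) mulrC ler_pM2r// mean_sum//.
apply: le_trans (_ : \sum_(r < n) K <= _).
  apply: ler_sum => r _; rewrite (meanZ mu _ (bZ r)) mulrC.
  by rewrite ler_pdivrMr ?exprn_gt0.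
by rewrite sumr_const card_ord mulr_natl.
Qed.

(** The transferred operators act on differences of the functions,
    which are small by hypothesis, and the powers of [psi] add up to
    [n * D + size L0] because each label is transferred once. *)
Lemma mean_prod_ops_le n v (f : 'I_n -> config -> R) (own : L -> 'I_n) L0
    (s : 'I_n -> seq (bool * L)) (K psi : R) D :
  (0 < n)%N -> (forall r, bmeasurable (f r)) -> uniq L0 ->
  (forall k, k \in L0 -> (true, k) \in s (own k)) ->
  (forall r, (size (s r) <= v)%N) -> 0 <= K -> 0 < psi ->
  (forall r B, uniq B -> (forall k, k \in B -> k \in L0 /\ own k != r) ->
     mean (fun x => `|freeze_diffs B (f r) x| ^+ n) <=
     K * (psi ^+ (D + size B)) ^+ n) ->
  `|mean (fun x => \prod_r ops (s r) (f r) x)| <=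
  n%:R ^+ size L0 * (n%:R * ((4 ^+ n) ^+ (size L0 + v) * K)) *
    psi ^+ (n * D + size L0).
Proof.
move=> n0 bf uL0 sk sv K0 psi0 hf; rewrite -mulrA.
apply: (mean_prod_transfer bf uL0 _ sk) => [|t [t1 t2 t3 t4]].
  by rewrite !mulr_ge0// ?exprn_ge0// ltW.
have -> : psi ^+ (n * D + size L0) = \prod_r psi ^+ (D + size (gains (t r))).
  by rewrite prodrXr big_split /= sum_nat_const card_ord t4.
have -> : (fun x => \prod_r ops (t r ++ s r) (f r) x) =
   (fun x => \prod_r ops (t r ++ s r) (freeze_diffs (gains (t r)) (f r)) x).
  apply/funext => x; apply: eq_bigr => r _; rewrite ops_freeze_diffs//.
  move=> k; rewrite /gains => /mapP[[b l]]; rewrite mem_filter /= => /andP[].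
  by case: b => // _ lt ->; rewrite mem_cat lt.
apply: mean_prod_le => // [r|r|r].
- by apply: bmeasurable_ops; exact: bmeasurable_freeze_diffs.
- exact: exprn_gt0.
apply: le_trans (mean_norm_ops_le _ _ _) _; first exact: bmeasurable_freeze_diffs.
have hr := hf r _ (t2 r) (t1 r).
rewrite -mulrA; apply: ler_pM => //.
- by apply: Rintegral_ge0 => x _; rewrite exprn_ge0.
- apply: ler_weXn2l; first by rewrite exprn_ege1// ler1n.
  by rewrite size_cat leq_add.
Qed.

End operator_words.

(** * Coincidences between index tuples *)

Section index_lists.
Context (R : realType) (V L : finType).
Local Notation A := {ffun V -> L}.
Implicit Types (a : A) (l : seq A) (k : L) (G : seq A -> R).
Variable p : pred A.
Hypothesis p_inj : forall a, p a -> injective a.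

(** Sums over [n]-tuples of elements of [A], grown one element at a time, so
    that each new element can be compared with the previous ones. *)
Fixpoint iter_sum n G l : R :=
  if n is n'.+1 then \sum_(a | p a) iter_sum n' G (a :: l) else G l.

Lemma iter_sum_expr n (X : A -> R) l :
  iter_sum n (fun l' => \prod_(a <- l') X a) l =
  (\sum_(a | p a) X a) ^+ n * \prod_(a <- l) X a.
Proof.
elim: n l => [|n IH] l /=; first by rewrite expr0 mul1r.
rewrite exprSr -mulrA mulr_suml mulr_sumr; apply: eq_bigr => a _.
by rewrite IH big_cons.
Qed.

Lemma le_iter_sum n G G' l : all p l ->
  (forall l', all p l' -> size l' = (n + size l)%N -> G l' <= G' l') ->
  iter_sum n G l <= iter_sum n G' l.
Proof.
elim: n l => [|n IH] l pl GG /=; first exact: GG.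
apply: ler_sum => a pa; apply: IH => /= [|l' pl' sl']; first by rewrite pa.
by apply: GG; rewrite // sl' addnS.
Qed.

Lemma iter_sumZ n c G l :
  iter_sum n (fun l' => c * G l') l = c * iter_sum n G l.
Proof.
elim: n l => //= n IH l; rewrite mulr_sumr.
by apply: eq_bigr => a _; rewrite IH.
Qed.

Definition occurrences l k := count (fun a : A => k \in codom a) l.

(** The number of occurrences of labels that repeat an earlier one. *)
Definition excess l := (\sum_k (occurrences l k).-1)%N.

Lemma sum_codom a (P : pred L) : injective a ->
  (\sum_(k | P k) (k \in codom a) = #|[set i | P (a i)]|)%N.
Proof.
move=> ia.
rewrite -sum1_card -big_mkcondr /=.
rewrite (eq_bigl (fun k => k \in a @: [set i | P (a i)])); last first.
  move=> k; apply/andP/imsetP => [[Pk /codomP[v kv]]|[v]].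
    by move: Pk; rewrite kv => Pk; exists v => //; rewrite inE.
  by rewrite inE => Pi ->; rewrite Pi codom_f.
by rewrite big_imset //=; move=> i j _ _; exact: ia.
Qed.

Lemma excess_cons a l : injective a ->
  excess (a :: l) = (#|[set i | (0 < occurrences l (a i))%N]| + excess l)%N.
Proof.
move=> ia; rewrite -(sum_codom (fun k => 0 < occurrences l k)%N ia) /excess.
rewrite [X in (_ = X + _)%N]big_mkcond -big_split /=; apply: eq_bigr => k _.
by rewrite /occurrences /=; case: (k \in codom a); case: (count _ l).
Qed.

Lemma sum_occurrences l (F : {set V}) : all p l ->
  (\sum_k count (fun a => k \in a @: F) l = size l * #|F|)%N.
Proof.
elim: l => [|a l IH] /=; first by rewrite big1.
move=> /andP[pa pl]; rewrite big_split /= IH// mulSn; congr (_ + _)%N.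
rewrite -(card_imset F (p_inj pa)) -sum1_card [RHS]big_mkcond /=.
by apply: eq_bigr => k _; case: ifP.
Qed.

(** The has-clause restricts to labels carried by a vertex of [F], that
    is, to those on which a fluctuation operator acts. *)
Definition lone_labels (F : {set V}) l :=
  [seq k <- enum L | (occurrences l k == 1%N) && has (fun a => k \in a @: F) l].

(** A label that occurs [m > 1] times contributes at most [m] to the left
    side and [2 * (m - 1)] to the right side. *)
Lemma size_lone (F : {set V}) l : all p l ->
  (size l * #|F| <= size (lone_labels F l) + 2 * excess l)%N.
Proof.
move=> pl; rewrite -(sum_occurrences F pl) /lone_labels size_filter -sum1_count big_enum_cond /=.
rewrite /excess big_distrr /= [X in (_ <= X + _)%N]big_mkcond -big_split /=.
apply: leq_sum => k _.
set m := occurrences l k; set c := count _ l.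
have cm : (c <= m)%N.
  apply: sub_count => a /imsetP[i _ ->]; exact: codom_f.
have : has (fun a => k \in a @: F) l = (0 < c)%N by rewrite has_count.
move=> ->; case: eqP => m1 /=; last by lia.
by case: (posnP c) => [->//|c0]; lia.
Qed.

Lemma uniq_lone (F : {set V}) l : uniq (lone_labels F l).
Proof. by rewrite filter_uniq// enum_uniq. Qed.

Lemma size_lone_le (F : {set V}) l : all p l -> (size (lone_labels F l) <= size l * #|F|)%N.
Proof.
move=> pl; rewrite -(sum_occurrences F pl) /lone_labels size_filter -sum1_count big_enum_cond /=.
rewrite big_mkcond; apply: leq_sum => k _; case: ifP => // /andP[_].
by rewrite has_count.
Qed.

Section weights.
Variables (w : A -> R) (M : R).
Hypotheses (w0 : forall a, 0 <= w a) (M1 : 1 <= M).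
Hypothesis wM : forall (S : {set V}) (a0 : A),
  \sum_(a | p a && [forall i in S, a i == a0 i]) w a <= M ^- #|S|.

Let M0 : 0 < M. Proof. exact: lt_le_trans M1. Qed.

(** Each entry that falls into [U] is one of boundedly many
    prescribed values, and prescribing it divides the total weight by [M]. *)
Lemma weight_collision (U : {set L}) (m : nat) : (#|U| <= m)%N ->
  \sum_(a | p a) w a * M ^+ #|[set i | a i \in U]| <=
  2 ^+ #|V| * (m.+1)%:R ^+ #|V|.
Proof.
move=> Um; case: (pickP p) => [a1 pa1|p0]; last first.
  by rewrite big_pred0// mulr_ge0// exprn_ge0.
pose S a := [set i | a i \in U].
(* the entries of [a] outside [U] are forgotten *)
pose c a : A := [ffun i => if a i \in U then a i else a1 i].
pose U1 i := a1 i |: U.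
have cU a : c a \in family (fun i => U1 i).
  apply/familyP => i; rewrite ffunE !inE.
  by case: ifP => [->|]; rewrite ?orbT ?eqxx.
have aS a : [forall i in S a, a i == c a i].
  by apply/forallP => i; apply/implyP; rewrite inE ffunE => ->.

apply: le_trans (_ : \sum_(a | p a) \sum_(Sc : {set V} * A | Sc.2 \in family (fun i => U1 i))
    (if [forall i in Sc.1, a i == Sc.2 i] then w a * M ^+ #|Sc.1| else 0) <= _).
  apply: ler_sum => a pa; rewrite (bigD1 (S a, c a)) ?cU//= aS lerDl.
  apply: sumr_ge0 => -[S' c'] _ /=; case: ifP => // _.
  by rewrite mulr_ge0// exprn_ge0// ltW.
rewrite exchange_big /=.
apply: le_trans (_ : \sum_(Sc : {set V} * A | Sc.2 \in family (fun i => U1 i)) (1 : R) <= _).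
  apply: ler_sum => -[S' c'] _ /=; rewrite -big_mkcondr /= -mulr_suml.
  rewrite -[leRHS](@mulVf _ (M ^+ #|S'|)) ?expf_neq0 ?gt_eqF//.
  by rewrite ler_pM2r ?exprn_gt0.
rewrite sumr_const.
have -> : #|[pred Sc : {set V} * A | Sc.2 \in family (fun i => U1 i)]| =
    (2 ^ #|V| * \prod_i #|U1 i|)%N.
  have -> : (2 ^ #|V| = #|{set V}|)%N.
    by rewrite -(cardsT {set V}) -powersetT card_powerset cardsT.
  have -> : (\prod_i #|U1 i| = #|family (fun i => U1 i)|)%N.
    by rewrite card_family foldrE big_map big_enum.
  rewrite -cardX.
  by apply: eq_card => -[S' c']; rewrite !inE.
rewrite natrM natrX ler_pM2l ?exprn_gt0// natr_prod.
have -> : (m.+1%:R : R) ^+ #|V| = \prod_(i : V) m.+1%:R by rewrite prodr_const.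
apply: ler_prod => i _; rewrite ler0n ler_nat /=.
by rewrite /U1 cardsU1; apply: leq_trans (leq_add (leq_b1 _) Um) _; rewrite add1n.
Qed.

Lemma sum_occurrences_le l : all p l -> (\sum_k occurrences l k <= size l * #|V|)%N.
Proof.
elim: l => [|a l IH] /=; first by rewrite big1.
move=> /andP[pa pl]; rewrite /occurrences /= big_split mulSn leq_add//; last exact: IH.
by rewrite (sum_codom xpredT (p_inj pa)) max_card.
Qed.

Definition weight_of l := \prod_(a <- l) w a * M ^+ excess l.

Lemma weight_of_ge0 l : 0 <= weight_of l.
Proof.
apply: mulr_ge0; first exact: prodr_ge0.
by rewrite exprn_ge0// ltW.
Qed.

Definition weight_const m : R := 2 ^+ #|V| * (m * #|V|).+1%:R ^+ #|V|.

(** Apply [weight_collision] to the set of labels already used. *)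
Lemma iter_sum_weight_of m n l : all p l -> (n + size l <= m)%N ->
  iter_sum n weight_of l <= weight_const m ^+ n * weight_of l.
Proof.
have C0 : 0 <= weight_const m by rewrite mulr_ge0// exprn_ge0.
elim: n l => [|n IH] l pl nm /=; first by rewrite expr0 mul1r.
apply: le_trans (_ : \sum_(a | p a) weight_const m ^+ n * weight_of (a :: l) <= _).
  by apply: ler_sum => a pa; apply: IH; rewrite /= ?pa// -addSnnS.
rewrite -mulr_sumr exprSr -mulrA ler_wpM2l ?exprn_ge0//.
pose U := [set k | (0 < occurrences l k)%N].
have Um : (#|U| <= m * #|V|)%N.
  apply: leq_trans (leq_trans (sum_occurrences_le pl) _).
    rewrite -sum1_card big_mkcond; apply: leq_sum => k _; rewrite inE.
    by case: ifP.
  by rewrite leq_mul2r (leq_trans _ nm) ?orbT// leq_addl.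
apply: le_trans (_ : \sum_(a | p a) w a * M ^+ #|[set i | a i \in U]| * weight_of l <= _).
  apply: ler_sum => a pa; rewrite /weight_of big_cons excess_cons; last exact: p_inj.
  have -> : [set i | (0 < occurrences l (a i))%N] = [set i | a i \in U].
    by apply/setP => i; rewrite !inE.
  by rewrite exprD mulrACA.
rewrite -mulr_suml ler_wpM2r//; first exact: weight_of_ge0.
exact: weight_collision.
Qed.

End weights.
End index_lists.

Lemma count1_inj (T : Type) (P : pred T) (x : T) (l : seq T) i j :
  count P l = 1%N -> (i < size l)%N -> (j < size l)%N ->
  P (nth x l i) -> P (nth x l j) -> i = j.
Proof.
elim: l i j => // a l IH; rewrite /=; case: (boolP (P a)) => Pa.
  move=> i j [c0]; have nP k : (k < size l)%N -> ~ P (nth x l k).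
    move=> kl Pk; have : has P l by apply/(has_nthP x); exists k.
    by rewrite has_count; move: c0; rewrite add0n => ->.
  case: i => [|i]; case: j => [|j] //=; rewrite !ltnS.
  - by move=> _ /nP.
  - by move=> /nP h _ /h.
  - by move=> /nP h _ /h.
move=> [|i] [|j] //=; rewrite ?(negPf Pa)//; rewrite !ltnS => c1 il jl Pi Pj.
by rewrite (IH i j).
Qed.

Section weighted_moments.
Context (R : realType) (I L V : finType).
Local Notation config := (config R I).
Local Notation A := {ffun V -> L}.
Variable mu : probability config R.
Hypothesis mu_box : forall B : I -> set (R * R),
  (forall i, measurable (B i)) ->
  mu (box B) = (\prod_i mu (box (fun j => if j == i then B i else setT)))%E.
Variables (star : L -> {set I}) (x0 : config).
Local Notation mean := (mean mu).
Variables (p : pred A) (w : A -> R) (M : R) (f : A -> config -> R).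
Hypotheses (p_inj : forall a, p a -> injective a).
Hypotheses (w0 : forall a, 0 <= w a) (M1 : 1 <= M).
Hypothesis wM : forall (S : {set V}) (a0 : A),
  \sum_(a | p a && [forall i in S, a i == a0 i]) w a <= M ^- #|S|.
Hypothesis bf : forall a, bmeasurable (f a).

Lemma bmeasurable_iter_sum n (G : seq A -> config -> R) l : (forall l, bmeasurable (G l)) ->
  bmeasurable (fun x => iter_sum p n (fun l' => G l' x) l).
Proof.
move=> bG; elim: n l => [|n IH] l //=.
by apply: bmeasurable_sum => a; exact: IH.
Qed.

Lemma mean_iter_sum n (G : seq A -> config -> R) l : (forall l, bmeasurable (G l)) ->
  mean (fun x => iter_sum p n (fun l' => G l' x) l) =
  iter_sum p n (fun l' => mean (G l')) l.
Proof.
move=> bG; elim: n l => [|n IH] l //=.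
rewrite mean_sum => [|a]; last exact: bmeasurable_iter_sum.
by apply: eq_bigr => a _; exact: IH.
Qed.

Variables (F : {set V}) (n D : nat) (K psi : R).
Hypotheses (n0 : (0 < n)%N) (K0 : 0 <= K) (psi0 : 0 < psi) (psi1 : psi <= 1).
Hypothesis psiM : 1 <= psi ^+ 2 * M.
Hypothesis hf : forall a (B : seq L), p a -> uniq B -> (size B <= n * #|F|)%N ->
  (forall k, k \in B -> k \notin codom a /\ exists2 a', p a' & k \in codom a') ->
  mean (fun x => `|freeze_diffs star x0 B (f a) x| ^+ n) <=
    K * (psi ^+ (D + size B)) ^+ n.

Definition flu_word (a : A) := [seq (true, a i) | i <- enum F].

Lemma mean_prod_flu_le l : all p l -> size l = n ->
  `|mean (fun x => \prod_(a <- l) ops mu star (flu_word a) (f a) x)| <=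
  n%:R ^+ (n * #|F|) * (n%:R * ((4 ^+ n) ^+ (n * #|F| + #|F|) * K)) *
  psi ^+ (n * D + size (lone_labels F l)).
Proof.
move=> pl sl; case: l pl sl => [_ sl|a0 l' pl sl]; first by move: n0; rewrite -sl.
set l := a0 :: l' in pl sl *.
have sm := sl.
pose own k : 'I_n := insubd (Ordinal n0) (find (fun a : A => k \in codom a) l).
pose a_ (r : 'I_n) := nth a0 l r.
have pa r : p (a_ r).
  by move/allP : pl => /(_ (a_ r)); apply; apply: mem_nth; rewrite sm.
have Fk (a : A) k : k \in a @: F -> k \in codom a.
  by move=> /imsetP[i _ ->]; exact: codom_f.
have ownP k : k \in lone_labels F l -> k \in a_ (own k) @: F /\
    forall r, k \in codom (a_ r) -> r = own k.
  rewrite mem_filter => /andP[/andP[/eqP m1 hk] _].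
  have hc : has (fun a : A => k \in codom a) l by apply: sub_has hk => a; exact: Fk.
  have fl : (find (fun a : A => k \in codom a) l < n)%N by rewrite -sm -has_find.
  have cf : k \in codom (a_ (own k)).
    by rewrite /a_ val_insubd fl; exact: (nth_find a0 hc).
  have U r : k \in codom (a_ r) -> r = own k.
    move=> kr; apply: val_inj => /=.
    by apply: (count1_inj m1 _ _ kr cf); rewrite sm.
  split => //; have /(has_nthP a0)[i il ki] := hk.
  have il' : (i < n)%N by rewrite -sm.
  have := U (Ordinal il') (Fk _ _ ki) => <-.
  exact: ki.
have sL : (size (lone_labels F l) <= n * #|F|)%N.
  by have := size_lone_le p_inj F pl; rewrite sm.
have -> : (fun x => \prod_(a <- l) ops mu star (flu_word a) (f a) x) =
    (fun x => \prod_(r < n) ops mu star (flu_word (a_ r)) (f (a_ r)) x).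
  by apply/funext => x; rewrite (big_nth a0) sm big_mkord.
have C0 c : 0 <= 4 ^+ n ^+ c * K by rewrite mulr_ge0// exprn_ge0// exprn_ge0.
apply: le_trans (_ : n%:R ^+ size (lone_labels F l) *
   (n%:R * ((4 ^+ n) ^+ (size (lone_labels F l) + #|F|) * K)) *
   psi ^+ (n * D + size (lone_labels F l)) <= _).
  apply: (mean_prod_ops_le mu_box (x0 := x0) (own := own)) => //.
  - exact: uniq_lone.
  - move=> k /ownP[/imsetP[i iF ki] _]; rewrite {1}ki; apply/mapP.
    by exists i => //; rewrite mem_enum.
  - by move=> r; rewrite size_map -cardE.
  - move=> r B uB hB; apply: hf => //.
      by apply: leq_trans (uniq_leq_size uB _) sL => k /hB[].
    move=> k kB; have [kL kr] := hB k kB; have [ko kU] := ownP k kL.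
    split; first by apply: contra kr => /kU ->.
    by exists (a_ (own k)) => //; exact: Fk.
rewrite ler_wpM2r ?exprn_ge0 ?(ltW psi0)//.
apply: ler_pM => //.
- by rewrite mulr_ge0.
- by apply: ler_weXn2l => //; rewrite ler1n.
rewrite ler_wpM2l// ler_wpM2r//; apply: ler_weXn2l; last by rewrite leq_add2r.
by rewrite exprn_ege1// ler1n.
Qed.

Definition moment_const : R :=
  n%:R ^+ (n * #|F|) * (n%:R * ((4 ^+ n) ^+ (n * #|F| + #|F|) * K)) *
  weight_const R V n ^+ n.

(** By [size_lone] and [1 <= psi ^+ 2 * M], the gains that are
    missing at the labels which are not lone are paid for by [M ^+ excess l],
    and the weights can absorb this factor. *)
Lemma mean_weighted_sum_le :
  mean (fun x => (\sum_(a | p a) w a * ops mu star (flu_word a) (f a) x) ^+ n)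
  <= moment_const * psi ^+ (n * (D + #|F|)).
Proof.
pose G l x := \prod_(a <- l) (w a * ops mu star (flu_word a) (f a) x).
have bY a : bmeasurable (ops mu star (flu_word a) (f a)) by exact: bmeasurable_ops.
have bG l : bmeasurable (G l).
  by apply: bmeasurable_prod => a; apply: bmeasurableM => //; exact: bmeasurable_cst.
have -> : (fun x => (\sum_(a | p a) w a * ops mu star (flu_word a) (f a) x) ^+ n) =
    (fun x => iter_sum p n (fun l => G l x) [::]).
  by apply/funext => x; rewrite iter_sum_expr big_nil mulr1.
rewrite mean_iter_sum//.
set C := n%:R ^+ (n * #|F|) * (n%:R * ((4 ^+ n) ^+ (n * #|F| + #|F|) * K)).
have C0 : 0 <= C by rewrite !mulr_ge0// ?exprn_ge0// exprn_ge0.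
apply: le_trans (_ : iter_sum p n
    (fun l => C * psi ^+ (n * (D + #|F|)) * weight_of w M l) [::] <= _).
  apply: le_iter_sum => // l pl; rewrite addn0 => sl.
  have -> : mean (G l) = \prod_(a <- l) w a *
      mean (fun x => \prod_(a <- l) ops mu star (flu_word a) (f a) x).
    rewrite -meanZ; last exact: bmeasurable_prod.
    by congr (mean _); apply/funext => x; rewrite /G big_split.
  rewrite /weight_of mulrCA ler_wpM2l ?prodr_ge0//.
  apply: le_trans (le_trans (ler_norm _) (mean_prod_flu_le pl sl)) _.
  rewrite -/C -[leRHS]mulrA ler_wpM2l//.
  rewrite mulnDr !exprD -[leRHS]mulrA ler_wpM2l ?exprn_ge0 ?(ltW psi0)//.
  have := size_lone p_inj F pl; rewrite sl => nF.
  set e := excess l in nF *; set b := size (lone_labels F l) in nF *.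
  apply: le_trans (_ : psi ^+ (b + 2 * e) * M ^+ e <= _).
    by rewrite exprD -mulrA exprM -exprMn ler_peMr ?exprn_ge0 ?(ltW psi0)// exprn_ege1.
  rewrite ler_wpM2r ?exprn_ge0 ?(le_trans _ M1)//.
  by apply: ler_wiXn2l => //; exact: ltW.
rewrite iter_sumZ /moment_const -/C [leRHS]mulrAC ler_wpM2l//.
  by rewrite mulr_ge0// exprn_ge0// ltW.
apply: le_trans (iter_sum_weight_of p_inj w0 M1 wM (m := n) _ _) _ => //.
  by rewrite addn0.
rewrite /weight_of big_nil mul1r /excess big1// expr0 mulr1.
by [].
Qed.

End weighted_moments.

(** * Uniqueness of conditional expectations *)

Section condexp_unique.
Local Open Scope classical_set_scope.
Context d (T : measurableType d) (R : realType) (P : probability T R).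
Variable F : set (set T).
Hypotheses (sF : sigma_algebra setT F) (subF : F `<=` measurable).
Implicit Types X Y : T -> R.

Let T' := g_sigma_algebraType F.

Let FE : @measurable _ T' = F.
Proof. exact: sigma_algebra_id. Qed.

Lemma is_condexp_measurable X Y : is_condexp P F X Y -> measurable_fun setT Y.
Proof. by move=> [mY _ _] _ B mB; rewrite setTI; apply: subF; exact: mY. Qed.

(** The event belongs to [F], so that both functions have the same
    integral over it. *)
Lemma is_condexp_lt0 X Y Y' : is_condexp P F X Y -> is_condexp P F X Y' ->
  P [set w | Y' w < Y w] = 0.
Proof.
move=> hY hY'; have [FY iY eY] := hY; have [FY' iY' eY'] := hY'.
set A := [set w | Y' w < Y w].
have mY : measurable_fun setT (Y : T' -> R).
  by move=> _ B mB; rewrite setTI FE; exact: FY.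
have mY' : measurable_fun setT (Y' : T' -> R).
  by move=> _ B mB; rewrite setTI FE; exact: FY'.
have FA : F A.
  rewrite -FE.
  have := measurable_fun_ltr mY' mY measurableT (Y := [set true]) I.
  by rewrite setTI.
have mA : measurable A by exact: subF.
have iAY := integrableS measurableT mA (@subsetT _ A) iY.
have iAY' := integrableS measurableT mA (@subsetT _ A) iY'.
have e0 : (\int[P]_(w in A) ((EFin \o Y) \- (EFin \o Y')) w = 0)%E.
  rewrite integralB// /comp eY// eY'// subee// -eY'//.
  exact: integrable_fin_num iAY'.
have iD := integrableB mA iAY iAY'.
have mD := measurable_int _ iD.
have /(ae_eq_integral_abs P mA mD) : (\int[P]_(w in A) `|((EFin \o Y) \- (EFin \o Y')) w| = 0)%E.
  rewrite -[RHS]e0; apply: eq_integral => w; rewrite inE /A /= => Aw.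
  by rewrite -EFinD ger0_norm // subr_ge0 ltW.
move=> [N [mN N0 subN]].
apply/eqP; rewrite eq_le measure_ge0 andbT -N0.
apply: le_measure; rewrite ?inE//.
move=> w Aw; apply: subN => /= /(_ Aw)/eqP.
by rewrite -EFinB eqe subr_eq0 => /eqP h; move: Aw; rewrite /A /= h ltxx.
Qed.

Lemma condexp_ae_unique X Y Y' : is_condexp P F X Y -> is_condexp P F X Y' ->
  {ae P, forall w, Y w = Y' w}.
Proof.
move=> hY hY'.
have mY := is_condexp_measurable hY; have mY' := is_condexp_measurable hY'.
exists ([set w | Y' w < Y w] `|` [set w | Y w < Y' w]); split.
- apply: measurableU.
    by have := measurable_fun_ltr mY' mY measurableT (Y := [set true]) I; rewrite setTI.
  by have := measurable_fun_ltr mY mY' measurableT (Y := [set true]) I; rewrite setTI.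
- apply/eqP; rewrite eq_le measure_ge0 andbT.
  apply: le_trans (measureU2 _ _ _) _ => //.
  + by have := measurable_fun_ltr mY' mY measurableT (Y := [set true]) I; rewrite setTI.
  + by have := measurable_fun_ltr mY mY' measurableT (Y := [set true]) I; rewrite setTI.
  by rewrite [X in (X + _)%E](is_condexp_lt0 hY hY') [X in (_ + X)%E](is_condexp_lt0 hY' hY) adde0.
- move=> w /= /eqP; rewrite neq_lt => /orP[]; [by right|by left].
Qed.

Lemma condexpP X Y : is_condexp P F X Y -> is_condexp P F X (condexp P F X).
Proof. by move=> h; apply: (xgetPex (cst 0)); exists Y. Qed.

Lemma condexp_aeE X Y : is_condexp P F X Y ->
  {ae P, forall w, condexp P F X w = Y w}.
Proof. by move=> h; exact: (condexp_ae_unique (condexpP h) h). Qed.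

(** The defining property only involves integrals of [X], so the two
    functions have the same versions of the conditional expectation and the
    same version is chosen. *)
Lemma condexp_ae_eq X X' : measurable_fun setT X -> measurable_fun setT X' ->
  {ae P, forall w, X w = X' w} -> condexp P F X = condexp P F X'.
Proof.
move=> mX mX' XX'.
rewrite /condexp; congr (xget _ _); apply/seteqP; split => Y [h1 h2 h3];
  split => // A FA; rewrite h3//; apply: ae_eq_integral.
- exact: subF.
- by apply/measurable_EFinP; exact: measurable_funS mX.
- by apply/measurable_EFinP; exact: measurable_funS mX'.
- by apply: filterS XX' => w -> .
- exact: subF.
- by apply/measurable_EFinP; exact: measurable_funS mX'.
- by apply/measurable_EFinP; exact: measurable_funS mX.
- by apply: filterS XX' => w -> .
Qed.

End condexp_unique.

(** * Partial expectations as resampling averages *)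

Section matrix_of_configuration.
Context (R : realType) (N : nat).

Definition upper := {ij : 'I_N * 'I_N | (ij.1 <= ij.2)%N}.

Local Notation config := (config R upper).

Definition entry (x : config) (i j : 'I_N) : R[i] :=
  if @insub _ (fun ij : 'I_N * 'I_N => (ij.1 <= ij.2)%N) upper (i, j) is Some e
  then (x e).1 +i* (x e).2 else 0.

(** Every configuration gives a Hermitian matrix, so that the resolvent at a
    spectral parameter off the real axis is bounded on all configurations. *)
Definition mat (x : config) : 'M[R[i]]_N :=
  \matrix_(i, j) if (i < j)%N then entry x i j
    else if (j < i)%N then (entry x j i)^* else (complex.Re (entry x i i))%:C.

Definition config_of (A : 'M[R[i]]_N) : config :=
  fun e => plane (A (val e).1 (val e).2).

Definition star (k : 'I_N) : {set upper} :=
  [set e | ((val e).1 == k) || ((val e).2 == k)]%SET.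

Definition zero_config : config := fun=> (0, 0).

Lemma entry_le (x : config) (i j : 'I_N) (ij : (i <= j)%N) :
  entry x i j = (x (exist _ (i, j) ij)).1 +i* (x (exist _ (i, j) ij)).2.
Proof.
rewrite /entry; case: insubP => [e _ ve|]; last by rewrite /= ij.
suff -> : e = exist _ (i, j) ij by [].
exact: val_inj.
Qed.

Lemma hermitian_mat x : selfadjoint (mat x).
Proof.
move=> i j; rewrite !mxE; case: (ltngtP i j) => ij.
- by rewrite conjcK.
- by [].
- have -> : i = j by exact: val_inj.
  by rewrite conjc_real.
Qed.

Lemma mat_config_of A : selfadjoint A -> mat (config_of A) = A.
Proof.
move=> hA.
have e (i j : 'I_N) : (i <= j)%N -> entry (config_of A) i j = A i j.
  by move=> ij; rewrite entry_le /config_of /=; case: (A i j).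
apply/matrixP => i j; rewrite !mxE; case: (ltngtP i j) => ij.
- by rewrite e// ltnW.
- by rewrite e -?hA// ltnW.
- have <- : i = j by exact: val_inj.
  rewrite e//; have := hA i i; case: (A i i) => a b /= [] h.
  by congr (_ +i* _); lra.
Qed.

Lemma mat_freeze k x :
  mat (resample (star k) x zero_config) = minor [set k]%SET (mat x).
Proof.
have e (i j : 'I_N) : (i <= j)%N -> entry (resample (star k) x zero_config) i j =
    if (i == k) || (j == k) then 0 else entry x i j.
  move=> ij; rewrite !entry_le /resample inE /=.
  by case: ifP.
apply/matrixP => i j; rewrite !mxE !inE; case: (ltngtP i j) => ij.
- by rewrite e// ltnW.
- by rewrite e 1?ltnW// orbC; case: ifP => //; rewrite conjc0.
- have <- : i = j by exact: val_inj.
  by rewrite e//; case: ifP.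
Qed.

End matrix_of_configuration.

Section partial_expectation.
Local Open Scope classical_set_scope.
Context d (T : measurableType d) (R : realType) (P : probability T R) (N : nat).
Variable H : T -> 'M[R[i]]_N.
Hypotheses (mH : forall i j, measurable_fun setT (fun w => complex.Re (H w i j)) /\
                 measurable_fun setT (fun w => complex.Im (H w i j)))
  (hH : forall w, selfadjoint (H w))
  (indH : mutually_independent P (fun (ij : upper N) w =>
            H w (val ij).1 (val ij).2)).
Local Notation config := (config R (upper N)).

Definition sample (w : T) : config := config_of (H w).

Lemma measurable_sample : measurable_fun setT sample.
Proof.
apply: measurable_config => e; rewrite /sample /config_of /plane.
by apply: measurable_fun_pair; [exact: (mH _ _).1|exact: (mH _ _).2].
Qed.

Definition sampleRV : {mfun T >-> config} :=
  mfun_Sub (mem_set measurable_sample : sample \in mfun).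

Definition law : probability config R := distribution P sampleRV.

Lemma lawE A : law A = P (sample @^-1` A).
Proof. by []. Qed.

Lemma law_box (B : upper N -> set (R * R)) : (forall i, measurable (B i)) ->
  law (box B) = (\prod_i law (box (fun j => if j == i then B i else setT)))%E.
Proof.
move=> mB.
have := indH [set: upper N]%SET mB.
have -> : \bigcap_(k in [set` [set: upper N]%SET])
    (@plane R \o (fun w => H w (val k).1 (val k).2)) @^-1` B k =
    sample @^-1` box B.
  by apply/seteqP; split => w /= h k; [apply: h; rewrite /= inE|move=> _; apply: h].
rewrite lawE => ->; apply: eq_big => [k|k _]; first by rewrite inE.
rewrite lawE; congr (P _); apply/seteqP; split => w /=.
  by move=> h j /=; case: eqP => // ->.
by move=> /(_ k); rewrite eqxx.
Qed.

Lemma mean_law (f : config -> R) : bmeasurable f ->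
  mean law f = Rintegral P setT (f \o sample).
Proof.
move=> bf; rewrite /mean /Rintegral; congr fine.
rewrite integral_distribution//.
  by apply/measurable_EFinP; case: bf.
have := bmeasurable_integrable law measurableT bf => /integrableP[m1 i1].
apply/integrableP; split.
  by apply: measurableT_comp => //; exact: measurable_sample.
rewrite [in ltLHS]ge0_integral_distribution// in i1.
exact: measurableT_comp.
Qed.

Lemma bmeasurable_sample (f : config -> R) : bmeasurable f -> bmeasurable (f \o sample).
Proof.
move=> [mf [C fC]]; split; last by exists C => w; exact: fC.
exact: (measurableT_comp mf measurable_sample).
Qed.

Section one_index.
Variable k : 'I_N.
Local Notation Fk := (minor_sigma_algebra H k).

Let T' := g_sigma_algebraType [set A | exists i l (B : set (R * R)), measurable B /\
         A = (fun w => plane (minor_mx H k w i l)) @^-1` B].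

Lemma minor_sigma_algebraS : Fk `<=` measurable.
Proof.
apply: smallest_sub => [|_ [i [l [B [mB ->]]]]].
  exact: sigma_algebra_measurable.
rewrite -[X in measurable X]setTI.
have : measurable_fun setT (fun w => plane (minor_mx H k w i l)).
  rewrite /plane /minor_mx; under eq_fun do rewrite mxE.
  case: ((i == k) || (l == k)); first exact: measurable_cst.
  by apply: measurable_fun_pair; [exact: (mH _ _).1|exact: (mH _ _).2].
exact.
Qed.

Definition frozen_sample w := resample (star k) (sample w) (@zero_config R N).

Lemma measurable_frozen_sample : measurable_fun setT (frozen_sample : T' -> config).
Proof.
apply: measurable_config => e.
have -> : (fun w => frozen_sample w e) =
    (fun w => plane (minor_mx H k w (val e).1 (val e).2)).
  apply/funext => w; rewrite /frozen_sample /resample /minor_mx mxE inE.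
  by case: ifP.
move=> _ B mB; rewrite setTI; apply: sub_sigma_algebra.
by exists (val e).1, (val e).2, B.
Qed.

(** The sigma-algebra of the minor is generated by the
    configuration with the entries of row and column [k] set to zero. *)
Lemma minor_sigma_algebra_preimage A : Fk A ->
  exists2 A' : set config, measurable A' & A = frozen_sample @^-1` A'.
Proof.
suff : Fk `<=` preimage_set_system setT frozen_sample
    (measurable : set (set config)).
  by move=> h /h[A' mA' <-]; exists A' => //; rewrite setTI.
apply: smallest_sub => [|_ [i [l [B [mB ->]]]]].
  by apply: sigma_algebra_preimage; exact: sigma_algebra_measurable.
have [il|li] := leqP i l.
  exists [set x | B (x (exist _ (i, l) il))].
    rewrite -[X in measurable X]setTI.
    exact: (@measurable_coord R _ (exist _ (i, l) il)).
  rewrite setTI; apply/seteqP; split => w /=;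
    rewrite /frozen_sample /resample /minor_mx mxE inE /=; by case: ifP.
pose e : upper N := exist _ (l, i) (ltnW li).
exists [set x | B ((x e).1, - (x e).2)].
  rewrite -[X in measurable X]setTI.
  have : measurable_fun setT (fun x : config => ((x e).1, - (x e).2)).
    have mc := @measurable_coord R _ e.
    apply: measurable_fun_pair; first exact: (measurableT_comp measurable_fst mc).
    by apply: measurableT_comp => //; exact: (measurableT_comp measurable_snd mc).
  exact.
rewrite setTI; apply/seteqP; split => w /=;
  rewrite /frozen_sample /resample /minor_mx mxE inE /= orbC;
  (case: ifP => _; first by rewrite oppr0);
  by rewrite /sample /config_of /e /= [H w i l](hH w i l); case: (H w l i).
Qed.

(** The average is a function of the frozen sample.  An event of the
    sigma-algebra is one of the frozen sample too, so its indicator can be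
    moved inside the average. *)
Lemma is_condexp_avg (f : config -> R) : bmeasurable f ->
  is_condexp P Fk (f \o sample) (avg law (star k) f \o sample).
Proof.
move=> bf.
have ba : bmeasurable (avg law (star k) f) by exact: bmeasurable_avg.
have inv : resample_invariant (star k) (avg law (star k) f) by exact: invariant_avg.
split.
- move=> B mB.
  have -> : (avg law (star k) f \o sample) @^-1` B =
      setT `&` frozen_sample @^-1` (avg law (star k) f @^-1` B).
    by rewrite setTI; apply/seteqP; split => w /=; rewrite /frozen_sample inv.
  have mF := measurable_frozen_sample.
  apply: (mF measurableT).
  by rewrite -[X in measurable X]setTI; apply: ba.1.
- by apply: bmeasurable_integrable => //; exact: bmeasurable_sample.
move=> A FA; have mA := minor_sigma_algebraS FA.
have [A' mA' AE] := minor_sigma_algebra_preimage FA.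
pose g (x : config) : R := \1_A' (resample (star k) x (@zero_config R N)).
have bg : bmeasurable g.
  apply: (@bmeasurable_resample2 R _ (\1_A') (star k) (@zero_config R N)); split => //.
  by exists 1 => x; rewrite indicE; case: (_ \in _); rewrite ?normr1 ?normr0.
have gS : resample_invariant (star k) g.
  move=> x y; rewrite /g; congr (\1_A' _); apply/funext => e.
  by rewrite /resample; case: (e \in star k).
have key (h : config -> R) : bmeasurable h ->
    (\int[P]_(w in A) ((h \o sample) w)%:E)%E =
    (mean law (fun x => g x * h x))%:E.
  move=> bh.
  rewrite (mean_law (bmeasurableM bg bh)).
  have bgs := bmeasurable_sample (bmeasurableM bg bh).
  have -> := mean_EFin P bgs.
  rewrite [LHS]integral_mkcond; apply: eq_integral => w _.
  rewrite patchE /g /= indicE; have -> : (w \in A) =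
     (resample (star k) (sample w) (@zero_config R N) \in A').
    by rewrite AE; apply/idP/idP; rewrite !inE.
  by case: ifP => _; rewrite /= ?mul1r ?mul0r.
rewrite (key _ ba) (key _ bf); congr (_%:E).
by rewrite -(avgMl law bf gS) (mean_avg law_box)//; exact: bmeasurableM.
Qed.

End one_index.
End partial_expectation.

(** * Measurability of resolvents, and the fluctuation operators *)

Section complex_measurable.
Local Open Scope classical_set_scope.
Context d (T : measurableType d) (R : realType).
Implicit Types f g : T -> R[i].

Definition cmeasurable f := measurable_fun setT (fun x => complex.Re (f x)) /\
  measurable_fun setT (fun x => complex.Im (f x)).

Lemma cmeasurable_cst c : cmeasurable (fun=> c).
Proof. by split; exact: measurable_cst. Qed.

Lemma cmeasurable_ext f g : (forall x, f x = g x) -> cmeasurable f -> cmeasurable g.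
Proof. by move=> /funext ->. Qed.

Lemma cmeasurableD f g : cmeasurable f -> cmeasurable g -> cmeasurable (fun x => f x + g x).
Proof.
move=> [f1 f2] [g1 g2]; split.
  under eq_fun do rewrite raddfD; exact: measurable_funD.
under eq_fun do rewrite raddfD; exact: measurable_funD.
Qed.

Lemma cmeasurableN f : cmeasurable f -> cmeasurable (fun x => - f x).
Proof.
move=> [f1 f2]; split.
  by under eq_fun do rewrite raddfN; exact: measurableT_comp.
by under eq_fun do rewrite raddfN; exact: measurableT_comp.
Qed.

Lemma cmeasurableM f g : cmeasurable f -> cmeasurable g -> cmeasurable (fun x => f x * g x).
Proof.
move=> [f1 f2] [g1 g2].
have ReM (a b : R[i]) : complex.Re (a * b) =
    complex.Re a * complex.Re b - complex.Im a * complex.Im b.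
  by case: a => ? ?; case: b.
have ImM (a b : R[i]) : complex.Im (a * b) =
    complex.Re a * complex.Im b + complex.Im a * complex.Re b.
  by case: a => ? ?; case: b.
split.
  under eq_fun do rewrite ReM.
  by apply: measurable_funB; exact: measurable_funM.
under eq_fun do rewrite ImM.
by apply: measurable_funD; exact: measurable_funM.
Qed.

Lemma cmeasurable_conj f : cmeasurable f -> cmeasurable (fun x => (f x)^*).
Proof.
move=> [f1 f2]; split.
  by apply: (eq_measurable_fun _ _ f1) => x _; case: (f x).
have h : measurable_fun setT (fun x => - complex.Im (f x)).
  exact: measurableT_comp.
by apply: (eq_measurable_fun _ _ h) => x _; case: (f x).
Qed.

Lemma cmeasurableV f : (forall x, f x != 0) -> cmeasurable f -> cmeasurable (fun x => (f x)^-1).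
Proof.
move=> f0 cf; have [f1 f2] := cf.
pose q x := complex.Re (f x) ^+ 2 + complex.Im (f x) ^+ 2.
have q0 x : 0 < q x.
  have := f0 x; rewrite /q; case: (f x) => a b /=; rewrite eq_complex /= negb_and.
  case/orP => h; first by rewrite ltr_pwDl ?sqr_ge0// exprn_even_gt0.
  by rewrite ltr_wpDl ?sqr_ge0// exprn_even_gt0.
have mq : measurable_fun setT q.
  by apply: measurable_funD; exact: measurable_funX.
have mqV : measurable_fun setT (fun x => (q x)^-1).
  have h := measurableT_comp (measurable_powR (-1)) mq.
  by apply: (eq_measurable_fun _ _ h) => x _ /=; rewrite powR_inv1// ltW.
apply: cmeasurable_ext (cmeasurableM (cmeasurable_conj cf) (_ : cmeasurable (fun x => (q x)^-1%:C))).
  move=> x; rewrite /q; case: (f x) => a b /=; apply/eqP; rewrite eq_complex /=.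
  by rewrite !mulr0 subr0 add0r mulNr !eqxx.
by split; [exact: mqV|exact: measurable_cst].
Qed.

Lemma cmeasurable_sum (J : Type) (s : seq J) (p : pred J) (f : J -> T -> R[i]) :
  (forall i, cmeasurable (f i)) -> cmeasurable (fun x => \sum_(i <- s | p i) f i x).
Proof.
move=> cf; elim: s => [|i s IH].
  by apply: cmeasurable_ext (cmeasurable_cst 0) => x; rewrite big_nil.
case pi: (p i).
  by apply: cmeasurable_ext (cmeasurableD (cf i) IH) => x; rewrite big_cons pi.
by apply: cmeasurable_ext IH => x; rewrite big_cons pi.
Qed.

Lemma cmeasurable_prod (J : Type) (s : seq J) (p : pred J) (f : J -> T -> R[i]) :
  (forall i, cmeasurable (f i)) -> cmeasurable (fun x => \prod_(i <- s | p i) f i x).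
Proof.
move=> cf; elim: s => [|i s IH].
  by apply: cmeasurable_ext (cmeasurable_cst 1) => x; rewrite big_nil.
case pi: (p i).
  by apply: cmeasurable_ext (cmeasurableM (cf i) IH) => x; rewrite big_cons pi.
by apply: cmeasurable_ext IH => x; rewrite big_cons pi.
Qed.

Lemma cmeasurable_det n (A : T -> 'M[R[i]]_n) :
  (forall i j, cmeasurable (fun x => A x i j)) -> cmeasurable (fun x => \det (A x)).
Proof.
move=> cA; rewrite /determinant; apply: cmeasurable_sum => s.
by apply: cmeasurableM; [exact: cmeasurable_cst|apply: cmeasurable_prod => i; exact: cA].
Qed.

(** The determinant of [A - z] never vanishes, so the entries
    are quotients of polynomials in the entries of [A]. *)
Lemma cmeasurable_resolvent n (A : T -> 'M[R[i]]_n) z :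
  (forall x, selfadjoint (A x)) -> 0 < complex.Im z ->
  (forall i j, cmeasurable (fun x => A x i j)) ->
  forall i j, cmeasurable (fun x => resolvent (A x) z i j).
Proof.
move=> hA z0 cA i j.
have cB k l : cmeasurable (fun x => (A x - z%:M) k l).
  apply: cmeasurable_ext (cmeasurableD (cA k l) (cmeasurable_cst (- (z *+ (k == l))))) => x.
  by rewrite !mxE.
apply: cmeasurable_ext (cmeasurableM (cmeasurableV _ (cmeasurable_det cB))
  (_ : cmeasurable (fun x => \adj (A x - z%:M) i j))) => [x|x|].
- by rewrite /resolvent /invmx (hermitian_unitmx (hA x) z0) [RHS]mxE.
- by have := hermitian_unitmx (hA x) z0; rewrite unitmxE unitfE.
- have : cmeasurable (fun x => cofactor (A x - z%:M) j i).
    apply: cmeasurableM; first exact: cmeasurable_cst.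
    apply: cmeasurable_det => k l.
    by apply: cmeasurable_ext (cB (lift j k) (lift i l)) => x; rewrite !mxE.
  by apply: cmeasurable_ext => x; rewrite mxE.
Qed.

Lemma cmeasurable_centered_resolvent n (A : T -> 'M[R[i]]_n) z (b : bool) :
  (forall x, selfadjoint (A x)) -> 0 < complex.Im z ->
  (forall i j, cmeasurable (fun x => A x i j)) ->
  forall i j, cmeasurable (fun x => centered_resolvent (A x) z b i j).
Proof.
move=> hA z0 cA i j; rewrite /centered_resolvent; case: b.
  have h := cmeasurable_conj (cmeasurable_resolvent hA z0 cA j i).
  apply: cmeasurable_ext (cmeasurableD h (cmeasurable_cst (- ((stieltjes_semicircle z)^* *+ (i == j))))).
  by move=> x; rewrite !mxE.
have h := cmeasurable_resolvent hA z0 cA i j.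
apply: cmeasurable_ext (cmeasurableD h (cmeasurable_cst (- (stieltjes_semicircle z *+ (i == j))))).
by move=> x; rewrite !mxE.
Qed.

Lemma measurable_cabs f : cmeasurable f -> measurable_fun setT (fun x => cabs (f x)).
Proof.
move=> [f1 f2].
have h : measurable_fun setT
    (fun x => Num.sqrt (complex.Re (f x) ^+ 2 + complex.Im (f x) ^+ 2)).
  apply: (measurableT_comp (continuous_measurable_fun (@sqrt_continuous R))).
  by apply: measurable_funD; exact: measurable_funX.
by apply: (eq_measurable_fun _ _ h) => x _; rewrite /cabs normc_def.
Qed.

Lemma measurable_bigmax (J : Type) (s : seq J) (f : J -> T -> R) :
  (forall i, measurable_fun setT (f i)) ->
  measurable_fun setT (fun x => \big[Num.max/0]_(i <- s) f i x).
Proof.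
move=> mf; elim: s => [|i s IH].
  by under eq_fun do rewrite big_nil; exact: measurable_cst.
by under eq_fun do rewrite big_cons; exact: measurable_maxr.
Qed.

End complex_measurable.

Section configurations_matrix.
Local Open Scope classical_set_scope.
Context (R : realType) (N : nat).
Local Notation config := (config R (upper N)).

Lemma cmeasurable_mat (i j : 'I_N) : cmeasurable (fun x : config => mat x i j).
Proof.
have ce k l : cmeasurable (fun x : config => entry x k l).
  rewrite /entry; case: insub => [e|]; last exact: cmeasurable_cst.
  have m := @measurable_coord R _ e.
  by split; [exact: (measurableT_comp measurable_fst m)|
             exact: (measurableT_comp measurable_snd m)].
have h : cmeasurable (fun x : config => if (i < j)%N then entry x i j
    else if (j < i)%N then (entry x j i)^* else (complex.Re (entry x i i))%:C).
  case: (i < j)%N => //; case: (j < i)%N; first exact: cmeasurable_conj.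
  by split; [exact: (ce i i).1|exact: measurable_cst].
by apply: cmeasurable_ext h => x; rewrite mxE.
Qed.

Lemma cmeasurable_monomial (Delta : admissible_graph) z a mu : 0 < complex.Im z ->
  cmeasurable (fun x : config => monomial (Delta := Delta) (mat x) z a mu).
Proof.
move=> z0; rewrite /monomial; apply: cmeasurable_prod => e.
apply: cmeasurable_centered_resolvent => //; first exact: hermitian_mat.
exact: cmeasurable_mat.
Qed.

Lemma measurable_Lambda z : 0 < complex.Im z ->
  measurable_fun setT (fun x : config => Lambda (mat x) z).
Proof.
move=> z0; rewrite /Lambda.
apply: measurable_bigmax => x; apply: measurable_bigmax => y; apply: measurable_cabs.
apply: cmeasurable_centered_resolvent => //; first exact: hermitian_mat.
exact: cmeasurable_mat.
Qed.

End configurations_matrix.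

Section fluctuations.
Local Open Scope classical_set_scope.
Context d (T : measurableType d) (R : realType) (P : probability T R) (N : nat).
Variable H : T -> 'M[R[i]]_N.
Hypotheses (mH : forall i j, measurable_fun setT (fun w => complex.Re (H w i j)) /\
                 measurable_fun setT (fun w => complex.Im (H w i j)))
  (hH : forall w, selfadjoint (H w))
  (indH : mutually_independent P (fun (ij : upper N) w =>
            H w (val ij).1 (val ij).2)).
Local Notation config := (config R (upper N)).
Local Notation law := (law P mH).
Local Notation ops := (ops law (@star N)).

Let lbox := law_box mH indH.

Lemma cmeasurable_sample (u v : config -> R) : bmeasurable u -> bmeasurable v ->
  cmeasurable (fun w => u (sample H w) +i* v (sample H w)).
Proof.
by move=> bu bv; split; [exact: (bmeasurable_sample mH bu).1|exact: (bmeasurable_sample mH bv).1].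
Qed.

Lemma partial_fluctuation_ae (k : 'I_N) (X : T -> R[i]) (u v : config -> R) :
  bmeasurable u -> bmeasurable v -> cmeasurable X ->
  {ae P, forall w, X w = u (sample H w) +i* v (sample H w)} ->
  cmeasurable (partial_fluctuation P H k X) /\
  {ae P, forall w, partial_fluctuation P H k X w =
    flu law (star k) u (sample H w) +i* flu law (star k) v (sample H w)}.
Proof.
move=> bu bv [mX1 mX2] XE.
have sF : sigma_algebra setT (minor_sigma_algebra H k).
  exact: smallest_sigma_algebra.
have subF := @minor_sigma_algebraS _ _ _ _ _ mH k.
have hu := is_condexp_avg mH hH indH k bu.
have hv := is_condexp_avg mH hH indH k bv.
have [mu1 _] := bmeasurable_sample mH bu; have [mv1 _] := bmeasurable_sample mH bv.
have eu : condexp P (minor_sigma_algebra H k) (fun w => complex.Re (X w)) =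
    condexp P (minor_sigma_algebra H k) (u \o sample H).
  by apply: condexp_ae_eq => //; apply: filterS XE => w ->.
have ev : condexp P (minor_sigma_algebra H k) (fun w => complex.Im (X w)) =
    condexp P (minor_sigma_algebra H k) (v \o sample H).
  by apply: condexp_ae_eq => //; apply: filterS XE => w ->.
split.
  rewrite /partial_fluctuation /partial_expectation /ccondexp eu ev.
  apply: cmeasurableD => //; apply: cmeasurableN; split => /=.
    by apply: (is_condexp_measurable subF); exact: (condexpP hu).
  by apply: (is_condexp_measurable subF); exact: (condexpP hv).
have au := condexp_aeE sF subF hu; have av := condexp_aeE sF subF hv.
apply: filterS3 XE au av => w Xw uw vw.
by rewrite /partial_fluctuation /partial_expectation /ccondexp eu ev Xw uw vw.
Qed.

(** Each conditional expectation is replaced by the corresponding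
    average outside a null set; the chosen version for the next operator does
    not see this change, by [condexp_ae_eq]. *)
Lemma fluctuations_ae (Delta : admissible_graph)
    (F : {set summation_vertex Delta}) a (u v : config -> R) :
  bmeasurable u -> bmeasurable v ->
  let X w := u (sample H w) +i* v (sample H w) in
  cmeasurable (fluctuations P H F a X) /\
  {ae P, forall w, fluctuations P H F a X w =
    ops (flu_word F a) u (sample H w) +i* ops (flu_word F a) v (sample H w)}.
Proof.
move=> bu bv X; rewrite /fluctuations /flu_word; elim: (enum F) => [|i s IH] /=.
  by split; [exact: cmeasurable_sample|exact: aeW].
have [IH1 IH2] := IH.
by apply: partial_fluctuation_ae => //; exact: bmeasurable_ops.
Qed.

End fluctuations.

(** * Deterministic bounds on monomials and their differences *)

(** Freezing a coordinate of the configuration at zero is taking a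
    minor of the matrix. *)
Lemma freeze_diffs_mat (R : realType) (N : nat) (pr : R[i] -> R)
    (phi : 'M[R[i]]_N -> R[i]) (B : seq 'I_N) (x : config R (upper N)) :
  {morph pr : u v / u - v} ->
  freeze_diffs (@star N) (@zero_config R N) B (fun y => pr (phi (mat y))) x =
  pr (differences B (fun T => phi (minor T (mat x))) finset.set0).
Proof.
move=> prB; elim: B phi => [|k B IH] phi /=; first by rewrite minor0.
pose phi' A := phi A - phi (minor [set k]%SET A).
have -> : freeze_diff (@star N) (@zero_config R N) (fun y => pr (phi (mat y))) k =
    (fun y => pr (phi' (mat y))).
  by apply/funext => y; rewrite /freeze_diff /freeze /phi' prB mat_freeze.
rewrite IH; congr (pr (differences _ _ _)); apply/funext => T.
by rewrite /phi' /difference minorU.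
Qed.

Section deterministic_bounds.
Context (R : realType).

Lemma centered_resolvent_le N (A : 'M[R[i]]_N) z b i j :
  selfadjoint A -> 0 < complex.Im z ->
  cabs (centered_resolvent A z b i j) <= 17 * (complex.Im z)^-1.
Proof.
move=> hA z0; set e := (complex.Im z)^-1.
have e0 : 0 <= e by rewrite invr_ge0 ltW.
have hG k l : `|resolvent A z k l| <= e%:C.
  by rewrite -cabs_le; exact: resolvent_le.
have hm (c : bool) : `|stieltjes_semicircle z *+ c| <= (16 * e)%:C.
  rewrite -cabs_le; case: c; first exact: stieltjes_semicircle_upper.
  by rewrite mulr0n -[0]/((0 : R)%:C) cabs_real normr0 mulr_ge0.
have E : (17 * e)%:C = e%:C + (16 * e)%:C by rewrite -rmorphD /=; congr (_%:C); ring.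
rewrite cabs_le E /centered_resolvent; case: b; rewrite !mxE.
  apply: le_trans (ler_normB _ _) _; rewrite lerD ?normcJ//.
  by have := hm (i == j); rewrite -(normcJ (_ *+ _)) rmorphMn.
by apply: le_trans (ler_normB _ _) _; rewrite lerD.
Qed.

Lemma monomial_le (Delta : admissible_graph) N (A : 'M[R[i]]_N) z a mu :
  selfadjoint A -> 0 < complex.Im z ->
  `|monomial (Delta := Delta) A z a mu| <=
    ((17 * (complex.Im z)^-1) ^+ degree Delta)%:C.
Proof.
move=> hA z0; rewrite /monomial normr_prod rmorphXn /= /degree.
rewrite -prodr_const; apply: ler_prod => e _; rewrite normr_ge0 /=.
by rewrite -cabs_le; exact: centered_resolvent_le.
Qed.

Lemma centered_resolvent_le_Lambda N (A : 'M[R[i]]_N) z x y :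
  cabs (centered_resolvent A z false x y) <= Lambda A z.
Proof.
apply: le_trans (le_bigmax _ _ x).
exact: (le_bigmax _ (fun y => cabs (centered_resolvent A z false x y)) y).
Qed.

(** Each removal at most doubles the error: the correction
    [G_xk G_ky / G_kk] has two small factors, and [|G_kk|] dominates one of
    them. *)
Lemma resolvent_minor_le N (A : 'M[R[i]]_N) z (b : nat) (lam c : R) :
  selfadjoint A -> 0 < complex.Im z -> c <= cabs (stieltjes_semicircle z) ->
  2 ^+ b * lam <= c / 2 -> 0 <= lam -> Lambda A z <= lam ->
  forall T : {set 'I_N}, (#|T| <= b)%N -> forall x y, x \notin T -> y \notin T ->
  `|resolvent (minor T A) z x y - stieltjes_semicircle z *+ (x == y)| <=
    (2 ^+ #|T| * lam)%:C.
Proof.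
move=> hA z0 cm bl lam0 hL T.
move tE : #|T| => t; elim: t T tE => [|t IH] T tE tb x y xT yT.
  move/eqP : tE; rewrite cards_eq0 => /eqP ->; rewrite minor0 expr0 mul1r.
  rewrite -cabs_le; apply: le_trans hL.
  by have := centered_resolvent_le_Lambda A z x y; rewrite !mxE.
have [k kT] : exists k, k \in T by apply/card_gt0P; rewrite tE.
pose T1 := (T :\ k)%SET.
have kT1 : k \notin T1 by rewrite !inE eqxx.
have TE : T = (k |: T1)%SET by rewrite finset.setD1K.
have T1t : #|T1| = t by have := cardsD1 k T; rewrite kT tE => -[].
have tb' : (t <= b)%N by exact: ltnW.
have nT1 u : u \notin T -> u \notin T1.
  by apply: contra; rewrite inE => /andP[].
have nk u : u \notin T -> u == k = false.
  by move=> uT; apply/negbTE; apply: contra uT => /eqP ->.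
have hA1 : selfadjoint (minor T1 A) by exact: hermitian_minor.
have := resolvent_minorB y hA1 z0 (negbT (nk x xT)).
rewrite minorU -TE => hB.
set l := (2 ^+ t * lam) in IH.
have l0 : 0 <= l by rewrite mulr_ge0// exprn_ge0.
have lc : l <= c / 2.
  by apply: le_trans bl; rewrite ler_wpM2r// ler_weXn2l// ler1n.
set g := resolvent (minor T1 A) z in hB *; set m := stieltjes_semicircle z in cm IH *.
have h1 : `|g x k| <= l%:C.
  by have := IH T1 T1t tb' x k (nT1 _ xT) kT1; rewrite nk// subr0.
have h2 : `|g k y| <= l%:C.
  have := IH T1 T1t tb' k y kT1 (nT1 _ yT); rewrite eq_sym nk//.
  by rewrite subr0.
have h3 := IH T1 T1t tb' k k kT1 kT1; rewrite eqxx mulr1n -/g in h3.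
have h4 : l%:C <= `|g k k|.
  have h5 : c%:C <= `|m| by rewrite -cabsE lecR.
  have h6 : `|m| <= `|g k k| + `|g k k - m|.
    by have := ler_normB (g k k) (g k k - m); rewrite opprB addrC subrK.
  have h7 : c%:C <= `|g k k| + l%:C.
    by apply: le_trans h5 (le_trans h6 _); rewrite lerD2l.
  rewrite -lerBlDr -rmorphB /= in h7; apply: le_trans h7; rewrite lecR.
  by move: lc; lra.
have -> : resolvent (minor T A) z x y - m *+ (x == y) =
    (g x y - m *+ (x == y)) - g x k * g k y / g k k.
  by rewrite -hB; ring.
have -> : (2 ^+ t.+1 * lam)%:C = l%:C + l%:C.
  by rewrite -rmorphD /= exprS /l; congr (_%:C); ring.
apply: le_trans (ler_normB _ _) _; apply: lerD.
  exact: IH T1 T1t tb' x y (nT1 _ xT) (nT1 _ yT).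
have [gkk|gkk] := eqVneq (g k k) 0.
  by rewrite gkk invr0 mulr0 normr0 ler0c.
rewrite !normrM normfV ler_pdivrMr ?normr_gt0//.
by apply: ler_pM => //; apply: le_trans h2 h4.
Qed.

(** All the edges of the monomial use only indices in
    [codom a] and [codom mu], which the removed indices avoid, so
    [small_resolvent] applies to each of them and [small_prod] to the
    product. *)
Lemma monomial_differences_le (Delta : admissible_graph) (b : nat) (c : R) : 0 < c ->
  exists2 C : R, 0 <= C & forall N (A : 'M[R[i]]_N) (z : R[i]) (lam : R),
  selfadjoint A -> 0 < complex.Im z -> c <= cabs (stieltjes_semicircle z) ->
  2 ^+ b * lam <= c / 2 -> 2 ^+ b * lam <= 1 -> 0 <= lam -> Lambda A z <= lam ->
  forall (a : {ffun summation_vertex Delta -> 'I_N})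
    (mu : {ffun external_vertex Delta -> 'I_N}) (B : seq 'I_N),
  uniq B -> (size B <= b)%N ->
  (forall k, k \in B -> k \notin codom a /\ k \notin codom mu) ->
  `|differences B (fun T => monomial (minor T A) z a mu) finset.set0| <=
    (C * lam ^+ (degree Delta + size B))%:C.
Proof.
move=> c0.
have b1 : (1 : R[i]) <= (1 + 2 / c)%:C.
  by rewrite -[leLHS]/((1 : R)%:C) lecR lerDl divr_ge0// ltW.
have [K K1 small_res] := small_resolvent b b1.
have K0 : 0 <= K by apply: le_trans K1.
have KR : K = (complex.Re K)%:C by rewrite RRe_real// ger0_real.
have C0E : (K * 2 ^+ b) ^+ degree Delta =
    ((complex.Re K * 2 ^+ b) ^+ degree Delta)%:C.
  by rewrite {1}KR rmorphXn rmorphM rmorphXn /= [in RHS]rmorph_nat.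
set C0 := (complex.Re K * 2 ^+ b) ^+ degree Delta in C0E.
have C00 : 0 <= C0.
  by rewrite exprn_ge0// mulr_ge0 ?exprn_ge0// -ler0c -KR.
exists (C0 * (2 ^+ b) ^+ (degree Delta + b)).
  by rewrite mulr_ge0// exprn_ge0// exprn_ge0.
move=> N A z lam hA z0 cm lc l1 lam0 hL a mu B uB sB hB.
pose lam' := 2 ^+ b * lam.
have lam'0 : 0 <= lam' by rewrite mulr_ge0// exprn_ge0.
have lam01 : (0 : R[i]) <= lam'%:C <= 1.
  by rewrite ler0c lam'0 -[leRHS]/((1 : R)%:C) lecR.
pose B' := [set k in B]%SET.
have B'b : (#|B'| <= b)%N by rewrite cardsE; apply: leq_trans (card_size B) sB.
pose m := stieltjes_semicircle z.
pose g x y T := resolvent (minor T A) z x y.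
have g1 (T : {set 'I_N}) x y : T \subset B' -> x \notin T -> y \notin T ->
    `|g x y T - m *+ (x == y)| <= lam'%:C.
  move=> TB xT yT; have Tb : (#|T| <= b)%N by apply: leq_trans (subset_leq_card TB) B'b.
  apply: le_trans (resolvent_minor_le hA z0 cm lc lam0 hL Tb xT yT) _.
  by rewrite lecR ler_wpM2r// ler_weXn2l// ler1n.
have g2 (T : {set 'I_N}) x : T \subset B' -> x \notin T ->
    g x x T != 0 /\ `|(g x x T)^-1| <= (1 + 2 / c)%:C.
  move=> TB xT; have := g1 T x x TB xT xT; rewrite eqxx mulr1n => h3.
  have h4 : (c / 2)%:C <= `|g x x T|.
    have h5 : c%:C <= `|m| by rewrite -cabsE lecR.
    have h6 : `|m| <= `|g x x T| + `|g x x T - m|.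
      by have := ler_normB (g x x T) (g x x T - m); rewrite opprB addrC subrK.
    have h7 : c%:C <= `|g x x T| + lam'%:C.
      by apply: le_trans h5 (le_trans h6 _); rewrite lerD2l.
    rewrite -lerBlDr -rmorphB /= in h7; apply: le_trans h7; rewrite lecR.
    by move: lc; rewrite -/lam'; lra.
  have g0 : 0 < `|g x x T| by apply: lt_le_trans h4; rewrite ltcR divr_gt0.
  split; first by rewrite -normr_gt0.
  rewrite normfV; apply: le_trans (_ : (2 / c)%:C <= _); last by rewrite lecR lerDr.
  rewrite -[2 / c]invrK invf_div fmorphV /= lef_pV2 ?posrE//.
  by rewrite ltcR divr_gt0.
have g3 (T : {set 'I_N}) x y k : x \notin (k |: T)%SET -> y \notin (k |: T)%SET ->
    k \notin T ->
    g x y T - g x y (k |: T)%SET = g x k T * g k y T / g k k T.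
  move=> xkT _ _; have xk : x != k by move: xkT; rewrite !inE negb_or => /andP[].
  by rewrite /g -minorU; apply: resolvent_minorB => //; exact: hermitian_minor.
pose X := [set i | (i \in codom a) || (i \in codom mu)]%SET.
have vX (v : summation_vertex Delta + external_vertex Delta) :
    vertex_index a mu v \in X.
  by rewrite inE; case: v => i /=; rewrite codom_f ?orbT.
have sm (e : edge Delta) : small B' lam'%:C b X 1 K (fun T =>
    centered_resolvent (minor T A) z (starred e)
      (vertex_index a mu (source e)) (vertex_index a mu (target e))).
  rewrite /centered_resolvent; case: (starred e).
    have [h _] := small_res _ B' _ m g lam01 g1 g2 g3 X _ _
      (vX (target e)) (vX (source e)).
    have := small_isometry (h := @conjc R) (fun u v => rmorphB (@conjc R) u v) (@normcJ R) h.
    by apply: small_ext => T _; rewrite !mxE rmorphB rmorphMn eq_sym.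
  have [h _] := small_res _ B' _ m g lam01 g1 g2 g3 X _ _
    (vX (source e)) (vX (target e)).
  by apply: small_ext h => T _; rewrite !mxE.
have := small_prod lam01 K1 sm.
move=> /(differences_bound (s := B)) => /(_ uB) h.
have BX : {subset B <= B' :\: X}.
  by move=> k kB; rewrite !inE kB; have [/negPf -> /negPf ->] := hB k kB.
apply: le_trans (h BX sB) _; rewrite -/(degree Delta) C0E.
rewrite -rmorphXn -rmorphM lecR -mulrA ler_wpM2l// /lam' exprMn.
rewrite ler_wpM2r ?exprn_ge0// ler_weXn2l ?exprn_ege1 ?ler1n//.
by rewrite leq_add2l.
Qed.

End deterministic_bounds.

(** * The tail bound at fixed size *)

Section tails.
Local Open Scope classical_set_scope.
Context d (T : measurableType d) (R : realType) (mu : probability T R).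

Lemma bmeasurable_indic (A : set T) : measurable A -> bmeasurable (\1_A : T -> R).
Proof.
move=> mA; split=> //.
by exists 1 => x; rewrite indicE; case: (x \in A); rewrite ?normr1 ?normr0.
Qed.

Lemma mean_indic (A : set T) : measurable A -> mean mu \1_A = fine (mu A).
Proof. by move=> mA; rewrite /mean /Rintegral integral_indic// setIT. Qed.

(** [A] is the exceptional event. *)
Lemma mean_le_split (f : T -> R) (A : set T) (X Y q : R) : bmeasurable f ->
  measurable A -> (forall x, ~ A x -> f x <= X) -> (forall x, f x <= Y) ->
  0 <= X -> 0 <= Y -> (mu A <= q%:E)%E -> mean mu f <= X + q * Y.
Proof.
move=> bf mA fX fY X0 Y0 hq.
have b1 := bmeasurable_indic mA.
have b2 : bmeasurable (fun x => Y * \1_A x) by apply: bmeasurableM => //; exact: bmeasurable_cst.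
apply: le_trans (_ : mean mu (fun x => X + Y * \1_A x) <= _).
  apply: le_mean => // [|x]; first by apply: bmeasurableD => //; exact: bmeasurable_cst.
  rewrite indicE; case: (boolP (x \in A)) => xA.
    by rewrite mulr1; apply: le_trans (fY x) _; rewrite lerDr.
  by rewrite mulr0 addr0; apply: fX => Ax; move: xA; rewrite mem_set.
rewrite meanD//; last exact: bmeasurable_cst.
rewrite mean_cst (meanZ mu Y b1) mean_indic// lerD2l mulrC ler_wpM2r//.
by rewrite -lee_fin fineK//; exact: fin_num_measure.
Qed.

Lemma markov_even (S : T -> R) n (t : R) : bmeasurable S -> 0 < t -> ~~ odd n ->
  (mu [set x | (t < `|S x|)%R] <= (mean mu (fun x => S x ^+ n) / t ^+ n)%:E)%E.
Proof.
move=> bS t0 n2; set A := [set x | _].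
have mA : measurable A.
  have := measurable_fun_ltr (measurable_cst (t : R))
    (bmeasurable_norm bS).1 measurableT (Y := [set true]) Logic.I.
  by rewrite setTI.
have b1 := bmeasurable_indic mA; have bn := bmeasurableX n bS.
have h : t ^+ n * fine (mu A) <= mean mu (fun x => S x ^+ n).
  rewrite -mean_indic// -meanZ//; apply: le_mean => // [|x].
    by apply: bmeasurableM => //; exact: bmeasurable_cst.
  rewrite indicE; case: (boolP (x \in A)) => xA; last first.
    by rewrite mulr0 exprn_even_ge0.
  rewrite mulr1 -[leRHS]ger0_norm ?exprn_even_ge0// normrX.
  by apply: lerXn2r; rewrite ?nnegrE// ltW//; move: xA; rewrite inE.
have fA : mu A \is a fin_num by exact: fin_num_measure.
by rewrite -(fineK fA) lee_fin ler_pdivlMr ?exprn_gt0// mulrC.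
Qed.

Lemma ae_sum (V : nmodType) (J : Type) (s : seq J) (p : pred J) (X Y : J -> T -> V) :
  (forall j, {ae mu, forall w, X j w = Y j w}) ->
  {ae mu, forall w, \sum_(j <- s | p j) X j w = \sum_(j <- s | p j) Y j w}.
Proof.
move=> XY; elim: s => [|j s IH].
  by apply: aeW => w; rewrite !big_nil.
apply: filterS2 (XY j) IH => w XYj IHw.
by rewrite !big_cons XYj IHw.
Qed.

Lemma le_measure_ae (A B : set T) : measurable A -> measurable B ->
  {ae mu, forall w, A w -> B w} -> (mu A <= mu B)%E.
Proof.
move=> mA mB [N [mN N0 AB]].
apply: (@le_trans _ _ (mu (B `|` N))).
  apply: le_measure; rewrite ?inE//; first exact: measurableU.
  move=> w Aw; have [Bw|Bw] := pselect (B w); [by left|right].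
  by apply: AB => /= h; apply: Bw; exact: h.
apply: le_trans (measureU2 _ _ _) _ => //.
by rewrite [X in (_ + X)%E]N0 adde0.
Qed.

End tails.

(** For injective tuples the partition of the free vertices is
    the one into singletons. *)
Lemma adapted_weight_collision (R : realType) (Delta : admissible_graph) N (M : R)
    (w : {ffun summation_vertex Delta -> 'I_N} -> R)
    (p : pred {ffun summation_vertex Delta -> 'I_N}) :
  adapted_weight M w -> 1 <= M -> (forall a, p a -> injective a) ->
  forall (S : {set summation_vertex Delta})
    (a0 : {ffun summation_vertex Delta -> 'I_N}),
  \sum_(a | p a && [forall i in S, a i == a0 i]) w a <= M ^- #|S|.
Proof.
move=> [w01 hw] M1 pi S a0.
have M0 : M != 0 by rewrite gt_eqF// (lt_le_trans _ M1).
pose V := summation_vertex Delta.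
pose Q := [set [set i] | i in ~: S]%SET.
have cQ : #|Q| = #|~: S| by rewrite card_imset//; exact: set1_inj.
have pQ : finset.partition Q (~: S).
  apply/and3P; split.
  - apply/eqP/setP => i; apply/bigcupP/idP => [[_ /imsetP[j jS ->]]|iS].
      by rewrite inE => /eqP ->.
    by exists [set i]%SET; rewrite ?inE//; apply/imsetP; exists i.
  - apply/finset.trivIsetP => _ _ /imsetP[i _ ->] /imsetP[j _ ->] ij.
    rewrite finset.disjoints_subset; apply/fintype.subsetP => u; rewrite !inE => /eqP ->.
    by apply: contra ij => /eqP ->.
  - by apply/imsetP => -[i _ /setP /(_ i)]; rewrite !inE eqxx.
have := hw (~: S)%SET Q pQ a0; rewrite finset.setCK cQ => h.
apply: le_trans (le_trans _ h) _; last first.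
  rewrite -(cardsC S) addnC PoszD opprD addrA subrr sub0r.
  by rewrite -exprnN.
rewrite big_mkcond [leRHS]big_mkcond /=; apply: ler_sum => a _.
have wa : 0 <= w a by case/andP: (w01 a).
case: ifP => [/andP[pa ->]|_] /=; last by case: ifP.
suff -> : preim_partition a (~: S)%SET == Q by [].
apply/eqP/setP => X; apply/imsetP/imsetP => -[i iS ->]; exists i => //.
  apply/setP => j; rewrite !inE; apply/andP/eqP => [[_ /eqP aij]|->].
    by apply: (pi a pa); rewrite aij.
  by move: iS; rewrite inE.
apply/setP => j; rewrite !inE; apply/eqP/andP => [->|[_ /eqP aij]].
  by move: iS; rewrite inE.
by apply: (pi a pa); rewrite aij.
Qed.

Section fixed_size.
Local Open Scope classical_set_scope.
Context d (T : measurableType d) (R : realType) (P : probability T R) (N : nat).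
Variable H : T -> 'M[R[i]]_N.
Hypotheses (mH : forall i j, measurable_fun setT (fun w => complex.Re (H w i j)) /\
                 measurable_fun setT (fun w => complex.Im (H w i j)))
  (hH : forall w, selfadjoint (H w))
  (indH : mutually_independent P (fun (ij : upper N) w =>
            H w (val ij).1 (val ij).2)).
Local Notation config := (config R (upper N)).
Local Notation law := (law P mH).
Local Notation ops := (ops law (@star N)).
Let lbox := law_box mH indH.
Variables (Delta : admissible_graph) (F : {set summation_vertex Delta}) (n : nat).
Variables (M lam c q C K : R) (z : R[i]).
Hypotheses (n0 : (0 < n)%N) (n2 : ~~ odd n).
Local Notation b := (n * #|F|)%N.
Local Notation D := (degree Delta).
Hypothesis monomial_differences : forall (N : nat) (A : 'M[R[i]]_N) (z : R[i]) (lam : R),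
  selfadjoint A -> 0 < complex.Im z -> c <= cabs (stieltjes_semicircle z) ->
  2 ^+ b * lam <= c / 2 -> 2 ^+ b * lam <= 1 -> 0 <= lam -> Lambda A z <= lam ->
  forall (a : {ffun summation_vertex Delta -> 'I_N})
    (mu : {ffun external_vertex Delta -> 'I_N}) (B : seq 'I_N),
  uniq B -> (size B <= b)%N ->
  (forall k, k \in B -> k \notin codom a /\ k \notin codom mu) ->
  `|differences B (fun T => monomial (minor T A) z a mu) finset.set0| <=
    (C * lam ^+ (degree Delta + size B))%:C.
Hypotheses (C0 : 0 <= C) (M1 : 1 <= M) (lam0 : 0 < lam) (lam1 : lam <= 1)
  (lamM : 1 <= lam ^+ 2 * M) (z0 : 0 < complex.Im z)
  (cm : c <= cabs (stieltjes_semicircle z))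
  (lc : 2 ^+ b * lam <= c / 2) (l1 : 2 ^+ b * lam <= 1)
  (hq : (P [set w | (lam < Lambda (H w) z)%R] <= q%:E)%E) (K0 : 0 <= K)
  (hK : forall j, (j <= b)%N ->
    (C * lam ^+ (D + j)) ^+ n +
      q * (2 ^+ j * (17 * (complex.Im z)^-1) ^+ D) ^+ n <=
    K * (lam ^+ (D + j)) ^+ n).
Variables (w : {ffun summation_vertex Delta -> 'I_N} -> R)
  (mu : {ffun external_vertex Delta -> 'I_N}).
Hypothesis hw : adapted_weight M w.

Let p (a : {ffun summation_vertex Delta -> 'I_N}) :=
  injectiveb a && [forall i, forall j, a i != mu j].

Let part (pr : R[i] -> R) (a : {ffun summation_vertex Delta -> 'I_N}) :
  config -> R := fun x => pr (monomial (mat x) z a mu).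

Section projection.
Variable pr : R[i] -> R.
Hypotheses (prB : {morph pr : u v / u - v}) (prN : forall u, `|pr u| <= cabs u)
  (prm : forall a, measurable_fun setT (part pr a)).

Let Y0 : 0 <= (17 * (complex.Im z)^-1) ^+ D.
Proof. by rewrite exprn_ge0// mulr_ge0// invr_ge0 ltW. Qed.

Let bmeasurable_part a : bmeasurable (part pr a).
Proof.
split; first exact: prm.
exists ((17 * (complex.Im z)^-1) ^+ D) => x; apply: le_trans (prN _) _.
by rewrite cabs_le; apply: monomial_le => //; exact: hermitian_mat.
Qed.

(** On the event where Lambda is at most [lam] the differences
    are small; elsewhere the resolvent is at most [1 / eta], and [hK] says that
    the probability [q] compensates this. *)
Lemma mean_freeze_diffs_part a (B : seq 'I_N) : p a -> uniq B -> (size B <= b)%N ->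
  (forall k, k \in B -> k \notin codom a /\ exists2 a', p a' & k \in codom a') ->
  mean law (fun x => `|freeze_diffs (@star N) (@zero_config R N) B (part pr a) x| ^+ n)
    <= K * (lam ^+ (D + size B)) ^+ n.
Proof.
move=> pa uB sB hB; apply: le_trans (hK sB).
have lam0' := ltW lam0.
have E x : freeze_diffs (@star N) (@zero_config R N) B (part pr a) x =
    pr (differences B (fun T => monomial (minor T (mat x)) z a mu) finset.set0).
  exact: (freeze_diffs_mat (fun A => monomial A z a mu) B x prB).
pose A : set config := [set x | lam < Lambda (mat x) z].
have mA : measurable A.
  have := measurable_fun_ltr (measurable_cst lam) (@measurable_Lambda R N z z0)
    measurableT (Y := [set true]) Logic.I.
  by rewrite setTI.
apply: (@mean_le_split _ _ _ law _ A).
- by apply: bmeasurableX; apply: bmeasurable_norm; apply: bmeasurable_freeze_diffs; exact: bmeasurable_part.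
- exact: mA.
- move=> x /negP; rewrite -leNgt => hL.
  apply: lerXn2r; rewrite ?nnegrE//; first by rewrite mulr_ge0// exprn_ge0.
  rewrite E; apply: le_trans (prN _) _; rewrite cabs_le.
  apply: monomial_differences => // [|k kB]; first exact: hermitian_mat.
  have [ka [a' pa' ka']] := hB k kB; split => //.
  apply/negP => /codomP[j kj]; move: ka' => /codomP[i ki].
  by move: pa' => /andP[_ /forallP/(_ i)/forallP/(_ j)]; rewrite -ki -kj eqxx.
- move=> x; apply: lerXn2r; rewrite ?nnegrE//.
    by rewrite mulr_ge0// exprn_ge0.
  rewrite E; apply: le_trans (prN _) _; rewrite cabs_le.
  rewrite rmorphM /= rmorphXn rmorph_nat.
  apply: (@differences_le R[i] 'I_N B (fun T => monomial (minor T (mat x)) z a mu)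
    ((17 * (complex.Im z)^-1) ^+ D)%:C) => T'.
  by apply: monomial_le => //; apply: hermitian_minor; exact: hermitian_mat.
- by rewrite exprn_ge0// mulr_ge0// exprn_ge0.
- by rewrite exprn_ge0// mulr_ge0// exprn_ge0.
- rewrite lawE; apply: le_trans hq.
  have -> : sample H @^-1` A = [set w | lam < Lambda (H w) z].
    by apply/seteqP; split => v /=; rewrite /A /preimage /= /sample mat_config_of.
  by [].
Qed.

Definition weighted_part x :=
  \sum_(a | p a) w a * ops (flu_word F a) (part pr a) x.

Lemma bmeasurable_weighted_part : bmeasurable weighted_part.
Proof.
apply: bmeasurable_sum => a; apply: bmeasurableM; first exact: bmeasurable_cst.
by apply: bmeasurable_ops; exact: bmeasurable_part.
Qed.

Lemma weighted_part_tail (t : R) : 0 < t ->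
  (P [set v | (t < `|weighted_part (sample H v)|)%R] <=
   (moment_const F n K * lam ^+ (n * (D + #|F|)) / t ^+ n)%:E)%E.
Proof.
move=> t0.
have := markov_even law bmeasurable_weighted_part t0 n2; rewrite lawE => h.
apply: le_trans h _; rewrite lee_fin ler_wpM2r ?invr_ge0 ?exprn_ge0 ?(ltW t0)//.
have p_inj a : p a -> injective a by move=> /andP[/injectiveP].
apply: (mean_weighted_sum_le lbox (M := M) (x0 := @zero_config R N)) => //.
- by move=> a; case/andP: (hw.1 a).
- exact: adapted_weight_collision.
- exact: mean_freeze_diffs_part.
Qed.

End projection.

Let cmono a := cmeasurable_monomial (N := N) (Delta := Delta) a mu z0.

Let ReB : {morph (@complex.Re R) : u v / u - v}. Proof. exact: raddfB. Qed.
Let ImB : {morph (@complex.Im R) : u v / u - v}. Proof. exact: raddfB. Qed.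

Lemma average_ae :
  cmeasurable (average P H F w mu z) /\
  {ae P, forall v, average P H F w mu z v =
    weighted_part (@complex.Re R) (sample H v) +i*
    weighted_part (@complex.Im R) (sample H v)}.
Proof.
have bR a : bmeasurable (part (@complex.Re R) a).
  split; first exact: (cmono a).1.
  exists ((17 * (complex.Im z)^-1) ^+ D) => x; apply: le_trans (Re_le_cabs _) _.
  by rewrite cabs_le; apply: monomial_le => //; exact: hermitian_mat.
have bI a : bmeasurable (part (@complex.Im R) a).
  split; first exact: (cmono a).2.
  exists ((17 * (complex.Im z)^-1) ^+ D) => x; apply: le_trans (Im_le_cabs _) _.
  by rewrite cabs_le; apply: monomial_le => //; exact: hermitian_mat.
have fa a := @fluctuations_ae _ _ _ P _ _ mH hH indH Delta F a _ _ (bR a) (bI a).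
have E a : (fun v => monomial (H v) z a mu) = (fun v =>
    part (@complex.Re R) a (sample H v) +i* part (@complex.Im R) a (sample H v)).
  apply/funext => v; rewrite /part /sample mat_config_of//.
  by case: (monomial _ _ _ _).
split.
  rewrite /average; apply: cmeasurable_sum => a; apply: cmeasurableM; first exact: cmeasurable_cst.
  by rewrite E; exact: (fa a).1.
have h a : {ae P, forall v, (w a)%:C *
      fluctuations P H F a (fun v => monomial (H v) z a mu) v =
    (w a * ops (flu_word F a) (part (@complex.Re R) a) (sample H v)) +i*
    (w a * ops (flu_word F a) (part (@complex.Im R) a) (sample H v))}.
  rewrite E; apply: filterS (fa a).2 => v ->.
  by apply/eqP; rewrite eq_complex /= !mul0r subr0 addr0 !eqxx.
apply: filterS (ae_sum (index_enum _) p h) => v; rewrite /average => ->.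
rewrite /weighted_part; elim/big_rec3: _ => // a u1 u2 u3 _ ->.
by [].
Qed.

Lemma average_tail (t : R) : 0 < t ->
  (P [set v | (t < cabs (average P H F w mu z v))%R] <=
   (2 * (moment_const F n K * lam ^+ (n * (D + #|F|)) / (t / 2) ^+ n))%:E)%E.
Proof.
move=> t0; have [mA Aae] := average_ae.
have t2 : 0 < t / 2 by rewrite divr_gt0.
have hR := weighted_part_tail ReB (@Re_le_cabs R) (fun a => (cmono a).1) t2.
have hI := weighted_part_tail ImB (@Im_le_cabs R) (fun a => (cmono a).2) t2.
have bR := bmeasurable_weighted_part (@Re_le_cabs R) (fun a => (cmono a).1).
have bI := bmeasurable_weighted_part (@Im_le_cabs R) (fun a => (cmono a).2).
have mtail (S : config -> R) : bmeasurable S ->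
    measurable [set v | (t / 2 < `|S (sample H v)|)%R].
  move=> bS.
  have := measurable_fun_ltr (measurable_cst (t / 2))
    (bmeasurable_norm (bmeasurable_sample mH bS)).1 measurableT (Y := [set true]) Logic.I.
  by rewrite setTI.
have mav : measurable [set v | (t < cabs (average P H F w mu z v))%R].
  have := measurable_fun_ltr (measurable_cst t) (measurable_cabs mA)
    measurableT (Y := [set true]) Logic.I.
  by rewrite setTI.
apply: (@le_trans _ _ (P ([set v | (t / 2 < `|weighted_part (@complex.Re R) (sample H v)|)%R] `|`
   [set v | (t / 2 < `|weighted_part (@complex.Im R) (sample H v)|)%R]))).
  apply: le_measure_ae => //.
    by apply: measurableU; exact: mtail.
  apply: filterS Aae => v /= -> h.
  have := lt_le_trans h (cabs_leD _) => /= h'.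
  have [h1|h1] := ltP (t / 2) `|weighted_part (@complex.Re R) (sample H v)|; [by left|right].
  by rewrite /=; move: h' h1; lra.
apply: le_trans (measureU2 _ _ _) _; [exact: mtail..|].
by apply: le_trans (leeD hR hI) _; rewrite -EFinD lee_fin mulr_natl mulr2n.
Qed.

End fixed_size.

(** * Asymptotics *)

Section asymptotics.
Context (R : realType).

Lemma powR_nat_large (e k : R) : 0 < e -> 0 < k ->
  exists N0 : nat, forall N : nat, (N0 <= N)%N -> N%:R `^ (- e) <= k.
Proof.
move=> e0 k0; exists (Num.bound (k^-1 `^ e^-1)).+1 => N hN.
have B : k^-1 `^ e^-1 <= N%:R.
  apply: le_trans (ltW (archi_boundP (powR_ge0 _ _))) _.
  by rewrite ler_nat ltnW.
have h : k^-1 <= N%:R `^ e.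
  have -> : k^-1 = (k^-1 `^ e^-1) `^ e.
    by rewrite -powRrM mulVf ?gt_eqF// powRr1// invr_ge0 ltW.
  by apply: ge0_ler_powR; rewrite ?nnegrE ?powR_ge0 ?(ltW e0).
by rewrite powRN invf_ple// ?posrE// ?invr_gt0// (lt_le_trans _ h)// invr_gt0.
Qed.

Lemma spectral_im_inv (M gamma e : R) : 1 <= M -> 0 < gamma ->
  M `^ (-1 + gamma) <= e -> 0 < e /\ e^-1 <= M.
Proof.
move=> M1 g0 he; have M0 : 0 < M by rewrite (lt_le_trans _ M1).
have h : M^-1 <= e.
  apply: le_trans he; rewrite -powR_inv1 ?(ltW M0)//.
  by rewrite ler_powR// lerDl ltW.
have e0 : 0 < e by apply: lt_le_trans h; rewrite invr_gt0.
by split => //; rewrite invf_ple ?posrE.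
Qed.

Lemma control_lower (M psi : R) : 1 <= M -> M `^ (- 2^-1) <= psi ->
  1 <= psi ^+ 2 * M /\ M^-1 <= psi.
Proof.
move=> M1 h; have M0 : 0 < M by rewrite (lt_le_trans _ M1).
have h1 : M^-1 <= psi.
  apply: le_trans h; rewrite -powR_inv1 ?(ltW M0)//.
  by rewrite ler_powR//; lra.
split => //; rewrite -ler_pdivrMr// mul1r.
have -> : M^-1 = (M `^ (- 2^-1)) ^+ 2.
  rewrite -powR_mulrn ?powR_ge0// -powRrM mulNr mulVf// powR_inv1//.
  exact: ltW.
by apply: lerXn2r; rewrite ?nnegrE ?powR_ge0// (le_trans _ h1)// invr_ge0 ltW.
Qed.

End asymptotics.

Local Open Scope classical_set_scope.

Theorem proposition6p1 (R : realType) (d : nat -> measure_display)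
    (Omega : forall N, measurableType (d N))
    (P : forall N, probability (Omega N) R)
    (H : forall N, Omega N -> 'M[R[i]]_N)
    (delta : R) (kappa : nat -> R) (gamma : R)
    (dom : nat -> set R[i]) (Psi : nat -> R[i] -> R)
    (Delta : admissible_graph) :
  0 < delta ->
  (forall N, (0 < N)%N -> random_band_matrix (P N) (H N) delta kappa) ->
  0 < gamma ->
  (forall N, (0 < N)%N ->
     dom N `<=` spectral_domain (bandwidth (P N) (H N)) gamma) ->
  admissible_control_parameter (fun N => bandwidth (P N) (H N)) dom Psi ->
  stoch_dominated P dom (fun N z omega => (Lambda (H N omega) z)%:C) Psi ->
  forall F : {set summation_vertex Delta},
    stoch_dominated P
      (fun N => [set u : average_parameter R Delta N |
         adapted_weight (bandwidth (P N) (H N)) (ap_weight u) /\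
         dom N (ap_spectral u)])
      (fun N u => average (P N) (H N) F
         (ap_weight u) (ap_external u) (ap_spectral u))
      (fun N u => Psi N (ap_spectral u) ^+ (degree Delta + #|F|)).
Proof.
move=> delta0 rbm gamma0 hdom [Psi0 [cp cp0 Psib]] hLam F eps D0 eps0 D00.
have [c c0 hc] := stieltjes_semicircle_lower R.
pose D := degree Delta; pose k := (D + #|F|)%N.
(* The loss [N ^ ep] per factor must stay below [N ^ (eps / 2)] after [k]
   factors, and below the decay [N ^ (- delta * cp)] of Psi. *)
pose ep := Num.min (eps / (2 * k.+1%:R)) (delta * cp / 2).
have ep0 : 0 < ep.
  by rewrite lt_min !divr_gt0// ?mulr_gt0.
have epk : ep * k%:R <= eps / 2.
  apply: le_trans (_ : eps / (2 * k.+1%:R) * k%:R <= _).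
    by rewrite ler_wpM2r// ge_min lexx.
  rewrite invfM mulrA -mulrA -[leRHS]mulr1 ler_pM2l ?divr_gt0//.
  by rewrite mulrC ler_pdivrMr// mul1r ler_nat.
have epd : ep - delta * cp <= - ep.
  have : ep <= delta * cp / 2 by rewrite ge_min lexx orbT.
  by lra.
(* [n] is even, and [N ^ (- eps / 2)] to the power [n] beats [N ^ (- D0 - 1)]. *)
pose n := (Num.bound ((D0 + 1) / eps)).+1.*2.
have n0 : (0 < n)%N by [].
have n2 : ~~ odd n by rewrite odd_double.
have neps : D0 + 1 <= eps / 2 * n%:R.
  have h := archi_boundP (_ : 0 <= (D0 + 1) / eps).
  rewrite /n -muln2 natrM; set m := (Num.bound _).+1%:R.
  have -> : eps / 2 * (m * 2) = m * eps by field.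
  rewrite -ler_pdivrMr//.
  apply: le_trans (ltW (h _)) _; last by rewrite ler_nat.
  by rewrite divr_ge0 ?addr_ge0// ltW.
pose b := (n * #|F|)%N.
have [C C0 hC] := monomial_differences_le Delta b c0.
(* The exceptional event has probability below [N ^ (- E)]: this beats the
   bound [N ^ (n D)] on the monomials there and the smallest possible value
   [N ^ (- n (D + b))] of the right-hand side. *)
pose E := (n * D + n * (D + b))%N.
pose C2 : R := (2 ^+ b * 17 ^+ D) ^+ n.
have C20 : 0 <= C2 by rewrite exprn_ge0// mulr_ge0 ?exprn_ge0.
pose K := C ^+ n + C2.
have K0 : 0 <= K by rewrite addr_ge0// exprn_ge0.
pose mc := moment_const F n K.
pose kap := Num.min (c / 2) 1 / 2 ^+ b.
have kap0 : 0 < kap by rewrite divr_gt0 ?exprn_gt0// lt_min ltr01 divr_gt0.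
have [N1 hN1] := hLam ep E.+1%:R ep0 (ltr0Sn _ _).
have [N2 hN2] := powR_nat_large ep0 kap0.
pose N3 := (Num.bound `|2 * mc * 2 ^+ n|).+1.
exists (maxn N1 (maxn N2 N3)) => N; rewrite !geq_max => /and3P[N1N N2N N3N].
have N0 : (0 < N)%N by apply: leq_trans N3N.
pose x : R := N%:R.
have x1 : 1 <= x by rewrite ler1n.
have x0 : 0 < x by rewrite (lt_le_trans _ x1).
have xge1 e : 0 <= e -> 1 <= x `^ e.
  by move=> e0; have := ler_powR x1 e0; rewrite powRr0.
have [mH hH indH _ _ _ /andP[Ml Mu] _] := rbm N N0.
set M := bandwidth (P N) (H N) in Ml Mu.
have M1 : 1 <= M.
  by apply: le_trans Ml; apply: xge1; exact: ltW.
have M0 : 0 < M by rewrite (lt_le_trans _ M1).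
apply: ub_ereal_sup => _ [u [hw hz] <-].
set z := ap_spectral u in hz *.
have [/andP[E1 E2] /andP[e1 e2]] := hdom N N0 z hz.
have [z0 zinv] := spectral_im_inv M1 gamma0 e1.
have cm : c <= cabs (stieltjes_semicircle z).
  by apply: hc; rewrite ?E1 ?E2// z0 e2.
have /andP[Psil Psiu] := Psib N z N0 hz.
have Psip := Psi0 N z N0 hz.
pose lam := x `^ ep * Psi N z.
have lam0 : 0 < lam by rewrite mulr_gt0// powR_gt0.
have Psilam : Psi N z <= lam.
  by rewrite /lam ler_peMl ?(ltW Psip)//; apply: xge1; exact: ltW.
have [lamM lamx] := control_lower M1 (le_trans Psil Psilam).
have lamk : lam <= kap.
  apply: le_trans (hN2 N N2N); rewrite -/x.
  apply: le_trans (_ : x `^ (ep - delta * cp) <= _); last by rewrite ler_powR.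
  rewrite powRD; last by rewrite (gt_eqF x0) implybT.
  rewrite ler_pM2l ?powR_gt0//; apply: le_trans Psiu _.
  rewrite !powRN lef_pV2 ?posrE ?powR_gt0// powRrM.
  by apply: ge0_ler_powR; rewrite ?nnegrE ?powR_ge0 ?(ltW cp0) ?(ltW M0).
have lam2b : 2 ^+ b * lam <= Num.min (c / 2) 1.
  by rewrite mulrC -ler_pdivlMr ?exprn_gt0.
have lc : 2 ^+ b * lam <= c / 2 by apply: le_trans lam2b _; rewrite ge_min lexx.
have l1 : 2 ^+ b * lam <= 1.
  by apply: le_trans lam2b _; rewrite ge_min lexx orbT.
have lam1 : lam <= 1.
  by apply: le_trans l1; rewrite ler_peMl ?(ltW lam0)// exprn_ege1// ler1n.
pose q := x `^ (- E.+1%:R).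
have hq : (P N [set w | (lam < Lambda (H N w) z)%R] <= q%:E)%E.
  apply: le_trans (hN1 N N1N); apply: ereal_sup_ubound; exists z => //.
  congr (P N _); apply/seteqP; split => w /=;
    by rewrite cabs_real ger0_norm// /Lambda bigmax_ge_id.
have qE : q <= x ^- E.
  rewrite /q powRN powR_mulrn ?(ltW x0)// lef_pV2 ?posrE ?exprn_gt0//.
  by rewrite ler_weXn2l.
have hK j : (j <= b)%N -> (C * lam ^+ (D + j)) ^+ n +
      q * (2 ^+ j * (17 * (complex.Im z)^-1) ^+ D) ^+ n <=
    K * (lam ^+ (D + j)) ^+ n.
  move=> jb; rewrite exprMn /K [leRHS]mulrDl lerD2l.
  have zx : (complex.Im z)^-1 <= x by apply: le_trans zinv Mu.
  apply: le_trans (_ : x ^- E * (C2 * x ^+ (n * D)) <= _).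
    apply: ler_pM => //; first exact: powR_ge0.
      by rewrite exprn_ge0// mulr_ge0 ?exprn_ge0// mulr_ge0// invr_ge0 ltW.
    rewrite /C2 mulnC exprM -exprMn -mulrA -exprMn.
    apply: lerXn2r; rewrite ?nnegrE.
    - by rewrite mulr_ge0 ?exprn_ge0// mulr_ge0// invr_ge0 ltW.
    - by rewrite mulr_ge0 ?exprn_ge0// mulr_ge0// ltW.
    apply: ler_pM; rewrite ?exprn_ge0// ?mulr_ge0 ?invr_ge0 ?(ltW z0)//.
      by rewrite ler_weXn2l// ler1n.
    apply: lerXn2r; rewrite ?nnegrE ?mulr_ge0 ?invr_ge0 ?(ltW z0) ?(ltW x0)//.
    by rewrite ler_pM2l.
  rewrite mulrCA ler_wpM2l//.
  rewrite /E exprD invfM mulrAC mulVf ?expf_neq0 ?gt_eqF// mul1r.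
  apply: le_trans (_ : lam ^+ (n * (D + b)) <= _).
    rewrite -exprVn; apply: lerXn2r; rewrite ?nnegrE ?invr_ge0 ?(ltW x0) ?(ltW lam0)//.
    by apply: le_trans lamx; rewrite lef_pV2.
  rewrite -exprM mulnC; apply: ler_wiXn2l; rewrite ?(ltW lam0)//.
  by rewrite leq_mul2r leq_add2l jb orbT.
set t := _ * _ ^+ _.
have t0 : 0 < t by rewrite mulr_gt0 ?powR_gt0// exprn_gt0.
apply: le_trans (average_tail mH hH indH n0 n2 hC C0 M1 lam0 lam1 lamM z0 cm lc l1
  hq K0 hK (ap_external u) hw t0) _.
rewrite lee_fin -/D -/k -/mc.
have ratio : lam ^+ (n * k) / (t / 2) ^+ n <= 2 ^+ n * x `^ (- (D0 + 1)).
  rewrite mulnC exprM -expr_div_n.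
  have -> : lam ^+ k / (t / 2) = 2 * ((x `^ ep) ^+ k / x `^ eps).
    rewrite /lam exprMn /t -/x -/k; field.
    by rewrite gt_eqF ?powR_gt0//= expf_neq0// gt_eqF.
  rewrite exprMn ler_wpM2l ?exprn_ge0//.
  rewrite -powR_mulrn ?powR_ge0// -powRrM -powRN -powRD; last first.
    by rewrite (gt_eqF x0) implybT.
  rewrite -powR_mulrn ?powR_ge0// -powRrM ler_powR//.
  have epk' : ep * k%:R - eps <= - (eps / 2).
    by rewrite lerBlDr (le_trans epk)// [leRHS]addrC {2}(splitr eps) addrK.
  by apply: le_trans (ler_wpM2r (ler0n _ n) epk') _; rewrite mulNr lerN2.
have mcx : 2 * mc * 2 ^+ n <= x.
  apply: le_trans (ler_norm _) _; apply: le_trans (ltW (archi_boundP _)) _ => //.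
  by rewrite ler_nat ltnW.
have mc0 : 0 <= mc.
  have w0 : 0 <= weight_const R (summation_vertex Delta) n.
    by rewrite /weight_const mulr_ge0// exprn_ge0.
  have K1 : 0 <= (4 ^+ n) ^+ (n * #|F| + #|F|) * K.
    by rewrite mulr_ge0// exprn_ge0// exprn_ge0.
  rewrite /mc /moment_const mulr_ge0//; last exact: exprn_ge0.
  by rewrite mulr_ge0 ?exprn_ge0// mulr_ge0.
rewrite -(mulrA mc) mulrA.
apply: le_trans (_ : 2 * mc * (2 ^+ n * x `^ (- (D0 + 1))) <= _).
  by rewrite ler_wpM2l// mulr_ge0.
rewrite mulrA opprD powRD; last by rewrite (gt_eqF x0) implybT.
rewrite powR_inv1 ?(ltW x0)// mulrCA -[leRHS]mulr1 ler_wpM2l ?powR_ge0//.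
by rewrite ler_pdivrMr// mul1r.
Qed.
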